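(* Let $m,n\ge1$, let $q_1,\dots,q_n$ be monomials in $\mathbb{C}\langle X_1,\dots,X_m\rangle$ and $V_t=\sum_{i=1}^n t_i(q_i+q_i^* )$ for $t\in\mathbb{R}^n$. Assume that there exist a convex neighborhood $U\subset\mathbb{R}^n$ of the origin, a finite real number $R$ and a family $\{\tau_t,\ t\in U\}\subset\mathbb{C}\langle X_1,\dots,X_m\rangle^*$ such that for all $t\in U$, $\tau_t$ is a solution of $\mathbf{SD}[V_t]$ with $|\tau_t(X_{i_1}\cdots X_{i_k})|\le R^k$ for all $k\in\mathbb{N}$ and all $i_1,\dots,i_k\in\{1,\dots,m\}$. Then: 1. For any $P\in\mathbb{C}\langle X_1,\dots,X_m\rangle$, $t\in U\mapsto\tau_t(P)$ is $C^\infty$ at the origin in the sense that for all $k=(k_1,\dots,k_n)\in\mathbb{N}^n$ there exists $\epsilon(k_1+\cdots+k_n)>0$ so that $\partial_{t_1}^{k_1}\cdots\partial_{t_n}^{k_n}\tau_t(P)$ exists on $U\cap B(0,\epsilon(k_1+\cdots+k_n))$. Let $\tau^{k}(P)=(-1)^{k_1+\cdots+k_n}\partial_{t_1}^{k_1}\cdots\partial_{t_n}^{k_n}\tau_t(P)|_{t=0}$. Then for all $P\in\mathbb{C}\langle X_1,\dots,X_m\rangle$ and all $i\in\{1,\dots,m\}$, $$\tau^{k}(X_iP)=\sum_{0\le p_j\le k_j,\ 1\le j\le n}\ \prod_{j=1}^n\binom{k_j}{p_j}\ \tau^{p}\otimes\tau^{k-p}(D_iP)+\sum_{1\le j\le n}k_j\,\tau^{k-1_j}\big((\mathcal{D}_iq_j+\mathcal{D}_iq_j^*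 )P\big),$$ where $p=(p_1,\dots,p_n)$, $1_j(i)=1_{i=j}$ (terms with $k_j=0$ in the last sum being $0$), and $\tau^{k}(1)=1_{k=0}$. 2. For any monomial $P\in\mathbb{C}\langle X_1,\dots,X_m\rangle$ and any $k_1,\dots,k_n\in\mathbb{N}$, $\tau^{k}(P)=\mathcal{M}(P,(q_1,k_1),\dots,(q_n,k_n))$.
   Context: **Non-commutative polynomials.** $\mathbb{C}\langle X_1,\dots,X_m\rangle$ is the algebra of polynomials in $m$ self-adjoint non-commutative variables, with involution $(zX_{i_1}\cdots X_{i_p})^*=\bar z X_{i_p}\cdots X_{i_1}$. A monomial is a word $X_{i_1}\cdots X_{i_p}$. $\mathbb{C}\langle X_1,\dots,X_m\rangle^*$ denotes the set of linear forms $\tau$ with $\tau(a^* )=\overline{\tau(a)}$. $D_i$ and $\mathcal{D}_i$ are the linear maps given on monomials by $D_iP=\sum_{P=P_1X_iP_2}P_1\otimes P_2$ and $\mathcal{D}_iP=\sum_{P=P_1X_iP_2}P_2P_1$. $B(0,\epsilon)=\{t\in\mathbb{R}^n:\max_i|t_i|\le\epsilon\}$. $\mathbb{N}$ contains $0$. **Schwinger–Dyson equation.** $\tau$ satisfies $\mathbf{SD}[V]$ if $\tau(1)=1$ and $\tau\otimes\tau(D_iP)=\tau((\mathcal{D}_iV+X_i)P)$ for all $i\in\{1,\dots,m\}$ and $P\in\mathbb{C}\langle X_1,\dots,X_m\rangle$. **Maps.** A star of type $q=X_{i_1}\cdots X_{i_l}$ is a vertex with $l$ branches (half-edges), listed clockwise,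 the $k$-th branch having color $i_k$, the first branch being marked; the star of type $1$ is a point. A planar map built on a finite collection of labeled stars is a connected graph embedded in the sphere obtained by gluing each branch to exactly one other branch of the same color so that the edges do not cross; maps are considered up to orientation-preserving homeomorphisms of the sphere respecting labels, colors and marked branches (equivalently, one counts color-preserving perfect matchings of the branches whose associated ribbon graph is connected of genus $0$; a single point counts as one map). $\mathcal{M}_0((q_1,k_1),\dots,(q_n,k_n))$ is the number of planar maps built with $k_i$ stars of type $q_i$ (all stars labeled; the $q_i$ not necessarily distinct); e.g. $\mathcal{M}_0((X^4,2))=36$. $\mathcal{M}_0(P,\dots)$ means there is in addition one star of type $P$. The number of planar maps with $k_i$ stars of type $q_i$ or $q_i^*$ and one star of type $P$ is $$\mathcal{M}(P,(q_1,k_1),\dots,(q_n,k_n))=\sum_{0\le p_i\le k_i,\,1\le i\le n}\ \prod_{i=1}^n\binom{k_i}{p_i}\ \mathcal{M}_0(P,(q_1,p_1),(q_1^*,k_1-p_1),\dots,(q_n,p_n),(q_n^*,k_n-p_n)).$$ *)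

(* Defs.v *)
From mathcomp Require Import all_boot all_order all_algebra fingroup perm complex.
From mathcomp Require Import finmap monalg.
From mathcomp Require Import all_classical reals topology normedtype derive convex.

Set Implicit Arguments.
Unset Strict Implicit.
Unset Printing Implicit Defensive.

Import Order.TTheory GRing.Theory Num.Theory.
Import numFieldNormedType.Exports.
Local Open Scope classical_set_scope.
Local Open Scope ring_scope.

Notation word m := {fmonom 'I_m}.

Definition wrev (m : nat) (w : word m) : word m := FMonom (rev w).

Definition lin_ext (A : nzRingType) (K : choiceType) (V : lmodType A)
    (F : K -> V) (P : {malg A[K]}) : V :=
  \sum_(w <- msupp P) P@_w *: F w.

(* C<X_1, ..., X_m> is the monoid algebra of the free monoid over C = R[i]. *)
Notation ncpoly R m := {malg R[i][word m]}.

(* The tensor square of C<X_1, ..., X_m> has the pairs of words as a basis. *)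
Notation ncpoly2 R m := {malg R[i][(word m * word m)%type]}.

Section NCPoly.
Variables (R : realType) (m : nat).

Definition ncX (i : 'I_m) : ncpoly R m := << fmu i >>.

Definition ncstar (P : ncpoly R m) : ncpoly R m :=
  \sum_(w <- msupp P) << (P@_w)^* *g wrev w >>.

Definition selfadjoint_form (tau : ncpoly R m -> R[i]) : Prop :=
  forall P, tau (ncstar P) = (tau P)^*.

(* D_i: a factorization w = w1 X_i w2 is a position k of w with letter i. *)
Definition ncdiff_word (i : 'I_m) (w : word m) : ncpoly2 R m :=
  \sum_(k < size w | tnth (in_tuple w) k == i)
    << (FMonom (take k w), FMonom (drop k.+1 w)) >>.

Definition ncdiff (i : 'I_m) (P : ncpoly R m) : ncpoly2 R m :=
  lin_ext (ncdiff_word i) P.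

(* The cyclic derivative: w1 X_i w2 is sent to w2 w1. *)
Definition cycdiff_word (i : 'I_m) (w : word m) : ncpoly R m :=
  \sum_(k < size w | tnth (in_tuple w) k == i)
    << FMonom (drop k.+1 w ++ take k w) >>.

Definition cycdiff (i : 'I_m) (P : ncpoly R m) : ncpoly R m :=
  lin_ext (cycdiff_word i) P.

(* This is tau (x) sigma when tau and sigma are linear. *)
Definition tensor_form (tau sigma : ncpoly R m -> R[i]) (Q : ncpoly2 R m) :
    R[i] :=
  \sum_(w <- msupp Q) Q@_w * (tau << w.1 >> * sigma << w.2 >>).

Definition schwinger_dyson (V : ncpoly R m) (tau : ncpoly R m -> R[i]) : Prop :=
  tau 1 = 1 /\
  forall (i : 'I_m) (P : ncpoly R m),
    tensor_form tau tau (ncdiff i P) = tau ((cycdiff i V + ncX i) * P).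

Definition potential (n : nat) (q : 'I_n -> word m) (t : 'rV[R]_n) :
    ncpoly R m :=
  \sum_(j < n) (t ord0 j)%:C%C *: (<< q j >> + ncstar << q j >>).

End NCPoly.

Section PartialDerivatives.
Variables (R : realType) (n : nat).
Implicit Types (f : 'rV[R]_n -> R[i]) (x : 'rV[R]_n) (i : 'I_n).

Local Notation e i := (delta_mx ord0 i : 'rV[R]_n).

(* Derivatives of complex-valued functions of real variables are taken on the
   real and imaginary parts. *)
Definition pderivable f i x : Prop :=
  derivable (fun y => complex.Re (f y)) x (e i) /\
  derivable (fun y => complex.Im (f y)) x (e i).

Definition pderiv i f : 'rV[R]_n -> R[i] := fun x =>
  ('D_(e i) (fun y => complex.Re (f y)) x
   +i* 'D_(e i) (fun y => complex.Im (f y)) x)%C.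

(* For s = [:: i1; ...; ir], the iterated derivative d_i1 (... (d_ir f)). *)
Definition pderivs (s : seq 'I_n) f : 'rV[R]_n -> R[i] := foldr pderiv f s.

(* Since 'D is a total operator, existence has to be tracked separately: d_i g
   exists at x if g exists around x and has a partial derivative at x. *)
Fixpoint pderivs_exist (s : seq 'I_n) f x : Prop :=
  if s is i :: s' then
    (\forall y \near x, pderivs_exist s' f y) /\ pderivable (pderivs s' f) i x
  else True.

(* [:: 1 (k_1 times); ...; n (k_n times)], that is d_1^k_1 ... d_n^k_n. *)
Definition mi_dirs (k : 'I_n -> nat) : seq 'I_n :=
  flatten [seq nseq (k i) i | i <- enum 'I_n].

End PartialDerivatives.

Section MultiIndices.
Variable n : nat.
Implicit Types k p : 'I_n -> nat.

Definition mi_deg k : nat := (\sum_(j < n) k j)%N.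

(* The multi-indices p with p_j <= k_j for all j; the bound mi_deg k on the
   entries of p is implied and only makes the index set a finite type. *)
Definition mi_le k : {set {ffun 'I_n -> 'I_(mi_deg k).+1}} :=
  [set p : {ffun 'I_n -> 'I_(mi_deg k).+1} | [forall j, (p j <= k j)%N]]%SET.

Definition mi_sub k p : 'I_n -> nat := fun j => (k j - p j)%N.

Definition mi_unit (j : 'I_n) : 'I_n -> nat := fun i => (i == j : nat).

Definition mi_bin k p : nat := (\prod_(j < n) 'C(k j, p j))%N.

End MultiIndices.

Definition tau_mi (R : realType) (m n : nat)
    (tau : 'rV[R]_n -> ncpoly R m -> R[i]) (k : 'I_n -> nat)
    (P : ncpoly R m) : R[i] :=
  (-1) ^+ mi_deg k * pderivs (mi_dirs k) (fun t => tau t P) 0.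

Section Maps.
Variable m : nat.
Implicit Types S : seq (word m).

(* A map is built on the labeled stars S_0, S_1, ...: a branch is a pair (star,
   position in the clockwise order starting from the marked branch). *)
Definition branch S : finType :=
  {j : 'I_(size S) & 'I_(size (tnth (in_tuple S) j))}.

Definition branch_color S (b : branch S) : 'I_m :=
  tnth (in_tuple (tnth (in_tuple S) (tag b))) (tagged b).

Definition next_branch_fun S (b : branch S) : branch S :=
  Tagged (fun j => 'I_(size (tnth (in_tuple S) j))) (ordS (tagged b)).

Lemma next_branch_inj S : injective (@next_branch_fun S).
Proof.
move=> [j k] [j' k'] /eqP; rewrite -tag_eqE /tag_eq /= => /andP[/eqP jj'].
by subst j'; rewrite tagged_asE => /eqP /ordS_inj ->.
Qed.

Definition next_branch S : {perm branch S} := perm (@next_branch_inj S).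

Definition matching S (alpha : {perm branch S}) : bool :=
  [forall b, [&& alpha b != b, alpha (alpha b) == b
               & branch_color (alpha b) == branch_color b]].

Definition map_connected S (alpha : {perm branch S}) : bool :=
  let adj := [rel j j' : 'I_(size S) |
                [exists b, (tag b == j) && (tag (alpha b) == j')]] in
  [forall j, forall j', connect adj j j'].

(* Faces are the cycles of (gluing, then rotation); a star without branches is
   drawn as a point and has one face of its own. *)
Definition map_faces S (alpha : {perm branch S}) : nat :=
  (#|porbits (alpha * next_branch S)%g| + count (fun w : word m => nilp w) S)%N.

(* Euler's relation V - E + F = 2, for a connected map; the edges are the
   two-element cycles of the matching. *)
Definition genus0 S (alpha : {perm branch S}) : bool :=
  (size S + map_faces alpha == #|porbits alpha| + 2)%N.

Definition planar_maps S : nat :=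
  #|[set alpha : {perm branch S} |
      [&& matching alpha, map_connected alpha & genus0 alpha]]%SET|.

Definition stars (l : seq (word m * nat)) : seq (word m) :=
  flatten [seq nseq qk.2 qk.1 | qk <- l].

Definition M0 (l : seq (word m * nat)) : nat := planar_maps (stars l).

(* Among the k_j stars of type q_j or q_j^*, p_j are of type q_j. *)
Definition M (n : nat) (P : word m) (q : 'I_n -> word m) (k : 'I_n -> nat) :
    nat :=
  (\sum_(p in mi_le k) mi_bin k (fun j => p j) *
    M0 ((P, 1) ::
        flatten [seq [:: (q j, val (p j)); (wrev (q j), k j - p j)]
                | j <- enum 'I_n]))%N.

End Maps.

(* Main.v *)
Require Import Defs.
From mathcomp Require Import all_boot all_order all_algebra fingroup perm complex.
From mathcomp Require Import finmap monalg.
From mathcomp Require Import all_classical reals topology normedtype derive convex.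
From mathcomp Require Import ring lra zify.

Set Implicit Arguments.
Unset Strict Implicit.
Unset Printing Implicit Defensive.

Import Order.TTheory GRing.Theory Num.Theory.
Import numFieldNormedType.Exports.
Local Open Scope ring_scope.

(** The moments x_t(w) = tau_t(w) of words satisfy a closed system: x_t(i w) is a sum of
    products over the occurrences of i in w, minus t_j times moments of words derived from
    q_j. In the norm sup_w |y(w)| / G^|w| with G large, and then t small, the linearization
    of this system is a contraction. This makes the moments real, makes their difference
    quotients Cauchy, and, differentiating the system and iterating, gives derivatives of
    every order on smaller and smaller boxes; at t = 0 the differentiated system is the
    recursion on the tau^k. Derivatives are indexed by sequences of directions instead of
    multi-indices, so that the Leibniz rule is a sum over the ways of splitting a sequence
    into two complementary subsequences.

    The numbers of planar maps satisfy the same recursion: contract the edge of the first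
    branch of the root star. If it joins the root to another star, the two stars merge; if
    it is a loop, the root star is cut into two. To avoid separating the resulting
    components, maps with several root stars are counted, with the requirement that every
    component contains a root and that the Euler characteristic is twice the number of
    roots: by Euler's inequality this forces the roots to lie in different planar
    components. *)

(** In the linearized sum over cuts one factor grows like G^|w| and the other like rho^|w|, with rho
    < G. Summed over positions this is a geometric sum of order G^|w| / (G - rho), to be compared
    with G^(|w|+1): the gap between the two rates makes it small. The terms in t have size |t| G^d,
    where d bounds the lengths of the q_j, so t is made small only after G is chosen. The iteration
    needs a finite norm to start from; the exponential bound on the moments provides it, and its
    value is forgotten in the limit, so that for difference quotients even a bound of order 1/|h|
    will do. Each derivative raises the growth rate, hence G, hence shrinks the box: this is why
    epsilon depends on the total order. On the side of maps, a loop leaves two root words, among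
    which the remaining stars have to be distributed. Keeping a list of roots makes the recursion
    linear; the distribution reappears as the Leibniz splittings when the count for a list of roots
    is identified with a coefficient of a product of moments. *)

Section Lists.
Variable A : Type.

Fixpoint splits (s : seq A) : seq (seq A * seq A) :=
  if s is x :: s' then [seq (x :: p.1, p.2) | p <- splits s'] ++
                       [seq (p.1, x :: p.2) | p <- splits s']
  else [:: ([::], [::])].

Fixpoint picks (s : seq A) : seq (A * seq A) :=
  if s is x :: s' then (x, s') :: [seq (p.1, x :: p.2) | p <- picks s']
  else [::].

Fixpoint cuts (s : seq A) : seq (seq A * A * seq A) :=
  if s is x :: s' then
    ([::], x, s') :: [seq (x :: p.1.1, p.1.2, p.2) | p <- cuts s']
  else [::].

End Lists.

(** * Contraction of an edge *)

Section Cyc.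
Local Open Scope group_scope.
Variable T : finType.
Implicit Types (x y a b : T) (s w u v : seq T) (L : seq (seq T)) (p : {perm T}).

(* The cycle sending each element of s to the next one; locked, as unification would
   otherwise unfold it when rewriting products. *)
Fixpoint cyc_rec s : {perm T} :=
  if s is x :: s' then cyc_rec s' * tperm x (head x s') else 1.

Definition cyc := locked cyc_rec.

Lemma cyc0 : cyc [::] = 1. Proof. by rewrite /cyc -lock. Qed.

Lemma cyc_cons x s : cyc (x :: s) = cyc s * tperm x (head x s).
Proof. by rewrite /cyc -lock. Qed.

Lemma cyc1 x : cyc [:: x] = 1. Proof. by rewrite cyc_cons tperm1 cyc0 mulg1. Qed.

Lemma cyc_out x s : x \notin s -> cyc s x = x.
Proof.
elim: s => [|y s IH]; first by rewrite cyc0 perm1.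
rewrite cyc_cons inE negb_or => /andP[xy xs].
rewrite permM IH // tpermD //; first by rewrite eq_sym.
by case: s xs {IH} => [|z s] /=; rewrite ?inE ?negb_or eq_sym // => /andP[].
Qed.

Lemma cyc_last x s : cyc (x :: s) (last x s) = x.
Proof.
elim: s x => [|y s IH] x; first by rewrite cyc1 perm1.
by rewrite cyc_cons permM IH tpermR.
Qed.

(** Conjugation by [cyc s] carries the transposition across and turns the last element of [s] into
    its head. *)
Lemma cyc_consl x s : x \notin s -> cyc (x :: s) = tperm x (last x s) * cyc s.
Proof.
case: s => [|y s] xs; first by rewrite cyc1 cyc0 tperm1 mulg1.
by rewrite conjgC tpermJ cyc_out // cyc_last cyc_cons.
Qed.

Lemma commute_cyc s p : (forall x, x \in s -> p x = x) -> commute (cyc s) p.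
Proof.
elim: s => [|y s IH] h; first by rewrite cyc0; apply/commute_sym/commute1.
rewrite cyc_cons.
apply/commute_sym/commuteM.
  by apply/commute_sym/IH => x xs; apply: h; rewrite inE xs orbT.
rewrite /commute [RHS]conjgC tpermJ !h //; last by rewrite inE eqxx.
by case: s {IH h} => [|z s] /=; rewrite !inE eqxx ?orbT.
Qed.

Lemma commute_cyc2 s1 s2 : ~~ has (mem s1) s2 -> commute (cyc s1) (cyc s2).
Proof.
move/hasPn => h; apply: commute_cyc => x xs; apply: cyc_out.
by apply/negP => /h /=; rewrite xs.
Qed.

(** A transposition joins two disjoint cycles into one, or cuts the long cycle when it is multiplied
    once more: the algebra behind both ways of contracting an edge. *)
Lemma cyc_cat x s1 y s2 : uniq (x :: s1 ++ y :: s2) ->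
  cyc (x :: s1 ++ y :: s2) = cyc (x :: s1) * cyc (y :: s2) * tperm x y.
Proof.
elim: s1 x => [|z s1 IH] x; first by rewrite cyc1 cyc_cons mul1g.
move=> un; have /andP[xn un'] := un.
transitivity (cyc (z :: s1 ++ y :: s2) * tperm x z); first by rewrite cyc_cons.
transitivity (cyc (z :: s1) * tperm x z * cyc (y :: s2) * tperm x y); last by rewrite (cyc_cons x).
rewrite (IH z un').
have: commute (cyc (y :: s2)) (tperm x z).
  apply: commute_cyc => u us; rewrite tpermD //.
    by apply: contraNneq xn => ->; rewrite inE mem_cat us !orbT.
  by move: un' => /andP[+ _]; apply: contraNneq => ->; rewrite mem_cat us !orbT.
move: (cyc (z :: s1)) (cyc (y :: s2)) => c1 c2 c2C.
rewrite -[RHS]mulgA -!(mulgA c1) (mulgA (tperm x z)) -c2C -!mulgA; congr (_ * (_ * _)).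
(* What is left is an identity between products of transpositions of the three distinct points [x],
   [y], [z]. *)
apply/permP => u; rewrite !permM.
have nxz : x != z by apply: contraNneq xn => ->; rewrite inE eqxx.
have nxy : x != y by apply: contraNneq xn => ->; rewrite inE mem_cat inE eqxx !orbT.
have nzy : z != y.
  by move: un' => /andP[+ _]; apply: contraNneq => ->; rewrite mem_cat inE eqxx !orbT.
by do 4![case: tpermP => //=; try by move=> *; subst; rewrite ?eqxx in nxz nxy nzy *];
   move=> *; subst; rewrite ?eqxx in nxz nxy nzy *.
Qed.

End Cyc.

Section Contraction.
Local Open Scope group_scope.
Variable T : finType.
Implicit Types (x y a b : T) (s w u v : seq T) (L : seq (seq T)) (p r : {perm T}).

Lemma cyc_catC u v : uniq (u ++ v) -> cyc (u ++ v) = cyc (v ++ u).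
Proof.
case: u => [|x u]; first by rewrite cats0.
case: v => [|y v] un; first by rewrite cats0.
rewrite !cat_cons !cyc_cat -?cat_cons // 1?uniq_catC // tpermC.
by rewrite (commute_cyc2 (s1 := x :: u)) //; move: un; rewrite cat_uniq => /and3P[_ /hasPn h _];
   apply/hasPn.
Qed.

(** Once removed from the star, [x] is an orbit of its own, cut off from the orbit it belonged to.
    If [x] was alone in its star nothing changes, hence the correction [~~ nilp s]. *)
Lemma card_porbits_cyc_cons x s p : x \notin s -> p x = x ->
  (#|porbits (cyc (x :: s) * p)| + ~~ nilp s = #|porbits (cyc s * p)|)%N.
Proof.
move=> xs px; case: s xs => [|y s] xs.
  by rewrite addn0 cyc1 cyc0.
rewrite cyc_consl // -mulgA /=.
have lx : x != last y s by apply: contraNneq xs => ->; exact: mem_last.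
have := porbits_mul_tperm (cyc (y :: s) * p) x (last y s).
rewrite /= lx; suff -> : x \notin porbit (cyc (y :: s) * p) (last y s).
  by move/eqP; rewrite -[1.*2]/(1 + 1)%N addnA eqn_add2r => /eqP.
have fx : (cyc (y :: s) * p) x = x by rewrite permM cyc_out.
rewrite porbit_sym; apply: contraNN lx => /porbitP[i ->]; apply/eqP.
by elim: i => [|i IH]; rewrite ?expg0 ?perm1 // expgSr permM -IH fx.
Qed.

Definition starperm L : {perm T} := \prod_(s <- L) cyc s.

Lemma starperm_cons s L : starperm (s :: L) = cyc s * starperm L.
Proof. by rewrite /starperm big_cons. Qed.

Lemma starperm_cat L1 L2 : starperm (L1 ++ L2) = starperm L1 * starperm L2.
Proof. by rewrite /starperm big_cat. Qed.

Lemma starperm_out x L : x \notin flatten L -> starperm L x = x.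
Proof.
elim: L => [|s L IH] /=; first by rewrite /starperm big_nil perm1.
by rewrite mem_cat negb_or starperm_cons permM => /andP[xs /IH]; rewrite cyc_out.
Qed.

Lemma commute_starperm L p : (forall x, x \in flatten L -> p x = x) ->
  commute (starperm L) p.
Proof.
elim: L => [|s L IH] h.
  by rewrite /starperm big_nil; apply/commute_sym/commute1.
rewrite starperm_cons; apply/commute_sym/commuteM; apply/commute_sym.
  by apply: commute_cyc => x xs; rewrite h //= mem_cat xs.
by apply: IH => x xs; rewrite h //= mem_cat xs orbT.
Qed.

Lemma starperm_catCA L1 s L2 : uniq (flatten (L1 ++ s :: L2)) ->
  starperm (L1 ++ s :: L2) = cyc s * starperm (L1 ++ L2).
Proof.
move=> un; rewrite !starperm_cat starperm_cons !mulgA; congr (_ * _).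
apply: commute_starperm => x xL; apply: cyc_out; apply/negP => xs.
move: un; rewrite flatten_cat cat_uniq => /and3P[_ /hasPn h _].
by move: (h x); rewrite /= mem_cat xs /= xL => /(_ isT).
Qed.

(* V + F for the stars L and the gluing p. The elements of T outside of L are also counted,
   as fixed points, but they contribute as much to #|porbits p|, which stands for E. *)
Definition vf L p : nat := size L + count (@nilp T) L + #|porbits (starperm L * p)|.

(** The remaining gluing [tperm a b * p] fixes [a] and [b], and the transposition split off can be
    absorbed into the cycles of the stars. *)
Lemma starperm_edge a b L p : p a = b -> p b = a ->
  starperm L * p = starperm L * tperm a b * (tperm a b * p).
Proof. by rewrite mulgA -(mulgA (starperm L)) tperm2 mulg1. Qed.

Lemma card_porbits_edge a b p : a != b -> p a = b -> p b = a ->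
  #|porbits (tperm a b * p)| = #|porbits p|.+1.
Proof.
move=> ab pa pb; have := porbits_mul_tperm p a b.
have -> : a \in porbit p b by apply/porbitP; exists 1%N; rewrite expg1.
by rewrite /= ab addn0 addn1.
Qed.

Lemma edge_fix a b p : p a = b -> p b = a ->
  (tperm a b * p) a = a /\ (tperm a b * p) b = b.
Proof. by move=> pa pb; rewrite !permM tpermL tpermR. Qed.

(** A loop cuts its star in two: one more star, and one more orbit for each of the deleted [a] and
    [b]. When [w1] or [w2] is empty the orbit is missing, but the face of the new isolated point
    replaces it. As [#|porbits p|] grows by one, V - E + F grows by two, the allowance of one more
    root. *)
Lemma vf_split a w1 b w2 L p :
    uniq (flatten ((a :: w1 ++ b :: w2) :: L)) -> p a = b -> p b = a ->
  vf (w1 :: w2 :: L) (tperm a b * p) = (vf ((a :: w1 ++ b :: w2) :: L) p + 3)%N.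
Proof.
move=> un pa pb; rewrite /vf (starperm_edge _ pa pb) /=.
have [fa fb] := edge_fix pa pb.
move: (tperm a b * p) fa fb => r fa fb; rewrite !starperm_cons.
have [aL bL] : a \notin flatten L /\ b \notin flatten L.
  move: un; rewrite [flatten _]/= -cat_cons cat_uniq => /and3P[_ /hasPn h _].
  by split; apply/negP => xL; move: (h _ xL); rewrite /= ?mem_cat !inE ?mem_cat ?inE eqxx ?orbT.
have un1 : uniq (a :: w1 ++ b :: w2).
  by move: un; rewrite [flatten _]/= -cat_cons cat_uniq => /and3P[].
rewrite -(mulgA (cyc (a :: w1 ++ b :: w2)) (starperm L)) (commute_starperm (p := tperm a b)); last first.
  by move=> x xL; rewrite tpermD //; apply: contraTneq xL => <-.
rewrite cyc_cat // -!mulgA (mulgA (tperm a b)) tperm2 mul1g.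
have [aw1 aw2 bw1 bw2] : [/\ a \notin w1, a \notin b :: w2, b \notin w1 & b \notin w2].
  move: un1; rewrite /= mem_cat cat_uniq /= !negb_or.
  by case/andP => /andP[? ?] /and3P[_ /andP[? _] /andP[? _]].
have := @card_porbits_cyc_cons a w1 (cyc (b :: w2) * (starperm L * r)) aw1.
rewrite !permM cyc_out // starperm_out // => /(_ fa).
have -> : cyc w1 * (cyc (b :: w2) * (starperm L * r)) =
          cyc (b :: w2) * (cyc w1 * (starperm L * r)).
  rewrite !mulgA (commute_cyc2 (s1 := w1)) //; apply/hasPn => x xw2; apply/negP => /= xw1.
  move: un1 => /= /andP[_]; rewrite cat_uniq => /and3P[_ /hasPn h _].
  by move: (h _ xw2) => /negP; rewrite /= xw1.
have := @card_porbits_cyc_cons b w2 (cyc w1 * (starperm L * r)) bw2.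
rewrite !permM cyc_out // starperm_out // => /(_ fb).
have -> : cyc w1 * (cyc w2 * (starperm L * r)) =
          cyc w2 * (cyc w1 * (starperm L * r)).
  rewrite !mulgA (commute_cyc2 (s1 := w1)) //; apply/hasPn => x xw2; apply/negP => /= xw1.
  move: un1 => /= /andP[_]; rewrite cat_uniq => /and3P[_ /hasPn h _].
  by move: (h x); rewrite /= inE xw2 orbT xw1 => /(_ isT).
move=> <- <-; move: #|_| (count _ L) (size L) => z k l.
by case: (nilp w1); case: (nilp w2) => /=; lia.
Qed.

(** Two stars become one, and deleting [a] and [b] adds two orbits (or one orbit and an isolated
    point). As [#|porbits p|] grows by one too, V - E + F does not change. *)
Lemma vf_merge a w A u b v B p :
    uniq (flatten ((a :: w) :: A ++ (u ++ b :: v) :: B)) -> p a = b -> p b = a ->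
  vf ((v ++ u ++ w) :: A ++ B) (tperm a b * p) =
  (vf ((a :: w) :: A ++ (u ++ b :: v) :: B) p + 1)%N.
Proof.
move=> un pa pb; rewrite /vf (starperm_edge _ pa pb) /=.
have [fa fb] := edge_fix pa pb.
move: (tperm a b * p) fa fb => r fa fb; rewrite !starperm_cons.
have pe : perm_eq (flatten ((a :: w) :: A ++ (u ++ b :: v) :: B))
                  ((a :: w ++ b :: v ++ u) ++ flatten (A ++ B)).
  have fc s L : flatten (s :: L) = s ++ flatten L by [].
  by apply/seq.permP => x; rewrite !(fc, flatten_cat, count_cat) /= !(count_cat, flatten_cat) /= !count_cat; lia.
have un1 := un; rewrite (perm_uniq pe) in un1.
have [un2 aL bL] : [/\ uniq (a :: w ++ b :: v ++ u), a \notin flatten (A ++ B)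
    & b \notin flatten (A ++ B)].
  move: un1; rewrite cat_uniq => /and3P[un2 /hasPn h _]; split=> //.
    by apply/negP => xL; move: (h _ xL); rewrite /= !inE eqxx.
  by apply/negP => xL; move: (h _ xL); rewrite /= !(inE, mem_cat) eqxx !orbT.
have un3 : uniq (flatten (A ++ (u ++ b :: v) :: B)).
  by move: un; rewrite /= cat_uniq => /andP[_ /and3P[]].
have -> : cyc (a :: w) * starperm (A ++ (u ++ b :: v) :: B) * tperm a b
        = cyc (a :: w ++ b :: v ++ u) * starperm (A ++ B).
  rewrite starperm_catCA // -!mulgA (commute_starperm (p := tperm a b)); last first.
    by move=> x xL; rewrite tpermD //; apply: contraTneq xL => <-.
  rewrite !mulgA; congr (_ * _).
  rewrite cyc_cat // -!mulgA; congr (_ * _).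
  rewrite cyc_catC //.
  by move: un3; rewrite flatten_cat /= !cat_uniq => /and3P[_ _ /and3P[]].
have [aw bwvu] : a \notin w ++ b :: v ++ u /\ b \notin v ++ u ++ w.
  move: un2; rewrite cons_uniq => /andP[->]; rewrite uniq_catC cat_cons cons_uniq -catA => /andP[bb _].
  by split=> //; rewrite catA mem_cat negb_or; move: bb; rewrite !mem_cat !negb_or => /and3P[-> -> ->].
have := @card_porbits_cyc_cons a _ (starperm (A ++ B) * r) aw.
rewrite !permM starperm_out // => /(_ fa).
rewrite !mulgA cyc_catC; last by move: un2; rewrite cons_uniq => /andP[].
rewrite [(_ :: _) ++ _]/= -catA.
have := @card_porbits_cyc_cons b _ (starperm (A ++ B) * r) bwvu.
rewrite !permM starperm_out // => /(_ fb); rewrite !mulgA => <-.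
have -> : nilp (w ++ b :: v ++ u) = false by case: (w).
rewrite !size_cat !count_cat /= => <-.
move: #|_| (count _ A) (count _ B) => z k l.
have -> : nilp (u ++ b :: v) = false by case: (u).
by case: (nilp _) => /=; lia.
Qed.

End Contraction.

Section ListLemmas.
Variables (A B : eqType).
Implicit Types (s : seq A).

Lemma cutsP s q : q \in cuts s -> s = q.1.1 ++ q.1.2 :: q.2.
Proof.
elim: s q => [|x s IH] q //=; rewrite inE => /orP[/eqP-> //|/mapP[q' /IH {}IH ->]].
by rewrite /= -IH.
Qed.

Lemma picksP s q : q \in picks s ->
  exists s1 s2, s = s1 ++ q.1 :: s2 /\ q.2 = s1 ++ s2.
Proof.
elim: s q => [|x s IH] q //=; rewrite inE.
case/orP=> [/eqP-> //|/mapP[q' /IH [s1 [s2 [-> e2]]] ->]]; first by exists [::], s.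
by exists (x :: s1), s2; rewrite /= e2.
Qed.

End ListLemmas.

Lemma cuts_letters A (s : seq A) : [seq q.1.2 | q <- cuts s] = s.
Proof. by elim: s => [|x s IH] //=; rewrite -map_comp -{2}IH; congr cons; apply: eq_map. Qed.

Lemma picks_fst A (s : seq A) : [seq q.1 | q <- picks s] = s.
Proof. by elim: s => [|x s IH] //=; rewrite -map_comp -{2}IH; congr cons; apply: eq_map. Qed.

Lemma cuts_map A B (f : A -> B) s :
  cuts (map f s) = [seq (map f q.1.1, f q.1.2, map f q.2) | q <- cuts s].
Proof. by elim: s => [|x s IH] //=; rewrite IH -!map_comp; congr cons; apply: eq_map. Qed.

Lemma picks_map A B (f : A -> B) s :
  picks (map f s) = [seq (f q.1, map f q.2) | q <- picks s].
Proof. by elim: s => [|x s IH] //=; rewrite IH -!map_comp; congr cons; apply: eq_map. Qed.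

(** * Gluings with several roots *)

Section Planar.
Variables (T : finType) (I : eqType) (c : T -> I).
Implicit Types (x y a b : T) (s w u v : seq T) (ws Ss L : seq (seq T)).
Implicit Types (p r : {perm T}) (D : {set T}).

(** Branches outside of [d] stay in [T] as fixed points, so that contracting an edge changes the
    stars but not the type on which permutations act. *)
Definition gluing (d : seq T) p : bool :=
  [forall x, [&& (p x == x) == (x \notin d), p (p x) == x & c (p x) == c x]].

(* Every component contains a root star: no nonempty set of branches of the non-root
   stars Ss is a union of components. *)
Definition rooted Ss p : bool :=
  ([::] \notin Ss) &&
  [forall D : {set T}, [&& [forall x in D, x \in flatten Ss],
     all (fun s => has (mem D) s ==> all (mem D) s) Ss & [forall x in D, p x \in D]]
     ==> (D == finset.set0)].

Lemma rootedP Ss p : reflect ([::] \notin Ss /\ forall D,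
     {subset D <= flatten Ss} ->
     (forall s x y, s \in Ss -> x \in s -> y \in s -> x \in D -> y \in D) ->
     (forall x, x \in D -> p x \in D) -> D = finset.set0) (rooted Ss p).
Proof.
apply: (iffP andP) => -[nS h]; split=> //.
  move=> D DS sD pD; move/forallP/(_ D): h => /implyP h; apply/eqP/h.
  apply/and3P; split; [exact/forall_inP | | exact/forall_inP].
  apply/allP => s sS; apply/implyP => /hasP[x xs xD]; apply/allP => y ys.
  exact: sD sS xs ys xD.
apply/forallP => D; apply/implyP => /and3P[/forall_inP h1 /allP h2 /forall_inP h3].
apply/eqP/h => // s x y sS xs ys xD.
by move/(_ _ sS)/implyP: h2 => /(_ _)/allP; apply=> //; apply/hasP; exists x.
Qed.

Definition planar_gluing ws Ss p : bool :=
  [&& gluing (flatten (ws ++ Ss)) p, rooted Ss p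
    & vf (ws ++ Ss) p == (#|porbits p| + 2 * size ws)%N].

Definition planar_count ws Ss : nat := #|[set p | planar_gluing ws Ss p]%SET|.

(** The condition [p b == b] says that [tperm a b * p] matches [a] with [b]; that [p] then fixes [a]
    as well follows from the involution. *)
Lemma gluing_tperm d d' a b p : a != b -> c b = c a ->
    (forall x, (x \in d) = [|| x == a, x == b | x \in d']) ->
    a \notin d' -> b \notin d' ->
  gluing d (tperm a b * p)%g && (p b == b) = gluing d' p.
Proof.
move=> ab cab dd' ad bd; apply/idP/idP => [/andP[/forallP h /eqP pb]|/forallP h].
  have pa : p a = a.
    by have := h a => /and3P[_ /eqP + _]; rewrite !permM tpermL pb tpermR.
  apply/forallP => x; case: (eqVneq x a) => [->|xa]; first by rewrite !pa !eqxx ad.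
  case: (eqVneq x b) => [->|xb]; first by rewrite !pb !eqxx bd.
  have [ax bx] : a != x /\ b != x by rewrite ![_ == x]eq_sym.
  have [apx bpx] : a != p x /\ b != p x by rewrite -{1}pa -{1}pb !(inj_eq perm_inj).
  by have := h x; rewrite !permM !tpermD // dd' (negbTE xa) (negbTE xb).
have pa : p a = a by have := h a; rewrite ad => /andP[/eqP/eqP ->].
have pb : p b = b by have := h b; rewrite bd => /andP[/eqP/eqP ->].
rewrite pb eqxx andbT; apply/forallP => x; rewrite !permM dd'.
case: (eqVneq x a) => [->|xa].
  by rewrite tpermL pb tpermR pa cab !eqxx [b == a]eq_sym (negbTE ab).
case: (eqVneq x b) => [->|xb].
  by rewrite tpermR pa tpermL pb cab !eqxx (negbTE ab).
have [ax bx] : a != x /\ b != x by rewrite ![_ == x]eq_sym.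
have [apx bpx] : a != p x /\ b != p x by rewrite -{1}pa -{1}pb !(inj_eq perm_inj).
by rewrite !tpermD //; exact: h.
Qed.

Lemma eq_rooted Ss p r : {in flatten Ss, p =1 r} -> rooted Ss p -> rooted Ss r.
Proof.
move=> pr /rootedP[nS h]; apply/rootedP; split=> // D DS sD rD.
by apply: h => // x xD; rewrite pr ?rD // DS.
Qed.

Lemma rooted_tperm Ss a b p : a \notin flatten Ss -> b \notin flatten Ss ->
  rooted Ss (tperm a b * p)%g = rooted Ss p.
Proof.
move=> aS bS; apply/idP/idP; apply: eq_rooted => x xS; rewrite permM tpermD //;
by apply: contraTneq xS => <-.
Qed.

(** The star of [b] is glued to [a], which lies in no non-root star, so a union of components
    avoiding the roots cannot meet it: the sets [D] to be tested are the same on both sides. *)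
Lemma rooted_merge A u b v B a p : uniq (flatten (A ++ (u ++ b :: v) :: B)) ->
    a \notin flatten (A ++ (u ++ b :: v) :: B) -> p a = a ->
  rooted (A ++ (u ++ b :: v) :: B) (tperm a b * p)%g = rooted (A ++ B) p.
Proof.
set s := u ++ b :: v => un aS pa.
have bs : b \in s by rewrite mem_cat inE eqxx orbT.
have ss : s \in A ++ s :: B by rewrite mem_cat inE eqxx orbT.
have dS x : (x \in flatten (A ++ s :: B)) = (x \in s) || (x \in flatten (A ++ B)).
  by rewrite !flatten_cat /= !mem_cat orbCA.
have dj x : x \in s -> x \notin flatten (A ++ B).
  move: un; rewrite !flatten_cat /= uniq_catCA cat_uniq => /and3P[_ /hasPn h _] xs.
  by apply/negP => /h; rewrite /= xs.
have AB z : (z \in A ++ s :: B) = (z == s) || (z \in A ++ B).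
  by rewrite !mem_cat inE orbCA.
apply/rootedP/rootedP => -[nS h]; split.
- by move: nS; rewrite AB negb_or => /andP[].
- move=> D DS sD pD; apply: h.
  + by move=> x /DS; rewrite dS orbC => ->.
  + move=> z x y; rewrite AB => /orP[/eqP-> xs _ /DS|]; last exact: sD.
    by rewrite (negbTE (dj _ xs)).
  + move=> x xD; rewrite permM tpermD ?pD //.
      by apply: contraNneq aS => ->; rewrite dS DS ?orbT.
    by apply: contraTneq (DS _ xD) => <-; exact: dj.
- by rewrite AB negb_or nS andbT; case: (u) @s {bs ss dS dj AB un aS h nS}.
- move=> D DS sD pD.
  have sND x : x \in s -> x \notin D.
    move=> xs; apply: contra aS => xD; apply: DS.
    by have := pD b (sD s x b ss xs bs xD); rewrite permM tpermR pa.
  apply: h => [x xD|z x y zAB|x xD].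
  + have := DS x xD; rewrite dS => /orP[xs|//].
    by have := sND x xs; rewrite xD.
  + by apply: sD; rewrite AB zAB orbT.
  + have := pD x xD; rewrite permM tpermD //.
      by apply: contraNneq aS => ->; exact: DS.
    by apply: contraTneq xD => <-; exact: sND.
Qed.

Lemma flatten_cons s L : flatten (s :: L) = s ++ flatten L.
Proof. by []. Qed.

Local Ltac perm_count :=
  let x := fresh "x" in
  apply/seq.permP => x;
  repeat (progress rewrite ?cat_cons ?flatten_cat ?flatten_cons ?count_cat /=); lia.

Lemma perm_split a u b v L :
  perm_eq (flatten ((a :: u ++ b :: v) :: L)) [:: a, b & flatten [:: u, v & L]].
Proof. perm_count. Qed.

Lemma perm_merge a w A u b v B :
  perm_eq (flatten ((a :: w) :: A ++ (u ++ b :: v) :: B))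
          [:: a, b & flatten ((v ++ u ++ w) :: A ++ B)].
Proof. perm_count. Qed.

Lemma gluing_contract a b (L L' : seq (seq T)) p :
    uniq (flatten L) -> perm_eq (flatten L) [:: a, b & flatten L'] -> c b = c a ->
  gluing (flatten L) (tperm a b * p)%g && (p b == b) = gluing (flatten L') p.
Proof.
move=> un pe cab; move: un; rewrite (perm_uniq pe) /= inE negb_or.
case/and3P => /andP[ab aL] bL _; apply: gluing_tperm => // x.
by rewrite (perm_mem pe) !inE.
Qed.

Lemma fix_contract (L' : seq (seq T)) a p :
  gluing (flatten L') p -> a \notin flatten L' -> p a = a.
Proof. by move=> /forallP/(_ a)/andP[/eqP e _] aL; by move: e; rewrite aL => /eqP. Qed.

Section Contract.
Variables (a b : T) (L L' : seq (seq T)) (p : {perm T}).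
Hypotheses (un : uniq (flatten L)) (pe : perm_eq (flatten L) [:: a, b & flatten L']).

Lemma contract_uniq :
  [/\ a != b, a \notin flatten L', b \notin flatten L' & uniq (flatten L')].
Proof. by move: un; rewrite (perm_uniq pe) /= inE negb_or => /and3P[/andP[]]. Qed.

Lemma contract_fix : gluing (flatten L') p ->
  (tperm a b * p)%g a = b /\ (tperm a b * p)%g b = a.
Proof.
have [_ aL bL _] := contract_uniq => g.
by rewrite !permM tpermL tpermR (fix_contract g aL) (fix_contract g bL).
Qed.

Lemma contract_porbits : gluing (flatten L') p ->
  #|porbits p| = #|porbits (tperm a b * p)%g|.+1.
Proof.
have [ab _ _ _] := contract_uniq => /contract_fix [ra rb].
by rewrite -(card_porbits_edge ab ra rb) mulgA tperm2 mul1g.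
Qed.

End Contract.

(** Without roots the set of all branches is itself a union of components, so it is empty; stars
    without branches are excluded by [rooted]. *)
Lemma rooted_nil Ss p : gluing (flatten Ss) p -> rooted Ss p -> Ss = [::].
Proof.
move=> /forallP g /rootedP[nS h].
have D0 : [set x in flatten Ss]%SET = finset.set0.
  apply: h => [x|s x y sS _ ys _|x]; rewrite ?inE //.
    by apply/flattenP; exists s.
  move=> xS; have /and3P[/eqP ex /eqP e2 _] := g x; have /and3P[/eqP e1 _ _] := g (p x).
  by move: e1; rewrite e2 eq_sym ex xS /= => /esym/negPn.
case: Ss nS {g h} D0 => [//|[|x s] Ss]; first by rewrite inE eqxx.
by move=> _ /setP/(_ x); rewrite !inE eqxx.
Qed.

Lemma vf_nil p : vf [::] p = #|porbits p|.
Proof. by rewrite /vf /starperm big_nil mul1g. Qed.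

Lemma vf_cons_nil L p : vf ([::] :: L) p = (vf L p).+2.
Proof. by rewrite /vf starperm_cons cyc0 mul1g /=; lia. Qed.

Lemma flatten_split b L : b \in flatten L ->
  exists A u v B, L = A ++ (u ++ b :: v) :: B.
Proof.
case/flattenP => s sL bs; case/splitPr: bs sL => u v.
by case/splitPr => A B; exists A, u, v, B.
Qed.

(* Euler's inequality; each root contributes one component at most. *)
Lemma vf_le ws Ss p : uniq (flatten (ws ++ Ss)) -> gluing (flatten (ws ++ Ss)) p ->
  rooted Ss p -> (vf (ws ++ Ss) p <= #|porbits p| + 2 * size ws)%N.
Proof.
(* A loop creates a root but consumes two branches, so this sum decreases in every case. *)
have [n] := ubnP (size (flatten (ws ++ Ss)) + size ws).
elim: n ws Ss p => // n IH [|[|a w] ws] Ss p.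
- by move=> _ _ g rt; rewrite (rooted_nil g rt) vf_nil muln0 addn0.
- move=> le un g rt.
  have le' : (size (flatten (ws ++ Ss)) + (size ws).+1 < n.+1)%N by exact: le.
  have := IH ws Ss p _ un g rt; rewrite vf_cons_nil -/(ws ++ Ss) /= mulnS.
  by move=> /(_ ltac:(lia)); lia.
move=> le un g rt; set b := p a.
have pb : p b = a by move: g => /forallP/(_ a)/and3P[_ /eqP].
have ad : a \in flatten (((a :: w) :: ws) ++ Ss) by rewrite inE eqxx.
have ab : b != a by move: g => /forallP/(_ a)/and3P[/eqP ->]; rewrite ad.
have cab : c b = c a by move: g => /forallP/(_ a)/and3P[_ _ /eqP].
have bd : b \in flatten (((a :: w) :: ws) ++ Ss).
  move: g => /forallP/(_ b)/and3P[/eqP + _ _]; rewrite pb eq_sym (negbTE ab).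
  by move/esym/negPn.
set r := (tperm a b * p)%g; have Er : p = (tperm a b * r)%g.
  by rewrite mulgA tperm2 mul1g.
have rb : r b = b by rewrite permM tpermR.
have gr L' : perm_eq (flatten (((a :: w) :: ws) ++ Ss)) [:: a, b & flatten L'] ->
    gluing (flatten L') r.
  by move=> pe; rewrite -(gluing_contract _ un pe) // -Er g rb eqxx.
move: bd; rewrite cat_cons flatten_cons flatten_cat 2!mem_cat inE (negbTE ab) /=.
move=> /orP[bw|/orP[bw|bS]].
(* The edge is a loop: both sides of the inequality grow by the same amount. *)
- have [u [v Ew]] : exists u v, w = u ++ b :: v.
    by case/splitPr: bw => u v; exists u, v.
  have pe := perm_split a u b v (ws ++ Ss); rewrite -Ew in pe.
  have [_ aL bL un'] := contract_uniq un pe.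
  have rt' : rooted Ss r.
    move: aL bL; rewrite /= !flatten_cat !mem_cat !negb_or.
    move=> /and4P[_ _ _ aS] /and4P[_ _ _ bS].
    by rewrite -(rooted_tperm _ aS bS) -Er.
  have := IH [:: u, v & ws] Ss r _ un' (gr _ pe) rt'.
  rewrite (contract_porbits un pe) ?gr // -Er.
  rewrite [_ ++ Ss]/= -/(ws ++ Ss) vf_split // -?Ew //.
  move: le; rewrite (perm_size pe) /=; lia.
- have [A [u [v [B Ew]]]] := flatten_split bw.
  have EL : ws ++ Ss = A ++ (u ++ b :: v) :: (B ++ Ss) by rewrite Ew -catA.
  have pe := perm_merge a w A u b v (B ++ Ss); rewrite -EL in pe.
  have [_ aL bL un'] := contract_uniq un pe.
  have rt' : rooted Ss r.
    move: aL bL; rewrite !(flatten_cons, flatten_cat, mem_cat) !negb_or.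
    move=> /and3P[_ _ /andP[_ aS]] /and3P[_ _ /andP[_ bS]].
    by rewrite -(rooted_tperm _ aS bS) -Er.
  have := IH ((v ++ u ++ w) :: A ++ B) Ss r; rewrite cat_cons -catA.
  move=> /(_ _ un' (gr _ pe) rt').
  rewrite (contract_porbits un pe) ?gr // -Er.
  rewrite EL vf_merge -?EL //.
  move: le; rewrite (perm_size pe) Ew /= !size_cat /=; lia.
(* The edge joins the root to a non-root star, which the root absorbs. *)
- have [A [u [v [B Ew]]]] := flatten_split bS.
  have EL : ws ++ Ss = (ws ++ A) ++ (u ++ b :: v) :: B by rewrite Ew catA.
  have pe := perm_merge a w (ws ++ A) u b v B; rewrite -EL in pe.
  have [_ aL bL un'] := contract_uniq un pe.
  have rt' : rooted (A ++ B) r.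
    have unS : uniq (flatten Ss).
      by move: un; rewrite cat_cons flatten_cons flatten_cat !cat_uniq => /and3P[_ _ /and3P[]].
    have aS : a \notin flatten Ss.
      by move: un; rewrite cat_cons /= flatten_cat !mem_cat !negb_or => /andP[/and3P[]].
    by move: unS aS rt; rewrite Ew Er => unS aS; rewrite rooted_merge // permM tpermL.
  have := IH ((v ++ u ++ w) :: ws) (A ++ B) r; rewrite cat_cons (catA ws).
  move=> /(_ _ un' (gr _ pe) rt').
  rewrite (contract_porbits un pe) ?gr // -Er.
  rewrite EL vf_merge -?EL //.
  move: le; rewrite (perm_size pe) /=; lia.
Qed.

End Planar.

(** * Counting gluings by the edge of the first branch *)

Section PlanarCount.
Variables (T : finType) (I : eqType) (c : T -> I).
Implicit Types (x y a b : T) (s w u v : seq T) (ws Ss L : seq (seq T)).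
Implicit Types (p r : {perm T}).

Lemma planar_count0 Ss : planar_count c [::] Ss = (Ss == [::]).
Proof.
rewrite /planar_count; case: eqP => [->|nS].
  rewrite -[RHS](cards1 (1%g : {perm T})); apply: eq_card => p; rewrite !inE.
  rewrite /planar_gluing vf_nil addn0 eqxx andbT.
  apply/andP/eqP => [[/forallP g _]|->].
    by apply/permP => x; rewrite perm1; have /andP[/eqP/eqP] := g x.
  split; first by apply/forallP => x; rewrite !perm1 !eqxx.
  apply/rootedP; split=> // D DS _ _; apply/setP => x; rewrite inE.
  by apply/negP => /DS.
apply: eq_card0 => p; rewrite !inE /planar_gluing.
apply/negP => /and3P[g rt _]; exact: nS (rooted_nil g rt).
Qed.

Lemma planar_count_nil ws Ss : planar_count c ([::] :: ws) Ss = planar_count c ws Ss.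
Proof.
apply: eq_card => p; rewrite !inE /planar_gluing; congr [&& _, _ & _].
rewrite cat_cons vf_cons_nil [size (_ :: _)]/=; apply/eqP/eqP; lia.
Qed.

Lemma card_edge (P Q : pred {perm T}) a b :
    (forall p, P (tperm a b * p)%g && (p b == b) = Q p) ->
  #|[set p | P p && (p a == b)]%SET| = #|[set p | Q p]%SET|.
Proof.
move=> PQ; rewrite -[RHS](card_imset _ (mulgI (tperm a b))); apply: eq_card => p.
rewrite !inE; apply/andP/imsetP => [[Pp /eqP pa]|[q]].
  exists (tperm a b * p)%g; last by rewrite mulgA tperm2 mul1g.
  by rewrite inE -PQ mulgA tperm2 mul1g Pp permM tpermR pa eqxx.
by rewrite inE -PQ => /andP[Pq /eqP qb] ->; rewrite Pq permM tpermL qb.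
Qed.

Lemma planar_count_split a u b v ws Ss :
    uniq (flatten ((a :: u ++ b :: v) :: ws ++ Ss)) -> c b = c a ->
  #|[set p | planar_gluing c ((a :: u ++ b :: v) :: ws) Ss p && (p a == b)]%SET|
    = planar_count c (u :: v :: ws) Ss.
Proof.
move=> un cab; apply: card_edge => p; rewrite /planar_gluing.
have pe := perm_split a u b v (ws ++ Ss).
have [ab aL bL un'] := contract_uniq un pe.
have [aS bS] : a \notin flatten Ss /\ b \notin flatten Ss.
  move: aL bL; rewrite !(flatten_cons, flatten_cat, mem_cat) !negb_or.
  by move=> /and4P[_ _ _ ->] /and4P[_ _ _ ->].
rewrite -(gluing_contract p un pe cab) -andbA; case g: (gluing _ _) => //=.
rewrite rooted_tperm //; case: (p b =P b) => pb; rewrite ?andbF ?andbT //=.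
have g' : gluing c (flatten [:: u, v & ws ++ Ss]) p.
  by rewrite -(gluing_contract p un pe cab) g pb eqxx.
have [ra rb] := contract_fix un pe g'.
have := vf_split un ra rb; rewrite mulgA tperm2 mul1g => ->.
rewrite (contract_porbits un pe g'); congr andb.
by move: (vf _ _) #|_| => x y; apply/eqP/eqP; lia.
Qed.

Lemma planar_count_merge a w ws A u b v B :
    uniq (flatten ((a :: w) :: ws ++ A ++ (u ++ b :: v) :: B)) -> c b = c a ->
  #|[set p | planar_gluing c ((a :: w) :: ws) (A ++ (u ++ b :: v) :: B) p
               && (p a == b)]%SET|
    = planar_count c ((v ++ u ++ w) :: ws) (A ++ B).
Proof.
move=> un cab; apply: card_edge => p; rewrite /planar_gluing.
rewrite catA in un.
have pe := perm_merge a w (ws ++ A) u b v B.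
have [ab aL bL un'] := contract_uniq un pe.
have unS : uniq (flatten (A ++ (u ++ b :: v) :: B)).
  by move: un; rewrite -catA flatten_cons flatten_cat !cat_uniq => /and3P[_ _ /and3P[]].
have aS : a \notin flatten (A ++ (u ++ b :: v) :: B).
  by move: un; rewrite -catA /= flatten_cat !mem_cat !negb_or => /andP[/and3P[]].
rewrite !cat_cons !(catA ws).
rewrite -(gluing_contract p un pe cab) -andbA; case g: (gluing _ _) => //=.
case: (p b =P b) => pb; rewrite ?andbF ?andbT //=.
have g' : gluing c (flatten ((v ++ u ++ w) :: (ws ++ A) ++ B)) p.
  by rewrite -(gluing_contract p un pe cab) g pb eqxx.
rewrite rooted_merge ?(fix_contract g' aL) //; congr andb.
have [ra rb] := contract_fix un pe g'.
have := vf_merge un ra rb; rewrite mulgA tperm2 mul1g => ->.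
rewrite (contract_porbits un pe g').
by move: (vf _ _) #|_| => x y; apply/eqP/eqP; lia.
Qed.

(** Merging two roots leaves V - E + F unchanged with one root less, so equality before the merge
    would violate [vf_le] after it. *)
Lemma planar_count_root a w A u b v B Ss :
    uniq (flatten ((a :: w) :: A ++ (u ++ b :: v) :: B ++ Ss)) ->
  #|[set p | planar_gluing c ((a :: w) :: A ++ (u ++ b :: v) :: B) Ss p
               && (p a == b)]%SET| = 0%N.
Proof.
move=> un; apply: eq_card0 => p; rewrite !inE; apply/negP => /andP[/and3P[g rt /eqP e] /eqP pa].
have cab : c b = c a by move: g => /forallP/(_ a)/and3P[_ _ /eqP]; rewrite pa.
have pb : p b = a by move: g => /forallP/(_ a)/and3P[_ /eqP]; rewrite pa.
set r := (tperm a b * p)%g; have Er : p = (tperm a b * r)%g.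
  by rewrite mulgA tperm2 mul1g.
have rb : r b = b by rewrite permM tpermR.
have pe := perm_merge a w A u b v (B ++ Ss).
rewrite cat_cons -catA cat_cons in g e.
have g' : gluing c (flatten ((v ++ u ++ w) :: A ++ B ++ Ss)) r.
  by rewrite -(gluing_contract r un pe cab) -Er g rb eqxx.
have [ab aL bL un'] := contract_uniq un pe.
have rt' : rooted Ss r.
  move: aL bL; rewrite !(flatten_cons, flatten_cat, mem_cat) !negb_or.
  move=> /and4P[_ _ _ aS] /and4P[_ _ _ bS].
  by rewrite -(rooted_tperm _ aS bS) -Er.
have := @vf_le _ _ c ((v ++ u ++ w) :: A ++ B) Ss r; rewrite cat_cons -catA.
move=> /(_ un' g' rt'); rewrite (vf_merge un pa pb) e.
by rewrite (contract_porbits un pe g') -Er /= !size_cat /=; lia.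
Qed.

Lemma sum_mem_seq (F : T -> nat) s : uniq s -> (forall x, x \notin s -> F x = 0%N) ->
  (\sum_x F x = \sum_(x <- s) F x)%N.
Proof.
move=> un F0; rewrite [RHS]big_uniq //= (bigID (mem s)) /= [X in (_ + X)%N]big1 ?addn0 //.
Qed.

(** The gluings are classified by the partner of [a]. The first sum collects the loops, the second
    the edges to non-root stars. *)
Lemma planar_count_step a w ws Ss : uniq (flatten ((a :: w) :: ws ++ Ss)) ->
  planar_count c ((a :: w) :: ws) Ss =
   (\sum_(q <- cuts w | c q.1.2 == c a) planar_count c (q.1.1 :: q.2 :: ws) Ss +
    \sum_(s <- picks Ss) \sum_(q <- cuts s.1 | c q.1.2 == c a)
       planar_count c ((q.2 ++ q.1.1 ++ w) :: ws) s.2)%N.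
Proof.
move=> un.
pose F b := #|[set p | planar_gluing c ((a :: w) :: ws) Ss p && (p a == b)]%SET|.
have F0 b : c b != c a -> F b = 0%N.
  move=> cab; apply: eq_card0 => p; rewrite !inE; apply/negP => /andP[/and3P[g _ _] /eqP pa].
  by move: g => /forallP/(_ a)/and3P[_ _]; rewrite pa (negbTE cab).
have -> : planar_count c ((a :: w) :: ws) Ss = (\sum_b F b)%N.
  rewrite /planar_count -sum1_card (partition_big (fun p => p a) xpredT) //=.
  by apply: eq_bigr => b _; rewrite /F -sum1_card; apply: eq_bigl => p; rewrite !inE.
have unw : uniq (w ++ flatten Ss).
  move: un; rewrite flatten_cons flatten_cat cat_cons cons_uniq => /andP[_].
  by rewrite uniq_catCA cat_uniq => /and3P[].
(* No other partner occurs: another root is excluded by [planar_count_root], and an element of [T]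
   outside of the stars is a fixed point. *)
rewrite (sum_mem_seq unw); last first.
  move=> b; rewrite mem_cat negb_or => /andP[bw bS].
  case: (boolP (b \in flatten ws)) => [/flatten_split[A [u [v [B E]]]]|bws].
    by rewrite /F E; apply: planar_count_root; move: un; rewrite E -catA.
  apply: eq_card0 => p; rewrite !inE; apply/negP => /andP[/and3P[g _ _] /eqP pa].
  have ad : a \in flatten (((a :: w) :: ws) ++ Ss) by rewrite inE eqxx.
  have ab : b != a by move: g => /forallP/(_ a)/and3P[/eqP + _ _]; rewrite pa ad => ->.
  move: g => /forallP g; have /and3P[_ /eqP pb _] := g a.
  have /and3P[/eqP + _ _] := g b; rewrite -{1}pa pb eq_sym (negbTE ab) => /esym/negPn.
  rewrite cat_cons flatten_cons flatten_cat 2!mem_cat inE (negbTE ab) (negbTE bw).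
  by rewrite (negbTE bws) (negbTE bS).
rewrite big_cat /=; congr (_ + _)%N.
  rewrite -{1}[w]cuts_letters big_map [RHS]big_mkcond /=.
  apply: eq_big_seq => -[[u b] v] /cutsP /= E; case: eqP => [cab|/eqP/F0//].
  by rewrite /F; move: un; rewrite E => un; rewrite planar_count_split.
rewrite big_flatten /= -{1}[Ss]picks_fst big_map.
apply: eq_big_seq => -[s S'] /picksP[A [B /= [ES ->]]].
rewrite -{1}[s]cuts_letters big_map [RHS]big_mkcond /=.
apply: eq_big_seq => -[[u b] v] /cutsP /= E; case: eqP => [cab|/eqP/F0//].
by rewrite /F; move: un; rewrite ES E => un; rewrite planar_count_merge.
Qed.

End PlanarCount.

(** * The recursion on words of colors *)

Section TutteRecursion.
Variable I : eqType.
Implicit Types (w : seq I) (ws S : seq (seq I)).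

(* n is fuel; it has to exceed the number of letters plus the number of roots. *)
Fixpoint tutte n ws S : nat :=
  if n is n'.+1 then
    match ws with
    | [::] => S == [::]
    | [::] :: ws' => tutte n' ws' S
    | (i :: w) :: ws' =>
      (\sum_(q <- cuts w | q.1.2 == i) tutte n' (q.1.1 :: q.2 :: ws') S +
       \sum_(s <- picks S) \sum_(q <- cuts s.1 | q.1.2 == i)
          tutte n' ((q.2 ++ q.1.1 ++ w) :: ws') s.2)%N
    end
  else 0%N.

(** The count depends on the branches only through their colors. This removes the finite type [T],
    which differs from one list of stars to another. *)
Lemma planar_count_tutte (T : finType) (c : T -> I) n (ws Ss : seq (seq T)) :
    uniq (flatten (ws ++ Ss)) -> (size (flatten (ws ++ Ss)) + size ws < n)%N ->
  planar_count c ws Ss = tutte n (map (map c) ws) (map (map c) Ss).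
Proof.
elim: n ws Ss => // n IH [|[|a w] ws] Ss un le.
- by rewrite planar_count0 /=; case: Ss {un le}.
- by rewrite planar_count_nil IH //; move: le; rewrite /= -/(cat ws Ss); lia.
rewrite planar_count_step // [RHS]/= cuts_map picks_map !big_map.
have sz L : perm_eq (flatten (((a :: w) :: ws) ++ Ss)) L ->
  size L = size (flatten (((a :: w) :: ws) ++ Ss)) by move/perm_size.
congr (_ + _)%N; rewrite [LHS]big_seq_cond [RHS]big_seq_cond.
  apply: eq_bigr => -[[u b] v] /= /andP[/cutsP /= E _].
  have pe := perm_split a u b v (ws ++ Ss); rewrite -E in pe.
  have [_ _ _ un'] := contract_uniq un pe.
  by rewrite IH //; have := sz _ pe; move: le; rewrite /=; lia.
apply: eq_bigr => -[s S'] /= /andP[/picksP[A [B /= [ES ->]]] _].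
rewrite cuts_map big_map [LHS]big_seq_cond [RHS]big_seq_cond.
apply: eq_bigr => -[[u b] v] /= /andP[/cutsP /= E _].
have EL : ws ++ Ss = (ws ++ A) ++ (u ++ b :: v) :: B by rewrite ES E -catA.
have pe := perm_merge a w (ws ++ A) u b v B; rewrite -EL in pe.
have [_ _ _ un'] := contract_uniq un pe.
rewrite -catA in pe un'.
by rewrite IH -?map_cat //; have := sz _ pe; move: le; rewrite /=; lia.
Qed.

(** Rewriting [picks] with [rem] gives a sum over the elements of [S], whose order can then be
    changed; it serves to show that the count ignores the order of the stars. *)
Lemma sum_picks_rem (F : seq I -> seq (seq I) -> nat) S :
    (forall s S1 S2, perm_eq S1 S2 -> F s S1 = F s S2) ->
  (\sum_(q <- picks S) F q.1 q.2 = \sum_(s <- S) F s (rem s S))%N.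
Proof.
move=> pF; rewrite -{2}[S]picks_fst big_map; apply: eq_big_seq => q /picksP[A [B [ES ->]]].
apply: pF; rewrite -(perm_cons q.1).
have qS : q.1 \in S by rewrite ES mem_cat inE eqxx orbT.
rewrite perm_sym; apply: perm_trans (_ : perm_eq _ S) _; first by rewrite perm_sym perm_to_rem.
by rewrite {1}ES -cat1s perm_catCA.
Qed.

Lemma tutte_perm n ws S S' : perm_eq S S' -> tutte n ws S = tutte n ws S'.
Proof.
elim: n ws S S' => // n IH [|[|i w] ws] S S' pe /=; [|exact: IH|].
  by rewrite -!size_eq0 (perm_size pe).
congr (_ + _)%N; first by apply: eq_bigr => q _; apply: IH.
pose F s S1 := (\sum_(q <- cuts s | q.1.2 == i) tutte n ((q.2 ++ q.1.1 ++ w) :: ws) S1)%N.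
have pF s S1 S2 : perm_eq S1 S2 -> F s S1 = F s S2.
  by move=> p12; apply: eq_bigr => q _; apply: IH.
rewrite !(sum_picks_rem _ pF) (perm_big _ pe) /=.
apply: eq_big_seq => s sS'; apply: pF; rewrite -(perm_cons s).
have sS : s \in S by rewrite (perm_mem pe).
apply: perm_trans (perm_trans pe (perm_to_rem sS')).
by rewrite perm_sym perm_to_rem.
Qed.

End TutteRecursion.

Section CardPorbits.
Local Open Scope group_scope.
Variable T : finType.
Implicit Types (s a : {perm T}).

Lemma porbit_conj s a x : porbit (s ^ a) (a x) = [set a y | y in porbit s x]%SET.
Proof.
apply/setP => y; apply/porbitP/imsetP => [[i ->]|[_ /porbitP[i ->] ->]].
  by exists ((s ^+ i) x); rewrite ?mem_porbit // -conjXg permJ.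
by exists i; rewrite -conjXg permJ.
Qed.

(** The two products are conjugate. Faces of maps are defined with the gluing first, whereas [vf]
    has the rotation first. *)
Lemma card_porbitsC s a : #|porbits (s * a)| = #|porbits (a * s)|.
Proof.
have -> : s * a = (a * s) ^ a by rewrite conjgE -!mulgA mulKg.
rewrite -(card_imset (porbits (a * s)) (imset_inj (@perm_inj _ a))).
apply: eq_card => A; apply/imsetP/imsetP => [[x _ ->]|[_ /imsetP[x _ ->] ->]].
  exists (porbit (a * s) (a^-1 x)); first exact: imset_f.
  by rewrite -{1}[x](permKV a) porbit_conj.
by exists (a x); rewrite // porbit_conj.
Qed.

Lemma cyc_head (x : T) w : x \notin w -> cyc (x :: w) x = head x w.
Proof. by move=> xw; rewrite cyc_cons permM cyc_out // tpermL. Qed.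

Lemma cyc_nth (x0 : T) w i : uniq w -> (i < size w)%N ->
  cyc w (nth x0 w i) = nth x0 w (i.+1 %% size w).
Proof.
move=> un lt; have E := cat_take_drop i w; rewrite (drop_nth x0 lt) in E.
have un' := un; rewrite -E in un'.
rewrite -{1}E cyc_catC // cat_cons cyc_head; last first.
  by move: un'; rewrite uniq_catC cat_cons cons_uniq => /andP[].
have [lt'|ge] := ltnP i.+1 (size w).
  by rewrite modn_small // (drop_nth x0 lt').
have -> : i.+1 = size w by apply/eqP; rewrite eqn_leq lt.
rewrite modnn drop_size cat0s; case: i lt {E un' ge} => [|i] lt; first by rewrite take0.
by case: w lt {un}.
Qed.

End CardPorbits.

(** * Planar maps *)

Section PlanarMaps.
Variable m : nat.
Implicit Types S : seq (word m).

Definition star_branches S (j : 'I_(size S)) : seq (branch S) :=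
  [seq Tagged (fun j => 'I_(size (tnth (in_tuple S) j))) k
    | k <- enum 'I_(size (tnth (in_tuple S) j))].

Definition branch_stars S : seq (seq (branch S)) :=
  [seq star_branches j | j <- enum 'I_(size S)].

Lemma mem_star_branches S j (b : branch S) : (b \in star_branches j) = (tag b == j).
Proof.
apply/mapP/eqP => [[k _ ->] //|<-]; exists (tagged b); first by rewrite mem_enum.
by case: b.
Qed.

Lemma mem_branch_stars S (b : branch S) : b \in flatten (branch_stars S).
Proof.
apply/flattenP; exists (star_branches (tag b)); last by rewrite mem_star_branches.
by apply: map_f; rewrite mem_enum.
Qed.

Lemma uniq_branch_stars S : uniq (flatten (branch_stars S)).
Proof.
apply: (@allpairs_uniq_dep _ (fun j : 'I_(size S) => 'I_(size (tnth (in_tuple S) j)))).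
- exact: enum_uniq.
- by move=> j _; exact: enum_uniq.
- by move=> [j k] [j' k'] _ _ e; exact: e.
Qed.

Lemma branch_stars_color S :
  map (map (@branch_color m S)) (branch_stars S) = [seq fmonom_val w | w <- S].
Proof.
rewrite /branch_stars -map_comp.
transitivity [seq fmonom_val (tnth (in_tuple S) j) | j <- enum 'I_(size S)].
  apply: eq_map => j /=; rewrite /star_branches -map_comp.
  by rewrite -[RHS](map_tnth_enum (in_tuple (tnth (in_tuple S) j))); apply: eq_map.
by rewrite map_comp map_tnth_enum.
Qed.

Lemma starperm_branch_stars S : starperm (branch_stars S) = next_branch S.
Proof.
apply/permP => -[j k]; rewrite permE.
have [A [B E]] : exists A B, branch_stars S = A ++ star_branches j :: B.
  have : star_branches j \in branch_stars S by apply: map_f; rewrite mem_enum.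
  by case/splitPr => A B; exists A, B.
have un := uniq_branch_stars S; rewrite E in un.
rewrite E starperm_catCA // permM.
have uj : uniq (star_branches j).
  by move: un; rewrite flatten_cat flatten_cons !cat_uniq => /and3P[_ _ /and3P[]].
pose b0 := Tagged (fun j => 'I_(size (tnth (in_tuple S) j))) k.
have sz : size (star_branches j) = size (tnth (in_tuple S) j).
  by rewrite size_map -cardE card_ord.
have nthE (i : 'I_(size (tnth (in_tuple S) j))) :
    nth b0 (star_branches j) i = Tagged (fun j => 'I_(size (tnth (in_tuple S) j))) i.
  by rewrite (nth_map k) -?cardE ?card_ord // nth_ord_enum.
have -> : cyc (star_branches j) b0 =
          Tagged (fun j => 'I_(size (tnth (in_tuple S) j))) (ordS k).
  by rewrite /b0 -{1}(nthE k) cyc_nth ?sz // -nthE.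
rewrite starperm_out //; apply/negP => bAB.
move: un; rewrite !flatten_cat flatten_cons uniq_catCA cat_uniq => /and3P[_ /hasPn h _].
have := h (Tagged (fun j => 'I_(size (tnth (in_tuple S) j))) (ordS k)).
by rewrite -flatten_cat bAB /= mem_star_branches eqxx => /(_ isT).
Qed.

Lemma matching_gluing S (alpha : {perm branch S}) :
  matching alpha = gluing (@branch_color m S) (flatten (branch_stars S)) alpha.
Proof.
apply/forallP/forallP => h b; have := h b; rewrite mem_branch_stars /=.
  by move=> /and3P[/negbTE-> -> ->].
by move=> /and3P[/eqP-> -> ->].
Qed.

Definition nonroot_branches (P : word m) S : seq (seq (branch (P :: S))) :=
  [seq @star_branches (P :: S) (@lift (size S).+1 ord0 j) | j <- enum 'I_(size S)].

(** Star 0 is the root. The branches of the stars that it does not reach form a union of components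
    without root; conversely such a union is preserved along any path, hence along one leading to
    star 0, where it has no branch. *)
Lemma map_connected_rooted (P : word m) S (alpha : {perm branch (P :: S)}) :
    matching alpha ->
  map_connected alpha =
  rooted (nonroot_branches P S) alpha.
Proof.
set S' := P :: S; set Ss := (X in rooted X) => al.
pose adj := [rel j j' : 'I_(size S') |
               [exists b : branch S', (tag b == j) && (tag (alpha b) == j')]].
have adjC : symmetric adj.
  move=> j j' /=; apply/existsP/existsP => -[b /andP[tb tab]]; exists (alpha b);
  by rewrite tab /=; have /forallP/(_ b)/and3P[_ /eqP-> _] := al.
have inSs (b : branch S') : (b \in flatten Ss) = (tag b != ord0).
  apply/flattenP/idP => [[_ /mapP[j _ ->]]|b0].
    by rewrite mem_star_branches => /eqP->.
  rewrite eq_sym in b0; have [j bj _] := unlift_some b0; exists (@star_branches S' (@lift (size S).+1 ord0 j)).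
    by apply: map_f; rewrite mem_enum.
  by rewrite mem_star_branches bj.
apply/idP/rootedP => [conn|[nS h]].
  have c0 j : connect adj j ord0 by move/forallP/(_ j)/forallP/(_ ord0): conn.
  split.
    (* A non-root star without branches has no neighbor, so it would not be connected to the
       root. *)
    apply/negP => /mapP[j _ E].
    have /connectP[pth] := c0 (@lift (size S).+1 ord0 j).
    case: pth => [_ /(congr1 val) //|j' pth] /= /andP[/existsP[b /andP[tb _]] _] _.
    by move: (@mem_star_branches S' (@lift (size S).+1 ord0 j) b); rewrite tb -E.
  move=> D DS sD pD; apply/setP => b; rewrite inE; apply/negP => bD.
  have /connectP[pth] := c0 (tag b).
  elim: pth b bD => [|j pth IH] b bD /=.
    by move=> _ e; move: (DS _ bD); rewrite inSs -e eqxx.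
  move=> /andP[/existsP[b' /andP[/eqP tb' /eqP tab']]] pp el.
  have b'D : b' \in D.
    have := DS _ bD => /flattenP[s sS bs]; apply: (sD _ _ _ sS bs _ bD).
    case/mapP: sS bs => k _ ->; rewrite !mem_star_branches => /eqP <-.
    by rewrite tb'.
  by apply: (IH (alpha b')); rewrite ?tab' ?pD.
have adjc := sym_connect_sym adjC.
suff c0 j : connect adj ord0 j.
  by apply/forallP => j; apply/forallP => j'; apply: connect_trans (c0 j'); rewrite adjc.
apply/negPn/negP => nc.
have D0 : [set b : branch S' | ~~ connect adj ord0 (tag b)]%SET = finset.set0.
  apply: h => [b|s b b' /mapP[k _ ->]|b]; rewrite ?mem_star_branches ?inE.
  - by rewrite inSs; apply: contraNneq => ->.
  - by move=> /eqP-> /eqP->.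
  - apply: contra => c0; apply: connect_trans c0 _; apply: connect1 => /=.
    apply/existsP; exists (alpha b); rewrite eqxx /=.
    by have /forallP/(_ b)/and3P[_ /eqP-> _] := al.
have j0 : ord0 != j by apply: contraNneq nc => <-.
have [k jk _] := unlift_some j0.
move/negP: nS; apply; apply/mapP; exists k; first by rewrite mem_enum.
apply/esym/eqP; rewrite -size_eq0 size_map -cardE card_ord -jk.
rewrite -leqn0 leqNgt; apply/negP => lt.
move/setP/(_ (Tagged (fun j : 'I_(size S') => 'I_(size (tnth (in_tuple S') j)))
   (Ordinal lt))): D0.
by rewrite !inE /= nc.
Qed.

Lemma planar_maps_tutte (P : word m) S n :
    (size P + size (flatten [seq fmonom_val w | w <- S]) + 1 < n)%N ->
  planar_maps (P :: S) = tutte n [:: fmonom_val P] [seq fmonom_val w | w <- S].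
Proof.
move=> le; set S' := P :: S.
pose Ss := @nonroot_branches P S.
have EL : branch_stars S' = star_branches (ord0 : 'I_(size S')) :: Ss.
  by rewrite /branch_stars [size S']/= enum_ordSl /= -map_comp.
have := branch_stars_color S'; rewrite EL [map _ (_ :: _)]/= => -[EP ES].
have un := uniq_branch_stars S'; rewrite EL in un.
transitivity (planar_count (@branch_color m S') [:: star_branches (ord0 : 'I_(size S'))] Ss).
  apply: eq_card => al; rewrite !inE /planar_gluing cat1s -EL -matching_gluing.
  case mt: (matching al) => //=; rewrite map_connected_rooted //; congr andb.
  rewrite /genus0 /vf /map_faces starperm_branch_stars card_porbitsC.
  have -> : size (branch_stars S') = size S' by rewrite size_map -cardE card_ord.
  have -> : count (@nilp (branch S')) (branch_stars S') =
            count (fun w : word m => nilp w) S'.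
    transitivity (count (@nilp _) (map (map (@branch_color m S')) (branch_stars S'))).
      by rewrite count_map; apply: eq_count => s; rewrite /= /nilp size_map.
    by rewrite branch_stars_color count_map.
  by congr (_ == _); rewrite -addnA (addnC (count _ _)).
rewrite (@planar_count_tutte _ _ _ n) ?cat1s //; first by rewrite /= EP ES.
have -> : size (flatten (star_branches (ord0 : 'I_(size S')) :: Ss)) =
   (size P + size (flatten [seq fmonom_val w | w <- S]))%N.
  by rewrite -(size_map (@branch_color m S')) map_flatten [map _ (_ :: _)]/= EP ES size_cat.
exact: le.
Qed.

End PlanarMaps.

(** * Sums over splittings *)

Section SplitSums.
Variables (V : nmodType) (J : Type).
Implicit Types (s : seq J).

Lemma sum_splits_cons x s (F : seq J * seq J -> V) :
  \sum_(p <- splits (x :: s)) F p =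
  \sum_(p <- splits s) F (x :: p.1, p.2) + \sum_(p <- splits s) F (p.1, x :: p.2).
Proof. by rewrite big_cat !big_map. Qed.

Lemma sum_picks_cons x s (F : J * seq J -> V) :
  \sum_(p <- picks (x :: s)) F p = F (x, s) + \sum_(p <- picks s) F (p.1, x :: p.2).
Proof. by rewrite big_cons big_map. Qed.

Lemma sum_splits_nill s (F : seq J -> V) :
  \sum_(p <- splits s) F p.2 *+ nilp p.1 = F s.
Proof.
elim: s F => [|x s IH] F; first by rewrite big_seq1.
by rewrite sum_splits_cons /= big1_eq add0r (IH (fun t => F (x :: t))).
Qed.

Lemma sum_splits_nilr s (F : seq J -> V) :
  \sum_(p <- splits s) F p.1 *+ nilp p.2 = F s.
Proof.
elim: s F => [|x s IH] F; first by rewrite big_seq1.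
by rewrite sum_splits_cons /= [X in _ + X]big1_eq addr0 (IH (fun t => F (x :: t))).
Qed.

(** Coassociativity: both sides run over the ways of distributing [s] among three subsequences. *)
Lemma sum_splitsA s (F : seq J -> seq J -> seq J -> V) :
  \sum_(p <- splits s) \sum_(q <- splits p.1) F q.1 q.2 p.2 =
  \sum_(p <- splits s) \sum_(q <- splits p.2) F p.1 q.1 q.2.
Proof.
elim: s F => [|x s IH] F; first by rewrite !big_seq1.
rewrite !sum_splits_cons /= !(eq_bigr _ (fun _ _ => sum_splits_cons _ _ _)) !big_split /=.
rewrite (IH (fun a b c => F (x :: a) b c)) (IH (fun a b c => F a (x :: b) c)).
by rewrite (IH (fun a b c => F a b (x :: c))) addrA.
Qed.

Lemma sum_splits_picks s (F : J -> seq J -> seq J -> V) :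
  \sum_(p <- splits s) \sum_(q <- picks p.1) F q.1 q.2 p.2 =
  \sum_(q <- picks s) \sum_(p <- splits q.2) F q.1 p.1 p.2.
Proof.
elim: s F => [|x s IH] F; first by rewrite big_seq1 !big_nil.
rewrite sum_splits_cons sum_picks_cons /= !(eq_bigr _ (fun _ _ => sum_picks_cons _ _ _)).
rewrite !(eq_bigr _ (fun _ _ => sum_splits_cons _ _ _)) !big_split /= -!addrA; congr (_ + _).
by rewrite (IH (fun j a b => F j (x :: a) b)) (IH (fun j a b => F j a (x :: b))).
Qed.

End SplitSums.

(** * Choosing the types of the stars, and products of moments *)

Section Decorations.
Variables (J : Type) (I : eqType) (st : J -> seq (seq I)).

(** Each direction stands for one star, whose type is still to be chosen in [st j]; in the
    application the choice is between [q j] and its reversal. *)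
Fixpoint decorations (s : seq J) : seq (seq (seq I)) :=
  if s is j :: s' then [seq x :: D | x <- st j, D <- decorations s'] else [:: [::]].

Lemma sum_decorations_cons (V : nmodType) j s (F : seq (seq I) -> V) :
  \sum_(D <- decorations (j :: s)) F D =
  \sum_(x <- st j) \sum_(D <- decorations s) F (x :: D).
Proof. by rewrite big_allpairs_dep. Qed.

Lemma sum_decorations_picks (V : nmodType) s (F : seq I -> seq (seq I) -> V) :
  \sum_(D <- decorations s) \sum_(p <- picks D) F p.1 p.2 =
  \sum_(q <- picks s) \sum_(x <- st q.1) \sum_(D <- decorations q.2) F x D.
Proof.
elim: s F => [|j s IH] F; first by rewrite big_seq1 !big_nil.
rewrite sum_decorations_cons sum_picks_cons /=.
under eq_bigr do under eq_bigr do rewrite sum_picks_cons /=.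
under eq_bigr do rewrite big_split /=; rewrite big_split /=; congr (_ + _).
under eq_bigr => x _ do rewrite (IH (fun y D => F y (x :: D))).
rewrite exchange_big /=; apply: eq_bigr => q _.
rewrite exchange_big /=; apply: eq_bigr => y _.
by rewrite sum_decorations_cons.
Qed.

Variables (K : comNzRingType) (T : seq J -> seq I -> K) (wt : J -> nat).
Hypothesis st_size : forall j x, x \in st j -> size x = wt j.
Hypothesis T_nil : forall s, T s [::] = (nilp s)%:R.
Hypothesis T_cons : forall s i w, T s (i :: w) =
  \sum_(q <- cuts w | q.1.2 == i) \sum_(p <- splits s) T p.1 q.1.1 * T p.2 q.2 +
  \sum_(p <- picks s) \sum_(x <- st p.1) \sum_(q <- cuts x | q.1.2 == i)
     T p.2 (q.2 ++ q.1.1 ++ w).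

(* The coefficient of a product of moments, by the Leibniz rule. *)
Fixpoint multiT (s : seq J) (ws : seq (seq I)) : K :=
  if ws is w :: ws' then \sum_(p <- splits s) T p.1 w * multiT p.2 ws'
  else (nilp s)%:R.

Lemma multiT1 s w : multiT s [:: w] = T s w.
Proof.
rewrite /= -[RHS](sum_splits_nilr s (fun t => T t w)).
by apply: eq_bigr => p _; rewrite mulr_natr.
Qed.

Definition weight s := (\sum_(j <- s) wt j)%N.

Lemma weight_picks s (F G : J * seq J -> K) :
    (forall p, (wt p.1 + weight p.2 = weight s)%N -> F p = G p) ->
  \sum_(p <- picks s) F p = \sum_(p <- picks s) G p.
Proof.
elim: s F G => [|j s IH] F G FG; first by rewrite !big_nil.
rewrite !sum_picks_cons FG /= ?/weight ?big_cons //; congr (_ + _).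
apply: (IH (fun p => F (p.1, j :: p.2)) (fun p => G (p.1, j :: p.2))) => p E.
by apply: FG; move: E; rewrite /weight /= !big_cons => <-; rewrite addnCA.
Qed.

(** Both sides satisfy the recursion on the first letter of the first root. The splittings in
    [multiT] distribute the stars among the roots, which lie in different components. *)
Lemma sum_tutte n s ws :
    (size (flatten ws) + weight s + size ws < n)%N ->
  \sum_(D <- decorations s) (tutte n ws D)%:R = multiT s ws.
Proof.
elim: n s ws => // n IH s [|[|i w] ws] le.
- case: s {le} => [|j s]; first by rewrite big_seq1.
  by rewrite sum_decorations_cons big1 // => x _; rewrite big1.
- rewrite /= IH; last by move: le; rewrite /=; lia.
  rewrite -{1}(sum_splits_nill s (fun t => multiT t ws)).
  by apply: eq_bigr => p _; rewrite T_nil mulr_natl.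
rewrite [multiT _ _]/=; under [LHS]eq_bigr do rewrite [tutte _ _ _]/= natrD !natr_sum.
under [RHS]eq_bigr do rewrite T_cons mulrDl !mulr_suml.
rewrite !big_split /=; congr (_ + _).
  rewrite exchange_big [RHS]exchange_big /= [LHS]big_seq_cond [RHS]big_seq_cond.
  apply: eq_bigr => -[[u b] v] /= /andP[/cutsP /= E _].
  rewrite IH; last by move: le; rewrite E /= !size_cat /=; lia.
  rewrite /=; under eq_bigr do rewrite mulr_sumr.
  (* After a loop, splitting off the stars of [u] and [v] together and then separating them is the
     same as splitting them off one after the other. *)
  rewrite -(sum_splitsA s (fun x y z => T x u * (T y v * multiT z ws))).
  under [RHS]eq_bigr do rewrite mulr_suml.
  by apply: eq_bigr => p _; apply: eq_bigr => q _; rewrite mulrA.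
under [LHS]eq_bigr do under eq_bigr do rewrite natr_sum.
pose F x D : K := \sum_(q <- cuts x | q.1.2 == i) (tutte n ((q.2 ++ q.1.1 ++ w) :: ws) D)%:R.
rewrite (sum_decorations_picks s F).
pose G j a b : K := (\sum_(x <- st j) \sum_(q <- cuts x | q.1.2 == i)
  T a (q.2 ++ q.1.1 ++ w)) * multiT b ws.
rewrite (sum_splits_picks s G).
apply: weight_picks => -[j s'] /= E; rewrite /F /G.
under [RHS]eq_bigr do rewrite mulr_suml; rewrite [RHS]exchange_big /=.
apply: eq_big_seq => x /st_size sx.
under [RHS]eq_bigr do rewrite mulr_suml; rewrite exchange_big [RHS]exchange_big /=.
rewrite [LHS]big_seq_cond [RHS]big_seq_cond.
apply: eq_bigr => -[[u b] v] /= /andP[/cutsP /= Ex _].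
by rewrite IH //=; move: le sx; rewrite -E Ex /= !size_cat /=; lia.
Qed.

End Decorations.

(** * Estimates for the linearized equation *)

Section Estimates.
Variables (R : archiRealFieldType) (I : eqType) (n : nat).
Variables (dq : I -> 'I_n -> seq (seq I)) (d B : nat).
Hypothesis dq_size : forall i j u, u \in dq i j -> (size u <= d)%N.
Hypothesis dq_count : forall i j, (size (dq i j) <= B)%N.
Implicit Types (a b c e : R) (w u v : seq I) (y : seq I -> R).

Lemma size_cuts w : size (cuts w) = size w.
Proof. by rewrite -[in RHS](cuts_letters w) size_map. Qed.

(** The factorization of a^l - b^l: the cuts realize each pair of exponents with sum l - 1 once. *)
Lemma sum_cuts_geom a b w :
  (a - b) * \sum_(q <- cuts w) a ^+ size q.1.1 * b ^+ size q.2 =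
  a ^+ size w - b ^+ size w.
Proof.
elim: w => [|x w IH]; first by rewrite big_nil mulr0 subrr.
rewrite [cuts _]/= big_cons big_map /=.
under eq_bigr do rewrite exprS -mulrA; rewrite -mulr_sumr mulrDr (mulrCA _ a) IH !exprS; ring.
Qed.

Lemma sum_cuts_le a b c w (P : pred (seq I * I * seq I)) : 0 <= b -> 0 < c -> b + c <= a ->
  \sum_(q <- cuts w | P q) a ^+ size q.1.1 * b ^+ size q.2 <= a ^+ size w / c.
Proof.
move=> b0 c0 bca; have a0 : 0 <= a by apply: le_trans bca; rewrite addr_ge0 // ltW.
rewrite ler_pdivlMr // mulrC.
apply: (@le_trans _ _ ((a - b) * \sum_(q <- cuts w) a ^+ size q.1.1 * b ^+ size q.2)).
  apply: ler_pM.
  - exact: ltW.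
  - by apply: sumr_ge0 => q _; rewrite mulr_ge0 ?exprn_ge0.
  - lra.
  - rewrite [leRHS](bigID P) /= lerDl sumr_ge0 // => q _.
    by rewrite mulr_ge0 ?exprn_ge0.
by rewrite sum_cuts_geom lerBlDr lerDl exprn_ge0.
Qed.

Lemma sum_cuts_ler a b c w (P : pred (seq I * I * seq I)) : 0 <= b -> 0 < c -> b + c <= a ->
  \sum_(q <- cuts w | P q) b ^+ size q.1.1 * a ^+ size q.2 <= a ^+ size w / c.
Proof.
move=> b0 c0 bca; have a0 : 0 <= a by apply: le_trans bca; rewrite addr_ge0 // ltW.
rewrite ler_pdivlMr // mulrC.
apply: (@le_trans _ _ ((a - b) * \sum_(q <- cuts w) b ^+ size q.1.1 * a ^+ size q.2)).
  apply: ler_pM.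
  - exact: ltW.
  - by apply: sumr_ge0 => q _; rewrite mulr_ge0 ?exprn_ge0.
  - lra.
  - rewrite [leRHS](bigID P) /= lerDl sumr_ge0 // => q _.
    by rewrite mulr_ge0 ?exprn_ge0.
by rewrite -opprB mulNr sum_cuts_geom opprB lerBlDr lerDl exprn_ge0.
Qed.

Lemma ler_sum_const (A : eqType) (r : seq A) (F : A -> R) (k : nat) c :
    0 <= c -> (size r <= k)%N -> (forall x, x \in r -> F x <= c) ->
  \sum_(x <- r) F x <= k%:R * c.
Proof.
move=> c0 rk Fc; apply: (@le_trans _ _ ((size r)%:R * c)); last first.
  by rewrite ler_wpM2r // ler_nat.
rewrite big_seq; apply: (@le_trans _ _ (\sum_(x <- r) c)).
  rewrite [leRHS]big_seq; exact: ler_sum.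
by rewrite big_const_seq count_predT iter_addr_0 mulr_natl.
Qed.

Definition tsize (t : 'rV[R]_n) : R := \sum_j `|t ord0 j|.

Definition drift (t : 'rV[R]_n) i w y : R :=
  \sum_j `|t ord0 j| * \sum_(u <- dq i j) `|y (u ++ w)|.

Lemma drift_le t i w y (K G : R) : 0 <= K -> 1 <= G ->
    (forall w, `|y w| <= K * G ^+ size w) ->
  drift t i w y <= tsize t * (B%:R * G ^+ d) * (K * G ^+ size w).
Proof.
move=> K0 G1 yK; rewrite /drift /tsize !mulr_suml; apply: ler_sum => j _.
rewrite -!mulrA ler_wpM2l //; apply: (ler_sum_const (k := B)) => // [|u uq].
  by rewrite !mulr_ge0 ?exprn_ge0 //; apply: le_trans G1.
apply: le_trans (yK _) _; rewrite mulrCA ler_wpM2l // size_cat exprD.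
rewrite ler_wpM2r ?exprn_ge0 //; first exact: le_trans G1.
by rewrite ler_weXn2l //; apply: dq_size uq.
Qed.

(* This is what the difference y of two solutions bounded by rho ^ |w| satisfies, up to a
   source term of size e. *)
Definition subsolution (rho e G : R) t y : Prop := forall i w,
  `|y (i :: w)| <=
   \sum_(q <- cuts w | q.1.2 == i)
      (`|y q.1.1| * rho ^+ size q.2 + rho ^+ size q.1.1 * `|y q.2|) +
   drift t i w y + e * G ^+ (size w).+1.

(** The contraction. The gap of 8 between [rho] and [G] bounds each of the two cut sums by K/8,
    hence both by K/4, and the smallness of [t] bounds the drift by K/4 as well: together K/2. *)
Lemma subsolution_step rho e G t y (K : R) :
    0 <= rho -> 1 <= G -> rho + 8 <= G -> tsize t * (B%:R * G ^+ d) <= 4^-1 -> 0 <= K ->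
    `|y [::]| <= e -> subsolution rho e G t y ->
    (forall w, `|y w| <= K * G ^+ size w) ->
  forall w, `|y w| <= (K / 2 + e) * G ^+ size w.
Proof.
move=> rho0 G1 rG tG K0 ye ys yK [|i w].
  by rewrite expr0 mulr1; apply: le_trans ye _; rewrite lerDr divr_ge0.
have G0 : 0 <= G by apply: le_trans G1.
apply: le_trans (ys i w) _.
have dl := drift_le t i w K0 G1 yK.
have Gw : G ^+ size w <= G ^+ (size w).+1 by rewrite exprS ler_peMl ?exprn_ge0.
have Gw0 : 0 <= G ^+ size w by rewrite exprn_ge0.
rewrite mulrDl lerD2r.
have -> : K / 2 * G ^+ size (i :: w) = K / 4 * G ^+ (size w).+1 + 4^-1 * (K * G ^+ (size w).+1).
  by rewrite /=; field.
apply: lerD; last first.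
  apply: le_trans dl _; apply: ler_pM => //; rewrite ?mulr_ge0 ?ler_wpM2l //.
  - by rewrite sumr_ge0.
  - by rewrite exprn_ge0.
apply: (@le_trans _ _ (\sum_(q <- cuts w | q.1.2 == i)
   (K * (G ^+ size q.1.1 * rho ^+ size q.2) + K * (rho ^+ size q.1.1 * G ^+ size q.2)))).
  apply: ler_sum => q _; rewrite mulrA mulrCA; apply: lerD.
    by rewrite ler_wpM2r ?exprn_ge0.
  by rewrite ler_wpM2l ?exprn_ge0.
rewrite big_split -!mulr_sumr /=.
have c1 := sum_cuts_le w (fun q => q.1.2 == i) rho0 (ltr0Sn _ 7) rG.
have c2 := sum_cuts_ler w (fun q => q.1.2 == i) rho0 (ltr0Sn _ 7) rG.
apply: le_trans (lerD (ler_wpM2l K0 c1) (ler_wpM2l K0 c2)) _.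
have := ler_wpM2l K0 Gw; lra.
Qed.

Lemma le_halvings (x a b : R) : (forall k, x <= a / 2 ^+ k + b) -> x <= b.
Proof.
move=> h; apply/ler_addgt0Pr => eps eps0.
have [k hk] : exists k, `|a| / eps < 2 ^+ k.
  by exists (Num.bound (`|a| / eps)); apply: upper_nthrootP.
apply: le_trans (h k) _; rewrite addrC lerD2l.
rewrite ler_pdivrMr ?exprn_gt0 //.
move: hk; rewrite ltr_pdivrMr // mulrC => /ltW; apply: le_trans; exact: ler_norm.
Qed.

(** Iterating K -> K/2 + e, whose fixed point is 2e. The a priori constant [K] disappears from the
    conclusion. *)
Lemma subsolution_le rho e G t y (K : R) :
    0 <= rho -> 1 <= G -> rho + 8 <= G -> tsize t * (B%:R * G ^+ d) <= 4^-1 ->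
    `|y [::]| <= e -> subsolution rho e G t y ->
    (forall w, `|y w| <= K * G ^+ size w) ->
  forall w, `|y w| <= 2 * e * G ^+ size w.
Proof.
move=> rho0 G1 rG tG ye ys yK w.
have e0 : 0 <= e by apply: le_trans ye.
have K0 : 0 <= K by have := yK [::]; rewrite expr0 mulr1; apply: le_trans.
suff h k : forall w, `|y w| <= (K / 2 ^+ k + 2 * e) * G ^+ size w.
  apply: (@le_halvings _ (K * G ^+ size w)) => k; apply: le_trans (h k w) _.
  by rewrite mulrDl mulrAC.
elim: k => [|k IH] {}w.
  apply: le_trans (yK w) _; rewrite ler_wpM2r ?exprn_ge0 //; first exact: le_trans G1.
  by rewrite expr0 divr1 lerDl mulr_ge0.
have := subsolution_step rho0 G1 rG tG _ ye ys IH w.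
have K2 : 0 <= K / 2 ^+ k + 2 * e by rewrite addr_ge0 ?mulr_ge0 ?invr_ge0 ?exprn_ge0.
move=> /(_ K2); suff -> : (K / 2 ^+ k + 2 * e) / 2 + e = K / 2 ^+ k.+1 + 2 * e by [].
by rewrite exprS invfM; field; rewrite expf_neq0 // pnatr_eq0.
Qed.

End Estimates.

Section SplitFacts.
Variable J : eqType.
Implicit Types s : seq J.

Lemma splitsP s p : p \in splits s ->
  [/\ (size p.1 + size p.2)%N = size s, nilp p.2 -> p.1 = s & nilp p.1 -> p.2 = s].
Proof.
elim: s p => [|x s IH] p /=; first by rewrite inE => /eqP->.
rewrite mem_cat => /orP[] /mapP[q /IH[<- q1 q2] ->]; split=> //=.
- by move/q1 ->.
- by rewrite addnS.
- by move/q2 ->.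
Qed.

Lemma size_splits s : size (splits s) = (2 ^ size s)%N.
Proof. by elim: s => //= x s IH; rewrite size_cat !size_map IH expnS mul2n addnn. Qed.

Lemma size_picks s : size (picks s) = size s.
Proof. by rewrite -[in RHS](picks_fst s) size_map. Qed.

Lemma picks_size s p : p \in picks s -> (size p.2).+1 = size s.
Proof. by case/picksP => s1 [s2 [-> ->]]; rewrite !size_cat /= addnS. Qed.

End SplitFacts.

(** * A common estimate for difference quotients and for differences of two of them *)

Section SplitEstimate.
Variables (R : archiRealFieldType) (I : eqType) (n : nat).
Variables (dq : I -> 'I_n -> seq (seq I)) (d B : nat).
Hypothesis dq_size : forall i j u, u \in dq i j -> (size u <= d)%N.
Hypothesis dq_count : forall i j, (size (dq i j) <= B)%N.

Definition est_const N (A : R) : R := (3 * 2 ^ N + B + N * B)%:R * A ^+ (d + 2).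

Lemma est_const_ge1 N A : 1 <= A -> 1 <= est_const N A.
Proof.
move=> A1; rewrite /est_const; apply: mulr_ege1; last exact: exprn_ege1.
by rewrite ler1n -addnA ltn_addr // muln_gt0 expn_gt0.
Qed.

(** Here [f] is a quotient, or the difference of two quotients, while [g] and [h] stand for
    derivatives at [t] and at the shifted point. On sequences shorter than [s] the family [f] is
    already of size [eta], so that [f s] is the only unknown. *)
Variables (rho A eta G K : R) (t : 'rV[R]_n) (s : seq 'I_n) (j : 'I_n).
Variables (f g h : seq 'I_n -> seq I -> R).
Hypotheses (rho0 : 0 <= rho) (A1 : 1 <= A) (eta0 : 0 <= eta).
Hypotheses (AG : 2 * A <= G) (rG : rho + 8 <= G).
Hypothesis tG : tsize t * (B%:R * G ^+ d) <= 4^-1.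
Hypothesis f_small : forall a w, (size a < size s)%N -> `|f a w| <= eta * A ^+ (size w).+1.
Hypothesis g_bd : forall a w, (size a <= size s)%N -> `|g a w| <= A ^+ (size w).+1.
Hypothesis h_bd : forall a w, (size a <= size s)%N -> `|h a w| <= A ^+ (size w).+1.
Hypothesis g0_bd : forall w, `|g [::] w| <= rho ^+ size w.
Hypothesis h0_bd : forall w, `|h [::] w| <= rho ^+ size w.
Hypothesis f_nil : `|f s [::]| <= eta.
Hypothesis f_bd : forall w, `|f s w| <= K * G ^+ size w.
Hypothesis f_cons : forall i w, `|f s (i :: w)| <=
  \sum_(q <- cuts w | q.1.2 == i) \sum_(p <- splits s)
    (`|f p.1 q.1.1| * `|g p.2 q.2| + `|h p.1 q.1.1| * `|f p.2 q.2|
     + eta * (A ^+ (size q.1.1).+1 * A ^+ (size q.2).+1)) +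
  drift dq t i w (f s) +
  (\sum_(u <- dq i j) eta * A ^+ (size (u ++ w)).+1 +
   \sum_(p <- picks s) \sum_(u <- dq i p.1) `|f p.2 (u ++ w)|).

Let A0 : 0 <= A. Proof. exact: le_trans A1. Qed.

(** The unknown [f s] occurs only when one part of the splitting is empty, and then next to a moment
    of order zero, which grows like [rho]; everything else is an error. *)
Lemma split_term_le u v p : p \in splits s ->
  `|f p.1 u| * `|g p.2 v| + `|h p.1 u| * `|f p.2 v|
     + eta * (A ^+ (size u).+1 * A ^+ (size v).+1) <=
  (`|f s u| * rho ^+ size v) *+ nilp p.2 + (rho ^+ size u * `|f s v|) *+ nilp p.1 +
  3 * (eta * (A ^+ (size u).+1 * A ^+ (size v).+1)).
Proof.
case/splitsP => sz n2 n1; set X := eta * _.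
have X0 : 0 <= X by rewrite !mulr_ge0 ?exprn_ge0.
have h1 : `|f p.1 u| * `|g p.2 v| <= (`|f s u| * rho ^+ size v) *+ nilp p.2 + X.
  case: nilP n2 => [p2 /(_ isT) ->|/eqP p2 _].
    by rewrite mulr1n p2 -[leLHS]addr0 lerD // ler_wpM2l.
  rewrite add0r /X mulrA ler_pM // ?f_small ?g_bd -?sz ?leq_addl //.
  by rewrite -[ltnLHS]addn0 ltn_add2l lt0n size_eq0.
have h2 : `|h p.1 u| * `|f p.2 v| <= (rho ^+ size u * `|f s v|) *+ nilp p.1 + X.
  case: nilP n1 => [p1 /(_ isT) ->|/eqP p1 _].
    by rewrite mulr1n p1 -[leLHS]addr0 lerD // ler_wpM2r.
  rewrite add0r /X mulrCA ler_pM // ?f_small ?h_bd -?sz ?leq_addr //.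
  by rewrite -[ltnLHS]add0n ltn_add2r lt0n size_eq0.
lra.
Qed.

Lemma split_subsolution_le w : `|f s w| <= 2 * (eta * est_const (size s) A) * G ^+ size w.
Proof.
have A_G : A <= G by apply: le_trans AG; rewrite ler_peMl // ler1n.
have G1 : 1 <= G by exact: le_trans A_G.
have G0 : 0 <= G by exact: le_trans G1.
apply: (subsolution_le dq_size dq_count rho0 G1 rG tG _ _ f_bd).
  by apply: le_trans f_nil _; rewrite ler_peMr // est_const_ge1.
move=> i {}w; apply: le_trans (f_cons i w) _.
rewrite addrAC [leRHS]addrAC lerD2r.
set N := size s; set l := (size w).+1.
have AGl : A ^+ l <= G ^+ l by apply: lerXn2r; rewrite ?nnegrE.
have E0 : 0 <= eta * A ^+ l by rewrite mulr_ge0 ?exprn_ge0.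
(* The number of cuts is absorbed by a power of 2; this is the reason for requiring [2 * A <= G]. *)
have wl : (size w)%:R * A ^+ l <= G ^+ l.
  apply: (@le_trans _ _ (2 ^+ l * A ^+ l)).
    rewrite ler_wpM2r ?exprn_ge0 // -natrX ler_nat.
    by apply: leq_trans (leqnSn _) _; apply: ltnW; apply: ltn_expl.
  by rewrite -exprMn lerXn2r ?nnegrE // mulr_ge0.
have S1 : \sum_(q <- cuts w | q.1.2 == i) \sum_(p <- splits s)
    (`|f p.1 q.1.1| * `|g p.2 q.2| + `|h p.1 q.1.1| * `|f p.2 q.2|
     + eta * (A ^+ (size q.1.1).+1 * A ^+ (size q.2).+1)) <=
   \sum_(q <- cuts w | q.1.2 == i)
      (`|f s q.1.1| * rho ^+ size q.2 + rho ^+ size q.1.1 * `|f s q.2|) +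
   (size w)%:R * ((2 ^ N)%:R * (3 * (eta * A ^+ l))).
  apply: (@le_trans _ _ (\sum_(q <- cuts w | q.1.2 == i)
     ((`|f s q.1.1| * rho ^+ size q.2 + rho ^+ size q.1.1 * `|f s q.2|) +
      (2 ^ N)%:R * (3 * (eta * A ^+ l))))); last first.
    rewrite big_split /= lerD2l big_mkcond /=; apply: ler_sum_const.
    - by rewrite !mulr_ge0 ?exprn_ge0.
    - by rewrite size_cuts.
    - by move=> q _; case: ifP => // _; rewrite !mulr_ge0 ?exprn_ge0.
  rewrite big_seq_cond [leRHS]big_seq_cond; apply: ler_sum => -[[u c] v] /= /andP[/cutsP /= Ew _].
  have El : A ^+ (size u).+1 * A ^+ (size v).+1 = A ^+ l.
    by rewrite -exprD /l Ew size_cat /= addSn.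
  rewrite El -addrA.
  rewrite -[X in _ <= X + _](sum_splits_nilr s (fun a => `|f a u| * rho ^+ size v)).
  rewrite -[X in _ <= _ + (X + _)](sum_splits_nill s (fun a => rho ^+ size u * `|f a v|)).
  apply: (@le_trans _ _ (\sum_(p <- splits s) ((`|f p.1 u| * rho ^+ size v) *+ nilp p.2 +
      ((rho ^+ size u * `|f p.2 v|) *+ nilp p.1 + 3 * (eta * A ^+ l))))).
    rewrite big_seq [leRHS]big_seq; apply: ler_sum => p ps.
    have := split_term_le u v ps; rewrite El addrA => /le_trans; apply.
    have [_ n2 n1] := splitsP ps.
    rewrite lerD2r; apply: lerD.
      by case: (nilp p.2) n2 => // /(_ isT) ->.
    by case: (nilp p.1) n1 => // /(_ isT) ->.
  rewrite !big_split /= lerD2l lerD2l; apply: ler_sum_const => //.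
    by rewrite mulr_ge0.
  by rewrite size_splits.
have ub u p : u \in dq i p -> A ^+ (size (u ++ w)).+1 <= A ^+ d * A ^+ l.
  move=> up; rewrite -exprD ler_weXn2l // size_cat -addnS leq_add2r.
  exact: dq_size up.
have Ad : 0 <= A ^+ d * A ^+ l by rewrite mulr_ge0 ?exprn_ge0.
have S2 : \sum_(u <- dq i j) eta * A ^+ (size (u ++ w)).+1 <= B%:R * (eta * (A ^+ d * A ^+ l)).
  apply: ler_sum_const => [|//|u uq]; first by rewrite mulr_ge0.
  by rewrite ler_wpM2l // (ub _ _ uq).
have S3 : \sum_(p <- picks s) \sum_(u <- dq i p.1) `|f p.2 (u ++ w)| <=
   N%:R * (B%:R * (eta * (A ^+ d * A ^+ l))).
  apply: ler_sum_const => [||p ps]; first by rewrite !mulr_ge0 ?exprn_ge0.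
    by rewrite size_picks.
  apply: ler_sum_const => [|//|u uq]; first by rewrite mulr_ge0.
  apply: le_trans (f_small _ _) _; first by rewrite -(picks_size ps).
  by rewrite ler_wpM2l // (ub _ _ uq).
apply: le_trans (lerD S1 (lerD S2 S3)) _.
rewrite -addrA lerD2l -/l /est_const exprD.
have A2 : 1 <= A ^+ 2 by rewrite exprn_ege1.
have Adge1 : 1 <= A ^+ d by rewrite exprn_ege1.
have Gl0 : 0 <= G ^+ l by rewrite exprn_ge0.
have P1 : (size w)%:R * ((2 ^ N)%:R * (3 * (eta * A ^+ l))) <=
          (3 * 2 ^ N)%:R * (eta * (A ^+ d * A ^+ 2 * G ^+ l)).
  have -> : (size w)%:R * ((2 ^ N)%:R * (3 * (eta * A ^+ l))) =
            (3 * 2 ^ N)%:R * (eta * ((size w)%:R * A ^+ l)) by rewrite natrM; ring.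
  rewrite !ler_wpM2l //; apply: le_trans wl _; rewrite ler_peMl //.
  by rewrite -[1]mul1r ler_pM.
have P2 : eta * (A ^+ d * A ^+ l) <= eta * (A ^+ d * A ^+ 2 * G ^+ l).
  rewrite ler_wpM2l // -mulrA ler_wpM2l ?exprn_ge0 //; apply: le_trans AGl _.
  by rewrite ler_peMl.
have P3 := ler_wpM2l (ler0n R B) P2.
have P4 := ler_wpM2l (ler0n R N) P3.
apply: le_trans (lerD P1 (lerD P3 P4)) _.
by rewrite !natrD !natrM le_eqVlt; apply/orP; left; apply/eqP; ring.
Qed.

End SplitEstimate.

Local Open Scope classical_set_scope.
Local Open Scope ring_scope.

(** * Derivatives of the moments *)

Section Smoothness.
Variables (R : realType) (I : eqType) (n : nat).
Variables (dq : I -> 'I_n -> seq (seq I)) (d B : nat).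
Hypothesis dq_size : forall i j u, u \in dq i j -> (size u <= d)%N.
Hypothesis dq_count : forall i j, (size (dq i j) <= B)%N.
Variable x : 'rV[R]_n -> seq I -> R.
Implicit Types (t : 'rV[R]_n) (s : seq 'I_n) (j k : 'I_n) (w u v : seq I) (h eps A : R).

Local Notation e j := (delta_mx ord0 j : 'rV[R]_n).

Fixpoint iterD s t w : R :=
  if s is j :: s' then 'D_(e j) (fun t' => iterD s' t' w) t else x t w.

Definition box eps t : Prop := forall j, `|t ord0 j| < eps.

Lemma box_near eps t : box eps t -> \forall t' \near t, box eps t'.
Proof.
move=> bt; apply: (@filter_forall _ _ (fun j t' => `|t' ord0 j| < eps) (nbhs t) (nbhs_filter t)) => j.
apply/nbhs_ballP.
exists (eps - `|t ord0 j|); first by rewrite /= subr_gt0.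
move=> t' [_ /(_ ord0 j)]; rewrite /ball /= => tt'.
have -> : t' ord0 j = t ord0 j - (t ord0 j - t' ord0 j) by rewrite opprB addrC subrK.
by apply: le_lt_trans (ler_normB _ _) _; rewrite -ltrBrDl.
Qed.

Lemma box_le eps eps' t : eps <= eps' -> box eps t -> box eps' t.
Proof. by move=> le bt j; apply: lt_le_trans le. Qed.

Lemma box_tsize eps t : box eps t -> tsize t <= n%:R * eps.
Proof.
move=> bt; apply: (@le_trans _ _ (\sum_(j < n) eps)).
  by apply: ler_sum => j _; apply: ltW.
by rewrite sumr_const card_ord mulr_natl.
Qed.

Lemma shiftE t h j k : (t + h *: e j) ord0 k = t ord0 k + h * (k == j)%:R.
Proof. by rewrite !mxE eqxx. Qed.

Lemma box_shift_norm eps t h j : box eps t -> box eps (t + h *: e j) -> `|h| <= 2 * eps.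
Proof.
move=> /(_ j) bt /(_ j); rewrite shiftE eqxx mulr1 => bt'.
have -> : h = (t ord0 j + h) - t ord0 j by rewrite addrAC subrr add0r.
by apply: le_trans (ler_normB _ _) _; rewrite mulr2n mulrDl mul1r lerD // ltW.
Qed.

Lemma box_shift_near eps t j : box eps t -> \forall h \near 0^', box eps (t + h *: e j).
Proof.
move=> bt.
apply: (@filter_forall _ _ (fun k h => `|(t + h *: e j) ord0 k| < eps) _ (dnbhs_filter 0)) => k; case: (eqVneq k j) => [->|kj]; last first.
  by apply: nearW => h; rewrite shiftE (negbTE kj) mulr0 addr0.
have e0 : 0 < eps - `|t ord0 j| by rewrite subr_gt0.
near=> h; rewrite shiftE eqxx mulr1.
apply: le_lt_trans (ler_normD _ _) _; rewrite -ltrBrDl.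
by near: h; apply: dnbhs0_lt.
Unshelve. all: by end_near. Qed.

Definition quot h j s t w : R := h^-1 * (iterD s (t + h *: e j) w - iterD s t w).

Lemma quotK h j s t w : h != 0 -> iterD s (t + h *: e j) w - iterD s t w = h * quot h j s t w.
Proof. by move=> h0; rewrite /quot mulVKf. Qed.

(** The equation differentiated along [s]: the splittings come from the Leibniz rule, and the sum
    over [picks] from derivatives falling on a coefficient t_k. *)
Definition sd_eq s t : Prop := forall i w,
  iterD s t (i :: w) =
  \sum_(q <- cuts w | q.1.2 == i) \sum_(p <- splits s) iterD p.1 t q.1.1 * iterD p.2 t q.2
  - \sum_k t ord0 k * (\sum_(u <- dq i k) iterD s t (u ++ w))
  - \sum_(p <- picks s) \sum_(u <- dq i p.1) iterD p.2 t (u ++ w).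

(** Discrete Leibniz rule, from a'b' - ab = (a' - a)b + a'(b' - b). The sum over [dq i j] alone
    comes from the shift of the coefficient t_j. *)
Lemma quot_eq h j s t i w : h != 0 -> sd_eq s t -> sd_eq s (t + h *: e j) ->
  quot h j s t (i :: w) =
  \sum_(q <- cuts w | q.1.2 == i) \sum_(p <- splits s)
     (quot h j p.1 t q.1.1 * iterD p.2 t q.2 +
      iterD p.1 (t + h *: e j) q.1.1 * quot h j p.2 t q.2)
  - \sum_k t ord0 k * (\sum_(u <- dq i k) quot h j s t (u ++ w))
  - \sum_(u <- dq i j) iterD s (t + h *: e j) (u ++ w)
  - \sum_(p <- picks s) \sum_(u <- dq i p.1) quot h j p.2 t (u ++ w).
Proof.
move=> h0 E E'; apply: (mulfI h0); rewrite -quotK // E E'.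
set t' := t + h *: e j.
rewrite !mulrBr.
have -> : h * \sum_(q <- cuts w | q.1.2 == i) \sum_(p <- splits s)
     (quot h j p.1 t q.1.1 * iterD p.2 t q.2 + iterD p.1 t' q.1.1 * quot h j p.2 t q.2) =
   \sum_(q <- cuts w | q.1.2 == i) \sum_(p <- splits s) iterD p.1 t' q.1.1 * iterD p.2 t' q.2
  - \sum_(q <- cuts w | q.1.2 == i) \sum_(p <- splits s) iterD p.1 t q.1.1 * iterD p.2 t q.2.
  rewrite mulr_sumr -sumrB; apply: eq_bigr => q _.
  rewrite mulr_sumr -sumrB; apply: eq_bigr => p _.
  by rewrite mulrDr mulrA -quotK // mulrCA -quotK // -/t'; ring.
have -> : h * \sum_(p <- picks s) \sum_(u <- dq i p.1) quot h j p.2 t (u ++ w) =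
  \sum_(p <- picks s) \sum_(u <- dq i p.1) iterD p.2 t' (u ++ w) -
  \sum_(p <- picks s) \sum_(u <- dq i p.1) iterD p.2 t (u ++ w).
  rewrite mulr_sumr -sumrB; apply: eq_bigr => q _.
  by rewrite mulr_sumr -sumrB; apply: eq_bigr => p _; rewrite -quotK.
have -> : \sum_k t' ord0 k * (\sum_(u <- dq i k) iterD s t' (u ++ w)) =
  h * \sum_k t ord0 k * (\sum_(u <- dq i k) quot h j s t (u ++ w)) +
  \sum_k t ord0 k * (\sum_(u <- dq i k) iterD s t (u ++ w)) +
  h * \sum_(u <- dq i j) iterD s t' (u ++ w).
  rewrite mulr_sumr -big_split /=.
  rewrite [X in _ = _ + X](_ : _ = \sum_k h * (k == j)%:R * \sum_(u <- dq i k) iterD s t' (u ++ w)).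
    rewrite -big_split /=; apply: eq_bigr => k _; rewrite shiftE.
    have Ek : h * \sum_(u <- dq i k) quot h j s t (u ++ w) =
      \sum_(u <- dq i k) iterD s t' (u ++ w) - \sum_(u <- dq i k) iterD s t (u ++ w).
      by rewrite mulr_sumr -sumrB; apply: eq_bigr => u _; rewrite -quotK.
    by rewrite (mulrCA h) Ek; ring.
  rewrite [RHS](bigD1 j) //= eqxx mulr1 [X in _ = _ + X]big1 ?addr0 // => k /negbTE ->.
  by rewrite mulr0 mul0r.
ring.
Qed.

(** The induction invariant. The exponent [(size w).+1] lets one number [A] serve as growth rate and
    as constant factor. The rate in [sm_quot] bounds the quotients of lower order uniformly in [h];
    [eps <= 1] keeps [|h|] below 2. *)
Record smooth_upto (N : nat) eps A : Prop := SmoothUpto {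
  sm_eps : 0 < eps <= 1;
  sm_ge1 : 1 <= A;
  sm_bd : forall s t w, (size s <= N)%N -> box eps t -> `|iterD s t w| <= A ^+ (size w).+1;
  sm_nil : forall s t, (size s <= N)%N -> box eps t -> iterD s t [::] = (nilp s)%:R;
  sm_eq : forall s t, (size s <= N)%N -> box eps t -> sd_eq s t;
  sm_der : forall s t w j, (size s < N)%N -> box eps t ->
    derivable (fun t' => iterD s t' w) t (e j);
  sm_quot : forall s t w j h, (size s < N)%N -> h != 0 -> box eps t ->
    box eps (t + h *: e j) ->
    `|quot h j s t w - iterD (j :: s) t w| <= `|h| * A ^+ (size w).+1 }.

Lemma mul_exp_le (c X Z : R) l : 0 <= c -> 0 <= X -> c + X <= Z -> c * X ^+ l <= Z ^+ l.+1.
Proof.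
move=> c0 X0 cXZ; have Z0 : 0 <= Z by apply: le_trans cXZ; rewrite addr_ge0.
rewrite exprS ler_pM ?exprn_ge0 //; first by apply: le_trans cXZ; rewrite lerDl.
by apply: lerXn2r; rewrite ?nnegrE //; apply: le_trans cXZ; rewrite lerDr.
Qed.

Lemma exists_small (G eps : R) : 0 <= G -> 0 < eps -> exists eps', 0 < eps' <= eps /\
  forall t, box eps' t -> tsize t * (B%:R * G ^+ d) <= 4^-1.
Proof.
move=> G0 eps0; set M := n%:R * (B%:R * G ^+ d).
have M0 : 0 <= M by rewrite !mulr_ge0 ?exprn_ge0.
have M1 : 0 < 4 * (M + 1) by rewrite mulr_gt0 // ltr_wpDl.
exists (Num.min eps (4 * (M + 1))^-1); split.
  by rewrite lt_min eps0 invr_gt0 M1 ge_min lexx.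
move=> t /box_tsize; set m := Num.min _ _ => tm.
apply: (@le_trans _ _ (n%:R * m * (B%:R * G ^+ d))).
  by rewrite ler_wpM2r // mulr_ge0 ?exprn_ge0.
rewrite mulrAC -/M; apply: (@le_trans _ _ (M * (4 * (M + 1))^-1)).
  by rewrite ler_wpM2l // ge_min lexx orbT.
rewrite invfM mulrCA -[leRHS]mulr1 ler_wpM2l ?invr_ge0 //.
by rewrite ler_pdivrMr ?mul1r ?lerDl // ltr_wpDl.
Qed.

Lemma ler_norm_seq (T : eqType) (r : seq T) (P : pred T) (F F' : T -> R) :
    (forall z, z \in r -> P z -> `|F z| <= F' z) ->
  `|\sum_(z <- r | P z) F z| <= \sum_(z <- r | P z) F' z.
Proof.
move=> FF; apply: le_trans (ler_norm_sum _ _ _) _.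
rewrite big_seq_cond [leRHS]big_seq_cond; apply: ler_sum => z /andP[zr Pz].
exact: FF.
Qed.

Lemma ler_norm4 (a b c f a' b' c' f' : R) : `|a| <= a' -> `|b| <= b' -> `|c| <= c' -> `|f| <= f' ->
  `|a - b - c - f| <= a' + b' + (c' + f').
Proof.
move=> ha hb hc hf; rewrite addrA.
apply: le_trans (ler_normB _ _) _; rewrite lerD //.
apply: le_trans (ler_normB _ _) _; rewrite lerD //.
by apply: le_trans (ler_normB _ _) _; rewrite lerD.
Qed.

Lemma norm_drift_le t i w (y : seq I -> R) :
  `|\sum_k t ord0 k * (\sum_(u <- dq i k) y (u ++ w))| <= drift dq t i w y.
Proof.
apply: le_trans (ler_norm_sum _ _ _) _; apply: ler_sum => k _.
by rewrite normrM ler_wpM2l // ler_norm_sum.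
Qed.

Section Step.
Variables (N : nat) (rho eps A : R).
Hypothesis sm : smooth_upto N eps A.
Hypothesis rho0 : 0 <= rho.
Hypothesis x_bd : forall t w, box eps t -> `|x t w| <= rho ^+ size w.

(** Uniform Lipschitz bound at the top order. On shorter sequences a quotient is within [|h|] times
    a power of [A] of a derivative bounded by that same power, and [|h| <= 2]: hence the constant
    3. *)
Lemma quot_lip G s t h j w : 2 * A <= G -> rho + 8 <= G ->
    tsize t * (B%:R * G ^+ d) <= 4^-1 -> (size s <= N)%N -> h != 0 ->
    box eps t -> box eps (t + h *: e j) ->
  `|quot h j s t w| <= 2 * (3 * est_const d B (size s) A) * G ^+ size w.
Proof.
move=> AG rG tG sN h0 bt bt'.
have A1 := sm_ge1 sm; have A0 : 0 <= A by exact: le_trans A1.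
have A_G : A <= G by apply: le_trans AG; rewrite ler_peMl // ler1n.
have G1 : 1 <= G by exact: le_trans A_G.
have G0 : 0 <= G by exact: le_trans G1.
have C1 := est_const_ge1 d B (size s) A1.
have h2 : `|h| <= 2.
  apply: le_trans (box_shift_norm bt bt') _.
  by rewrite ler_piMr //; case/andP: (sm_eps sm).
have small a v : (size a < N)%N -> `|quot h j a t v| <= 3 * A ^+ (size v).+1.
  move=> aN; have q := sm_quot sm v aN h0 bt bt'.
  have b := @sm_bd _ _ _ sm (j :: a) t v aN bt.
  rewrite -[quot _ _ _ _ _](subrK (iterD (j :: a) t v)).
  apply: le_trans (ler_normD _ _) _.
  apply: le_trans (lerD q b) _; rewrite -[X in _ + X]mul1r -mulrDl ler_wpM2r ?exprn_ge0 //.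
  by apply: le_trans (lerD h2 (lexx 1)) _; rewrite -(natrD _ 2 1).
(* The a priori constant is the trivial bound on a quotient and blows up as [h] tends to 0, which is
   harmless as it is absent from the conclusion. *)
apply: (@split_subsolution_le _ _ _ _ _ _ dq_size dq_count rho A 3 G (`|h|^-1 * (2 * A)) t s j
  (fun a v => quot h j a t v) (fun a v => iterD a t v)
  (fun a v => iterD a (t + h *: e j) v)) => //.
- by move=> a v as_; apply: small; apply: leq_trans sN.
- by move=> a v as_; apply: (sm_bd sm) => //; apply: leq_trans sN.
- by move=> a v as_; apply: (sm_bd sm) => //; apply: leq_trans sN.
- by move=> v; apply: x_bd.
- by move=> v; apply: x_bd.
- by rewrite /quot !(sm_nil sm) // subrr mulr0 normr0.
- move=> v; rewrite /quot normrM normfV -!mulrA ler_wpM2l ?invr_ge0 //.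
  apply: le_trans (ler_normB _ _) _.
  apply: le_trans (lerD (sm_bd sm v sN bt') (sm_bd sm v sN bt)) _.
  have AG' : A ^+ (size v).+1 <= A * G ^+ size v.
    by rewrite exprS ler_wpM2l // lerXn2r ?nnegrE.
  apply: le_trans (lerD AG' AG') _; rewrite le_eqVlt; apply/orP; left; apply/eqP; ring.
move=> i v; rewrite (quot_eq i v h0 (sm_eq sm sN bt) (sm_eq sm sN bt')).
apply: ler_norm4.
- apply: ler_norm_seq => q _ _; apply: ler_norm_seq => p _ _.
  apply: le_trans (ler_normD _ _) _; rewrite !normrM lerDl.
  by rewrite !mulr_ge0 ?exprn_ge0.
- exact: norm_drift_le.
- apply: ler_norm_seq => u _ _; apply: le_trans (sm_bd sm _ sN bt') _.
  by rewrite ler_peMl ?exprn_ge0 // ler1n.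
- apply: ler_norm_seq => p _ _; exact: ler_norm_sum.
Qed.

(** Two quotients at the same [t] satisfy the same linear equation up to the difference of the
    shifted points, which the Lipschitz bounds make of order [|h| + |h'|]. *)
Lemma quot_cauchy A1 G s t h h' j w : A <= A1 -> 2 * A1 <= G -> rho + 8 <= G ->
    tsize t * (B%:R * G ^+ d) <= 4^-1 -> (size s <= N)%N -> h != 0 -> h' != 0 ->
    box eps t -> box eps (t + h *: e j) -> box eps (t + h' *: e j) ->
    (forall a v, (size a <= N)%N -> `|quot h j a t v| <= A1 ^+ (size v).+1) ->
    (forall a v, (size a <= N)%N -> `|quot h' j a t v| <= A1 ^+ (size v).+1) ->
  `|quot h j s t w - quot h' j s t w| <=
     2 * ((`|h| + `|h'|) * est_const d B (size s) A1) * G ^+ size w.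
Proof.
move=> AA1 AG rG tG sN h0 h'0 bt bth bth' lh lh'.
have A1g := le_trans (sm_ge1 sm) AA1; have A10 : 0 <= A1 by exact: le_trans A1g.
have A0 : 0 <= A by exact: le_trans (sm_ge1 sm).
have A_G : A1 <= G by apply: le_trans AG; rewrite ler_peMl // ler1n.
have AAl l : A ^+ l <= A1 ^+ l by rewrite lerXn2r ?nnegrE.
have dY a v : (size a <= N)%N ->
    `|iterD a (t + h *: e j) v - iterD a (t + h' *: e j) v| <=
    (`|h| + `|h'|) * A1 ^+ (size v).+1.
  move=> aN; have -> : iterD a (t + h *: e j) v - iterD a (t + h' *: e j) v =
      h * quot h j a t v - h' * quot h' j a t v by rewrite -!quotK //; ring.
  apply: le_trans (ler_normB _ _) _; rewrite (normrM h) (normrM h') mulrDl.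
  by apply: lerD; rewrite ler_wpM2l ?normr_ge0 ?lh ?lh'.
have small a v : (size a < N)%N ->
    `|quot h j a t v - quot h' j a t v| <= (`|h| + `|h'|) * A1 ^+ (size v).+1.
  move=> aN; have q := sm_quot sm v aN h0 bt bth; have q' := sm_quot sm v aN h'0 bt bth'.
  have -> : quot h j a t v - quot h' j a t v = (quot h j a t v - iterD (j :: a) t v) -
    (quot h' j a t v - iterD (j :: a) t v) by ring.
  apply: le_trans (ler_normB _ _) _; rewrite mulrDl; apply: lerD.
    by apply: le_trans q _; rewrite ler_wpM2l.
  by apply: le_trans q' _; rewrite ler_wpM2l.
apply: (@split_subsolution_le _ _ _ _ _ _ dq_size dq_count rho A1 (`|h| + `|h'|) G (2 * A1) t s j
  (fun a v => quot h j a t v - quot h' j a t v) (fun a v => iterD a t v)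
  (fun a v => iterD a (t + h *: e j) v)) => //.
- by rewrite addr_ge0 ?normr_ge0.
- by move=> a v as_; apply: small; apply: leq_trans sN.
- move=> a v as_; apply: le_trans (AAl _); apply: (sm_bd sm) => //; exact: leq_trans sN.
- move=> a v as_; apply: le_trans (AAl _); apply: (sm_bd sm) => //; exact: leq_trans sN.
- by move=> v; apply: x_bd.
- by move=> v; apply: x_bd.
- by rewrite /quot !(sm_nil sm) // subrr !mulr0 subrr normr0 addr_ge0.
- move=> v; apply: le_trans (ler_normB _ _) _.
  have AG' : A1 ^+ (size v).+1 <= A1 * G ^+ size v.
    by rewrite exprS ler_wpM2l // lerXn2r ?nnegrE //; exact: le_trans A_G.
  apply: le_trans (lerD (le_trans (lh _ _ sN) AG') (le_trans (lh' _ _ sN) AG')) _.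
  by rewrite le_eqVlt; apply/orP; left; apply/eqP; ring.
move=> i v; rewrite (quot_eq i v h0 (sm_eq sm sN bt) (sm_eq sm sN bth)).
rewrite (quot_eq i v h'0 (sm_eq sm sN bt) (sm_eq sm sN bth')).
have regroup (a b c f a' b' c' f' : R) :
  (a - b - c - f) - (a' - b' - c' - f') = (a - a') - (b - b') - (c - c') - (f - f') by ring.
rewrite regroup -!sumrB; apply: ler_norm4.
- apply: ler_norm_seq => q _ _; rewrite -sumrB; apply: ler_norm_seq => p ps _.
  have [sz _ _] := splitsP ps.
  have p1N : (size p.1 <= N)%N by apply: leq_trans sN; rewrite -sz leq_addr.
  have p2N : (size p.2 <= N)%N by apply: leq_trans sN; rewrite -sz leq_addl.
  set Q1 := quot h j p.1 t _; set Q2 := quot h j p.2 t _.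
  set Q1' := quot h' j p.1 t _; set Q2' := quot h' j p.2 t _.
  set Y2 := iterD p.2 t _; set Y1 := iterD p.1 (t + h *: _) _.
  set Y1' := iterD p.1 (t + h' *: _) _.
  (* The first two terms are linear in the unknown differences; the third is the source. *)
  have -> : Q1 * Y2 + Y1 * Q2 - (Q1' * Y2 + Y1' * Q2') =
    (Q1 - Q1') * Y2 + Y1 * (Q2 - Q2') + (Y1 - Y1') * Q2' by ring.
  apply: le_trans (ler_normD _ _) _; apply: lerD.
    by apply: le_trans (ler_normD _ _) _; rewrite !normrM.
  by rewrite normrM mulrA ler_pM // ?dY ?lh'.
- under eq_bigr do rewrite -mulrBr -sumrB; exact: norm_drift_le.
- by apply: ler_norm_seq => u _ _; apply: dY.
- apply: ler_norm_seq => p _ _; rewrite -sumrB; exact: ler_norm_sum.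
Qed.

End Step.

(** The derivative exists by completeness; letting [h'] tend to 0 in the Cauchy estimate gives the
    rate. *)
Lemma quot_derivable (eps C : R) s t w j : 0 <= C -> box eps t ->
    (forall h h', h != 0 -> h' != 0 -> box eps (t + h *: e j) -> box eps (t + h' *: e j) ->
       `|quot h j s t w - quot h' j s t w| <= (`|h| + `|h'|) * C) ->
  derivable (fun t' => iterD s t' w) t (e j) /\
  (forall h, h != 0 -> box eps (t + h *: e j) ->
     `|quot h j s t w - iterD (j :: s) t w| <= `|h| * C).
Proof.
move=> C0 bt qC.
have good (r : R) : 0 < r -> \forall h \near 0^', [/\ h != 0, box eps (t + h *: e j) & `|h| * C <= r].
  move=> r0; near=> h; split.
  - by near: h; exact: nbhs_dnbhs_neq.
  - by near: h; exact: box_shift_near.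
  - have hr : `|h| <= r / (C + 1).
      by near: h; apply: dnbhs0_le; rewrite divr_gt0 // ltr_wpDl.
    apply: (@le_trans _ _ (r / (C + 1) * C)); first by rewrite ler_wpM2r.
    by rewrite -mulrA ler_piMr ?(ltW r0) // mulrC ler_pdivrMr ?ltr_wpDl // mul1r lerDl.
have qE h : quot h j s t w =
    h^-1 *: (iterD s (h *: e j + t) w - iterD s t w) by rewrite /quot (addrC t).
have cv : cvg ((fun h => h^-1 *: (iterD s (h *: e j + t) w - iterD s t w)) @ 0^').
  apply/cauchy_cvgP/cauchy_exP => r r0.
  have r4 : 0 < r / 4 by rewrite divr_gt0.
  have [h' [h'0 bh' h'r]] : exists h', [/\ h' != 0, box eps (t + h' *: e j) & `|h'| * C <= r / 4].
    exact: (filter_ex (good _ r4)).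
  exists (quot h' j s t w); have := good _ r4; apply: filterS => h [h0 bh hr].
  rewrite /ball /= -qE; apply: le_lt_trans (qC _ _ h'0 h0 bh' bh) _.
  rewrite mulrDl; apply: le_lt_trans (lerD h'r hr) _.
  by rewrite -mulrDr gtr_pMr //; lra.
split; first exact: cv.
move=> h h0 bh; apply/ler_addgt0Pr => r r0.
have r2 : 0 < r / 2 by rewrite divr_gt0.
have lim0 : (fun h => h^-1 *: (iterD s (h *: e j + t) w - iterD s t w)) @ 0^' -->
    (iterD (j :: s) t w) by exact: cv.
move/cvgrPdist_lt: lim0 => /(_ _ r2) near1.
have /filter_ex[h' [dh' [h'0 bh' h'r]]] := @filterI _ _ (dnbhs_filter (0 : R)) _ _ near1 (good _ r2).
rewrite -qE in dh'.
have -> : quot h j s t w - iterD (j :: s) t w =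
  (quot h j s t w - quot h' j s t w) - (iterD (j :: s) t w - quot h' j s t w) by ring.
apply: le_trans (ler_normB _ _) _.
apply: le_trans (lerD (qC _ _ h0 h'0 bh bh') (ltW dh')) _.
by rewrite mulrDl -addrA lerD2l (le_trans (lerD h'r (lexx _))) // -splitr.
Unshelve. all: by end_near. Qed.

Lemma is_derive_seq (T : eqType) (r : seq T) (P : pred T) (F : T -> 'rV[R]_n -> R)
    (dF : T -> R) t (v : 'rV[R]_n) :
    (forall z, z \in r -> P z -> is_derive t v (F z) (dF z)) ->
  is_derive t v (fun t' => \sum_(z <- r | P z) F z t') (\sum_(z <- r | P z) dF z).
Proof.
elim: r => [|z r IH] FdF.
  rewrite big_nil; under eq_fun do rewrite big_nil; exact: is_derive_cst.
have {}IH := IH (fun z' z'r => FdF z' (mem_behead (s := z :: r) z'r)).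
rewrite big_cons; under eq_fun do rewrite big_cons.
case: ifP => Pz; last exact: IH.
exact: (is_deriveD (FdF z (mem_head _ _) Pz) IH).
Qed.

Lemma is_derive_coord t j k : is_derive t (e j) (fun t' : 'rV[R]_n => t' ord0 k) (k == j)%:R.
Proof.
have lim : (fun h : R => h^-1 *: ((h *: e j + t) ord0 k - t ord0 k)) @ 0^' --> ((k == j)%:R : R).
  apply: (@cvg_trans _ ((fun=> (k == j)%:R : R) @ (0 : R)^')); last exact: cvg_cst.
  apply: near_eq_cvg; near=> h.
  have h0 : h != 0 by near: h; exact: nbhs_dnbhs_neq.
  by rewrite !mxE eqxx addrK /= scalerA mulVf // scale1r.
split; first by apply/cvg_ex; exists ((k == j)%:R : R).
exact: (cvg_lim _ lim).
Unshelve. all: by end_near. Qed.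

Lemma is_derive_sub (F1 F2 : 'rV[R]_n -> R) (d1 d2 : R) t (v : 'rV[R]_n) :
  is_derive t v F1 d1 -> is_derive t v F2 d2 ->
  is_derive t v (fun t' => F1 t' - F2 t') (d1 - d2).
Proof. by move=> h1 h2; exact: is_deriveB. Qed.

Lemma is_derive_mul (F1 F2 : 'rV[R]_n -> R) (d1 d2 : R) t (v : 'rV[R]_n) :
  is_derive t v F1 d1 -> is_derive t v F2 d2 ->
  is_derive t v (fun t' => F1 t' * F2 t') (d1 * F2 t + F1 t * d2).
Proof.
move=> h1 h2; have := is_deriveM h1 h2.
by rewrite addrC [_ *: d1]mulrC.
Qed.

(** The new direction joins either part of each splitting, or is the one picked when it falls on the
    coefficient t_j; these are the recursive clauses of [splits] and [picks]. *)
Lemma sd_eq_cons (N : nat) (eps : R) s t j : (size s <= N)%N -> box eps t ->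
    (forall t', box eps t' -> sd_eq s t') ->
    (forall a v, (size a <= N)%N -> derivable (fun t' => iterD a t' v) t (e j)) ->
  sd_eq (j :: s) t.
Proof.
move=> sN bt eq_s der i w.
have D a v : (size a <= N)%N -> is_derive t (e j) (fun t' => iterD a t' v) (iterD (j :: a) t v).
  by move=> aN; apply: derivableP; exact: der.
have near_s : \near t, iterD s t (i :: w) =
  \sum_(q <- cuts w | q.1.2 == i) \sum_(p <- splits s) iterD p.1 t q.1.1 * iterD p.2 t q.2
  - \sum_k t ord0 k * (\sum_(u <- dq i k) iterD s t (u ++ w))
  - \sum_(p <- picks s) \sum_(u <- dq i p.1) iterD p.2 t (u ++ w).
  by apply: filterS (box_near bt) => t' bt'; exact: eq_s.
rewrite [LHS]/= (near_eq_derive _ near_s).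
have S1 : is_derive t (e j) (fun t => \sum_(q <- cuts w | q.1.2 == i)
     \sum_(p <- splits s) iterD p.1 t q.1.1 * iterD p.2 t q.2)
   (\sum_(q <- cuts w | q.1.2 == i) \sum_(p <- splits s)
     (iterD (j :: p.1) t q.1.1 * iterD p.2 t q.2 + iterD p.1 t q.1.1 * iterD (j :: p.2) t q.2)).
  apply: is_derive_seq => q _ _; apply: is_derive_seq => p ps _.
  have [sz _ _] := splitsP ps.
  by apply: is_derive_mul; apply: D; apply: leq_trans sN; rewrite -sz ?leq_addr ?leq_addl.
have S2 : is_derive t (e j) (fun t => \sum_k t ord0 k * (\sum_(u <- dq i k) iterD s t (u ++ w)))
   (\sum_k ((k == j)%:R * (\sum_(u <- dq i k) iterD s t (u ++ w)) +
             t ord0 k * (\sum_(u <- dq i k) iterD (j :: s) t (u ++ w)))).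
  apply: is_derive_seq => k _ _; apply: is_derive_mul; first exact: is_derive_coord.
  by apply: is_derive_seq => u _ _; exact: D.
have S3 : is_derive t (e j) (fun t => \sum_(p <- picks s) \sum_(u <- dq i p.1) iterD p.2 t (u ++ w))
   (\sum_(p <- picks s) \sum_(u <- dq i p.1) iterD (j :: p.2) t (u ++ w)).
  apply: is_derive_seq => p ps _; apply: is_derive_seq => u _ _; apply: D.
  by apply: leq_trans sN; rewrite -(picks_size ps).
rewrite (derive_val (is_derive := is_derive_sub (is_derive_sub S1 S2) S3)).
rewrite sum_picks_cons /= opprD addrA; congr (_ - _).
rewrite big_split /= opprD addrA.
have -> : \sum_k (k == j)%:R * (\sum_(u <- dq i k) iterD s t (u ++ w)) =
    \sum_(u <- dq i j) iterD s t (u ++ w).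
  rewrite [LHS](bigD1 j) //= eqxx mul1r [X in _ + X]big1 ?addr0 // => k /negbTE ->.
  by rewrite mul0r.
rewrite addrAC; congr (_ - _ - _).
by apply: eq_bigr => q _; rewrite sum_splits_cons /= big_split.
Qed.

Lemma est_const_le N N' A : 0 <= A -> (N <= N')%N -> est_const d B N A <= est_const d B N' A.
Proof.
move=> A0 NN; rewrite /est_const ler_wpM2r ?exprn_ge0 // ler_nat.
by rewrite !leq_add ?leq_mul // leq_pexp2l.
Qed.

(** The box shrinks twice: to [e1] for the Lipschitz bound, which yields the growth rate [A1], then
    to [e2] for the Cauchy estimate, which needs [G2] above [2 * A1]. *)
Lemma smooth_step (N : nat) (rho eps A : R) : smooth_upto N eps A -> 0 <= rho ->
    (forall t w, box eps t -> `|x t w| <= rho ^+ size w) ->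
  exists eps' A', eps' <= eps /\ smooth_upto N.+1 eps' A'.
Proof.
move=> sm rho0 x_bd; have Age1 := sm_ge1 sm; have A0 := le_trans ler01 Age1.
have [eps0 eps1] := andP (sm_eps sm).
pose G1 := rho + 8 + 2 * A.
have rG1 : rho + 8 <= G1 by rewrite lerDl mulr_ge0.
have AG1 : 2 * A <= G1 by rewrite lerDr addr_ge0.
have G10 : 0 <= G1 by rewrite !addr_ge0 ?mulr_ge0.
have [e1 [/andP[e10 e1e] t1]] := exists_small G10 eps0.
pose c1 := 2 * (3 * est_const d B N A).
have c10 : 0 <= c1.
  apply: mulr_ge0; first exact: ler0n.
  by apply: mulr_ge0; [exact: ler0n | exact: le_trans ler01 (est_const_ge1 d B N Age1)].
pose A1 := c1 + G1.
have AA1 : A <= A1.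
  rewrite -[A]add0r lerD //; apply: le_trans AG1; by rewrite ler_peMl // ler1n.
have A1ge1 := le_trans Age1 AA1; have A10 := le_trans A0 AA1.
have lip a v t h j : (size a <= N)%N -> h != 0 -> box e1 t -> box e1 (t + h *: e j) ->
    `|quot h j a t v| <= A1 ^+ (size v).+1.
  move=> aN h0 bt bth.
  have := quot_lip sm rho0 x_bd v AG1 rG1 (t1 _ bt) aN h0 (box_le e1e bt) (box_le e1e bth).
  move=> /le_trans; apply; apply: le_trans (mul_exp_le _ c10 G10 (lexx _)).
  by rewrite ler_wpM2r ?exprn_ge0 // !ler_wpM2l // est_const_le.
pose G2 := rho + 8 + 2 * A1.
have rG2 : rho + 8 <= G2 by rewrite lerDl mulr_ge0.
have AG2 : 2 * A1 <= G2 by rewrite lerDr addr_ge0.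
have G20 : 0 <= G2 by rewrite !addr_ge0 ?mulr_ge0.
have [e2 [/andP[e20 e2e1] t2]] := exists_small G20 e10.
have e2e := le_trans e2e1 e1e.
pose c2 := 2 * est_const d B N A1.
have c20 : 0 <= c2.
  by apply: mulr_ge0; [exact: ler0n | exact: le_trans ler01 (est_const_ge1 d B N A1ge1)].
pose A2 := c2 + G2.
have A20 : 0 <= A2 by rewrite addr_ge0.
have cau a v t h h' j : (size a <= N)%N -> h != 0 -> h' != 0 -> box e2 t ->
    box e2 (t + h *: e j) -> box e2 (t + h' *: e j) ->
    `|quot h j a t v - quot h' j a t v| <= (`|h| + `|h'|) * A2 ^+ (size v).+1.
  move=> aN h0 h'0 bt bth bth'.
  apply: le_trans (@quot_cauchy N rho eps A sm rho0 x_bd A1 G2 a t h h' j v AA1 AG2 rG2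
    (t2 _ bt) aN h0 h'0 (box_le e2e bt) (box_le e2e bth) (box_le e2e bth') _ _) _.
  - by move=> b u bN; apply: lip => //; [exact: box_le bt | exact: box_le bth].
  - by move=> b u bN; apply: lip => //; [exact: box_le bt | exact: box_le bth'].
  rewrite mulrCA -mulrA ler_wpM2l ?addr_ge0 ?normr_ge0 //.
  apply: le_trans (mul_exp_le _ c20 G20 (lexx _)).
  by rewrite ler_wpM2r ?exprn_ge0 // ler_wpM2l // est_const_le.
have der a v t j : (size a <= N)%N -> box e2 t ->
    derivable (fun t' => iterD a t' v) t (e j) /\
    (forall h, h != 0 -> box e2 (t + h *: e j) ->
     `|quot h j a t v - iterD (j :: a) t v| <= `|h| * A2 ^+ (size v).+1).
  move=> aN bt; apply: quot_derivable => //; first by rewrite exprn_ge0.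
  by move=> h h' h0 h'0 bth bth'; exact: cau.
pose A' := A1 + A2.
have A1A' : A1 <= A' by rewrite lerDl.
have A2A' : A2 <= A' by rewrite lerDr.
have A'0 : 0 <= A' by exact: le_trans A1A'.
have A1l l : A1 ^+ l <= A' ^+ l by rewrite lerXn2r ?nnegrE.
have A2l l : A2 ^+ l <= A' ^+ l by rewrite lerXn2r ?nnegrE.
have Al l : A ^+ l <= A' ^+ l by rewrite lerXn2r ?nnegrE //; exact: le_trans A1A'.
exists e2, A'; split=> //; split.
- by rewrite e20; exact: le_trans eps1.
- exact: le_trans A1A'.
- move=> [|j s] t w sN bt; first exact: le_trans (sm_bd sm _ _ (box_le e2e bt)) _.
  have sN' : (size s <= N)%N by exact: sN.
  (* One admissible increment with [|h| <= 1] is enough: the new derivative is close to a quotient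
     that is already bounded. *)
  have [h [h0 bth h1]] : exists h, [/\ h != 0, box e2 (t + h *: e j) & `|h| <= 1].
    have : \forall h \near (0 : R)^', [/\ h != 0, box e2 (t + h *: e j) & `|h| <= 1].
      near=> h; split.
      - by near: h; exact: nbhs_dnbhs_neq.
      - by near: h; exact: box_shift_near.
      - by near: h; exact: dnbhs0_le.
    exact: filter_ex.
  have := (der s w t j sN' bt).2 h h0 bth.
  rewrite distrC => q.
  rewrite -[iterD (j :: s) t w](subrK (quot h j s t w)); apply: le_trans (ler_normD _ _) _.
  apply: le_trans (lerD q (lip _ _ _ _ _ sN' h0 (box_le e2e1 bt) (box_le e2e1 bth))) _.
  apply: (@le_trans _ _ (A2 ^+ (size w).+1 + A1 ^+ (size w).+1)).
    by rewrite lerD2r ler_piMl ?exprn_ge0.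
  rewrite !exprS {1}/A' (mulrDl A1 A2) [leLHS]addrC.
  by apply: lerD; apply: ler_wpM2l.
- move=> [|j s] t sN bt; first exact: (sm_nil sm _ (box_le e2e bt)).
  have near0 : \near t, iterD s t [::] = (nilp s)%:R.
    by apply: filterS (box_near bt) => t' bt'; apply: (sm_nil sm) => //; exact: box_le bt'.
  by rewrite [LHS]/= (near_eq_derive _ near0); exact: derive_cst.
- move=> [|j s] t sN bt; first exact: (sm_eq sm _ (box_le e2e bt)).
  apply: (sd_eq_cons (N := N) sN bt).
    by move=> t' bt'; apply: (sm_eq sm) => //; exact: box_le bt'.
  by move=> a v aN; exact: (der a v t j aN bt).1.
- by move=> s t w j sN bt; exact: (der s w t j sN bt).1.
- move=> s t w j h sN h0 bt bth; apply: le_trans ((der s w t j sN bt).2 h h0 bth) _.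
  by rewrite ler_wpM2l.
Unshelve. all: by end_near. Qed.

Lemma smooth_all (rho eps0 : R) : 0 < eps0 <= 1 -> 1 <= rho ->
    (forall t w, box eps0 t -> `|x t w| <= rho ^+ size w) ->
    (forall t, box eps0 t -> x t [::] = 1) -> (forall t, box eps0 t -> sd_eq [::] t) ->
  forall N, exists eps A, eps <= eps0 /\ smooth_upto N eps A.
Proof.
move=> e0 rho1 xb x1 xe; have rho0 := le_trans ler01 rho1.
elim=> [|N [eps [A [le sm]]]].
  exists eps0, rho; split=> //; split=> //.
  - move=> [|//] t w _ bt; apply: le_trans (xb t w bt) _.
    by rewrite exprS ler_peMl ?exprn_ge0.
  - by move=> [|//] t _ /x1.
  - by move=> [|//] t _ /xe.
have [eps' [A' [le' sm']]] := smooth_step sm rho0 (fun t w bt => xb t w (box_le le bt)).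
by exists eps', A'; split=> //; exact: le_trans le.
Qed.

End Smoothness.

(** * Linear forms on noncommutative polynomials *)

Section LinExt.
Variables (A : nzRingType) (K : choiceType) (V : lmodType A).
Implicit Types (F : K -> V) (P Q : {malg A[K]}).

Lemma lin_extEw F P (dom : {fset K}) : (msupp P `<=` dom)%fset ->
  lin_ext F P = \sum_(w <- dom) P@_w *: F w.
Proof.
move=> le; rewrite /lin_ext; apply/esym; rewrite (big_fset_incl _ le) //.
by move=> w _ wP; rewrite mcoeff_outdom // scale0r.
Qed.

Lemma lin_extU F w : lin_ext F << w >> = F w.
Proof. by rewrite /lin_ext msuppU oner_eq0 big_seq_fset1 mcoeffUU scale1r. Qed.

Lemma lin_extD F : {morph lin_ext F : P Q / P + Q}.
Proof.
move=> P Q; rewrite (lin_extEw _ (msuppD_le P Q)).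
rewrite (lin_extEw _ (fsubsetUl (msupp P) (msupp Q))).
rewrite (lin_extEw _ (fsubsetUr (msupp P) (msupp Q))) -big_split /=.
by apply: eq_bigr => w _; rewrite mcoeffD scalerDl.
Qed.

Lemma lin_extZ F c P : lin_ext F (c *: P) = c *: lin_ext F P.
Proof.
rewrite (lin_extEw _ (msuppZ_le c P)) scaler_sumr.
by apply: eq_bigr => w _; rewrite mcoeffZ scalerA.
Qed.

Lemma lin_ext0 F : lin_ext F 0 = 0.
Proof. by rewrite /lin_ext msupp0 big_seq_fset0. Qed.

Lemma lin_ext_sum F (T : Type) (s : seq T) (p : pred T) (G : T -> {malg A[K]}) :
  lin_ext F (\sum_(z <- s | p z) G z) = \sum_(z <- s | p z) lin_ext F (G z).
Proof. by apply: big_morph; [exact: lin_extD | exact: lin_ext0]. Qed.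

Lemma malg_sumE P : P = \sum_(w <- msupp P) P@_w *: << w >>.
Proof.
rewrite {1}[P]monalgE; apply: eq_bigr => w _; apply/malgP => k.
by rewrite mcoeffZ !mcoeffU mulrnAr mulr1.
Qed.

End LinExt.

Lemma sum_positions (V : nmodType) (T : eqType) (i : T) (w : seq T) (F : seq T -> seq T -> V) :
  \sum_(k < size w | tnth (in_tuple w) k == i) F (take k w) (drop k.+1 w) =
  \sum_(q <- cuts w | q.1.2 == i) F q.1.1 q.2.
Proof.
under eq_bigl do rewrite (tnth_nth i).
rewrite big_mkcond [RHS]big_mkcond /=.
elim: w F => [|x w IH] F; first by rewrite big_ord0 big_nil.
rewrite big_ord_recl [RHS]big_cons /= ?take0 ?drop0 big_map; congr (_ + _).
exact: (IH (fun u v => F (x :: u) v)).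
Qed.

(** * The Schwinger-Dyson equation on words *)

Section Words.
Variables (R : realType) (m : nat).
Implicit Types (i : 'I_m) (w u v : seq 'I_m) (P : ncpoly R m) (tau sigma : ncpoly R m -> R[i]).

Local Notation mon w := (<< FMonom w >> : ncpoly R m).

(** The words of the cyclic derivative, listed with multiplicity, all coefficients being 1. *)
Definition cyc_words i w : seq (seq 'I_m) :=
  [seq p.2 ++ p.1.1 | p <- [seq p <- cuts w | p.1.2 == i]].

Lemma malg1E : 1 = mon [::].
Proof. by rewrite -mpolyC1E; congr (<< _ >>); apply: fmoneE. Qed.

Lemma mulXX u v : mon u * mon v = mon (u ++ v).
Proof.
rewrite malgME !msuppU !oner_eq0 !big_seq_fset1 !mcoeffUU mulr1.
by congr (<< _ >>); apply: fmmulE.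
Qed.

Lemma ncXE i : ncX R i = mon [:: i].
Proof. by congr (<< _ >>); apply: fmuE. Qed.

Lemma ncstarU (w : word m) : ncstar (<< w >> : ncpoly R m) = << wrev w >>.
Proof. by rewrite /ncstar msuppU oner_eq0 big_seq_fset1 mcoeffUU conjC1. Qed.

Lemma tensor_formE tau sigma (Q : ncpoly2 R m) :
  tensor_form tau sigma Q = lin_ext (fun w : word m * word m => tau << w.1 >> * sigma << w.2 >> : R[i]^o) Q.
Proof. by []. Qed.

Lemma tensor_ncdiff tau sigma i P :
  tensor_form tau sigma (ncdiff i P) =
  \sum_(z <- msupp P) P@_z * \sum_(q <- cuts z | q.1.2 == i) tau (mon q.1.1) * sigma (mon q.2).
Proof.
rewrite tensor_formE /ncdiff [X in lin_ext _ X]/lin_ext lin_ext_sum; apply: eq_bigr => w _.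
rewrite lin_extZ; congr (_ * _); rewrite lin_ext_sum.
rewrite -(sum_positions i w (fun u v => tau (mon u) * sigma (mon v))).
by apply: eq_bigr => k _; rewrite lin_extU.
Qed.

Lemma cycdiff_wordM i (w : word m) v :
  cycdiff_word R i w * mon v = \sum_(u <- cyc_words i w) mon (u ++ v).
Proof.
rewrite /cycdiff_word mulr_suml big_map big_filter.
rewrite -(sum_positions i w (fun a b => mon ((b ++ a) ++ v))).
by apply: eq_bigr => k _; rewrite mulXX.
Qed.

Lemma cycdiffU i (w : word m) : cycdiff i (<< w >> : ncpoly R m) = cycdiff_word R i w.
Proof. by rewrite /cycdiff lin_extU. Qed.

Lemma cycdiff_potential n (q : 'I_n -> word m) (t : 'rV[R]_n) i :
  cycdiff i (potential q t) =
  \sum_j (t ord0 j)%:C%C *: (cycdiff_word R i (q j) + cycdiff_word R i (wrev (q j))).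
Proof.
rewrite /cycdiff /potential lin_ext_sum; apply: eq_bigr => j _.
by rewrite lin_extZ lin_extD ncstarU !lin_extU.
Qed.

Definition pot_words n (q : 'I_n -> word m) i j : seq (seq 'I_m) :=
  cyc_words i (q j) ++ cyc_words i (rev (q j)).

(** The term X_i P is isolated, with P a word: the equation then expresses a moment of a nonempty
    word, which is the form all the recursions start from. *)
Lemma schwinger_dyson_words n (q : 'I_n -> word m) (t : 'rV[R]_n) (tau : {scalar ncpoly R m}) i w :
    schwinger_dyson (potential q t) tau ->
  tau (mon (i :: w)) =
    \sum_(p <- cuts w | p.1.2 == i) tau (mon p.1.1) * tau (mon p.2)
    - \sum_j (t ord0 j)%:C%C * (\sum_(u <- pot_words q i j) tau (mon (u ++ w))).
Proof.
move=> [_ /(_ i (mon w))]; rewrite tensor_ncdiff msuppU oner_eq0 big_seq_fset1 mcoeffUU mul1r.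
move=> ->; rewrite mulrDl ncXE mulXX linearD /= cycdiff_potential mulr_suml linear_sum /=.
rewrite addrAC -[LHS]add0r; congr (_ + _); apply/esym/eqP; rewrite subr_eq0; apply/eqP.
apply: eq_bigr => j _; rewrite -scalerAl linearZ /= mulrDl !cycdiff_wordM.
by rewrite -big_cat linear_sum.
Qed.

End Words.

Lemma cyc_words_size m i (w u : seq 'I_m) : u \in cyc_words i w -> (size u <= size w)%N.
Proof.
case/mapP => p; rewrite mem_filter => /andP[_ /cutsP ->] ->.
by rewrite !size_cat /= addnC addnS leqW.
Qed.

Lemma cyc_words_count m i (w : seq 'I_m) : (size (cyc_words i w) <= size w)%N.
Proof. by rewrite size_map size_filter; apply: leq_trans (count_size _ _) _; rewrite size_cuts. Qed.

Section PotentialWords.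
Variables (m n : nat) (q : 'I_n -> word m).

(** A crude bound that controls the lengths of the words of the derived potential as well as,
    doubled, their number. *)
Definition pot_degree : nat := (\sum_j size (q j))%N.

Lemma size_le_pot_degree j : (size (q j) <= pot_degree)%N.
Proof. by rewrite /pot_degree (bigD1 j) //= leq_addr. Qed.

Lemma pot_words_size i j u : u \in pot_words q i j -> (size u <= pot_degree)%N.
Proof.
rewrite mem_cat => /orP[] /cyc_words_size; rewrite ?size_rev => /leq_trans; apply;
exact: size_le_pot_degree.
Qed.

Lemma pot_words_count i j : (size (pot_words q i j) <= pot_degree + pot_degree)%N.
Proof.
rewrite size_cat leq_add //; apply: leq_trans (cyc_words_count _ _) _; rewrite ?size_rev;
exact: size_le_pot_degree.
Qed.

End PotentialWords.

Section ComplexParts.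
Variable R : realType.
Implicit Types (z : R[i]) (a : R).

Lemma complex_parts_le z a : `|z| <= a%:C%C -> `|complex.Re z| <= a /\ `|complex.Im z| <= a.
Proof.
move=> za; split; rewrite -lecR; apply: le_trans za; first exact: normc_ge_Re.
rewrite normc_def lecR -sqrtr_sqr ler_sqrt ?lerDr ?sqr_ge0 //.
by rewrite addr_ge0 ?sqr_ge0.
Qed.

Lemma Re_sum (T : Type) (s : seq T) (P : pred T) (F : T -> R[i]) :
  complex.Re (\sum_(z <- s | P z) F z) = \sum_(z <- s | P z) complex.Re (F z).
Proof. by apply: (big_morph (@complex.Re R)) => // -[? ?] [? ?]. Qed.

Lemma Im_sum (T : Type) (s : seq T) (P : pred T) (F : T -> R[i]) :
  complex.Im (\sum_(z <- s | P z) F z) = \sum_(z <- s | P z) complex.Im (F z).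
Proof. by apply: (big_morph (@complex.Im R)) => // -[? ?] [? ?]. Qed.

Lemma ImB z z' : complex.Im (z - z') = complex.Im z - complex.Im z'.
Proof. by case: z z' => [? ?] [? ?]. Qed.

Lemma ImM z z' : complex.Im (z * z') =
  complex.Re z * complex.Im z' + complex.Im z * complex.Re z'.
Proof. by case: z z' => [? ?] [? ?]. Qed.

Lemma ReB z z' : complex.Re (z - z') = complex.Re z - complex.Re z'.
Proof. by case: z z' => [? ?] [? ?]. Qed.

Lemma Re_realM a z : complex.Re (a%:C%C * z) = a * complex.Re z.
Proof. by case: z => [? ?] /=; rewrite mul0r subr0. Qed.

Lemma Im_realM a z : complex.Im (a%:C%C * z) = a * complex.Im z.
Proof. by rewrite ImM /= mul0r addr0. Qed.

Lemma Im0_real z : complex.Im z = 0 -> z = (complex.Re z)%:C%C.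
Proof. by case: z => a b /= ->. Qed.

End ComplexParts.

(** * Moments of a solution near the origin *)

Section Solution.
Variables (R : realType) (m n : nat) (q : 'I_n -> word m).
Variables (U : set 'rV[R]_n) (r : R) (tau : 'rV[R]_n -> {scalar ncpoly R m}).
Hypothesis U0 : nbhs (0 : 'rV[R]_n) U.
Hypothesis tau_sd : forall t, U t -> schwinger_dyson (potential q t) (tau t).
Hypothesis tau_bound : forall t, U t ->
  forall w : word m, `|tau t << w >>| <= (r ^+ size w)%:C%C.

Local Notation mon w := (<< FMonom w >> : ncpoly R m).
Local Notation dq := (pot_words q).
Local Notation d := (pot_degree q).

Definition re_moment (t : 'rV[R]_n) (w : seq 'I_m) : R := complex.Re (tau t (mon w)).

Lemma exists_box : exists eps : R, 0 < eps <= 1 /\ forall t, box eps t -> U t.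
Proof.
move/nbhs_ballP: U0 => [eps /= eps0 epsU].
exists (Num.min eps 1); split; first by rewrite lt_min eps0 ltr01 ge_min lexx orbT.
move=> t bt; apply: epsU; split=> // i j; rewrite (ord1 i) /ball /= mxE sub0r normrN.
by apply: lt_le_trans (bt j) _; rewrite ge_min lexx.
Qed.

(** The estimates need a growth rate of at least 1, whatever the size and the sign of [r]. *)
Let rho : R := 1 + `|r|.

Lemma part_bound t w : U t ->
  `|complex.Re (tau t (mon w))| <= rho ^+ size w /\ `|complex.Im (tau t (mon w))| <= rho ^+ size w.
Proof.
move=> Ut; have [h1 h2] := complex_parts_le (tau_bound Ut (FMonom w)).
have le : r ^+ size w <= rho ^+ size w.
  apply: le_trans (ler_norm _) _; rewrite normrX lerXn2r ?nnegrE //.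
    by rewrite addr_ge0.
  by rewrite lerDr.
by split; [apply: le_trans h1 _ | apply: le_trans h2 _].
Qed.

(* The Schwinger-Dyson equation has real coefficients, so that the imaginary part of a
   solution solves a linear equation which has no nonzero solution for small t. *)
Lemma real_near : exists eps : R, 0 < eps <= 1 /\ forall t, box eps t ->
  U t /\ forall w, tau t (mon w) = (re_moment t w)%:C%C.
Proof.
have [e0 [/andP[e00 e01] e0U]] := exists_box.
have rho1 : 1 <= rho by rewrite lerDl.
have rho0 : 0 <= rho by exact: le_trans rho1.
pose G := rho + 8.
have G1 : 1 <= G by rewrite (le_trans rho1) // lerDl.
have G0 : 0 <= G by exact: le_trans G1.
have [eps [/andP[eps0 epse] small]] := exists_small n d (d + d)%N G0 e00.
exists eps; split; first by rewrite eps0 (le_trans epse).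
move=> t bt; have Ut : U t by apply: e0U; exact: box_le bt.
split=> // w; apply: Im0_real; apply/normr0_eq0/eqP; rewrite eq_le normr_ge0 andbT.
have [tau1 _] := tau_sd Ut.
pose y v := complex.Im (tau t (mon v)).
(* Each product of moments has imaginary part Re z Im z' + Im z Re z', linear in [y] with
   coefficients bounded by powers of [rho]; there is no source term. *)
have ys : subsolution dq rho 0 G t y.
  move=> i v; rewrite mul0r addr0 /y (schwinger_dyson_words _ _ (tau_sd Ut)) ImB.
  apply: le_trans (ler_normB _ _) _; apply: lerD.
    rewrite Im_sum; apply: ler_norm_seq => p _ _; rewrite ImM.
    apply: le_trans (ler_normD _ _) _; rewrite addrC; apply: lerD; rewrite normrM.
      by rewrite ler_wpM2l //; have [] := part_bound p.2 Ut.
    by rewrite ler_wpM2r //; have [] := part_bound p.1.1 Ut.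
  rewrite Im_sum; apply: le_trans (norm_drift_le dq t i v y).
  by rewrite le_eqVlt; apply/orP; left; apply/eqP; congr (`|_|); apply: eq_bigr => j _;
     rewrite Im_realM Im_sum.
have y0 : `|y [::]| <= 0 by rewrite /y -malg1E tau1 /= normr0.
have yK v : `|y v| <= 1 * G ^+ size v.
  rewrite mul1r; have [_ /le_trans] := part_bound v Ut; apply.
  by rewrite lerXn2r ?nnegrE // lerDl.
have := subsolution_le (@pot_words_size _ _ q) (@pot_words_count _ _ q) rho0 G1 (lexx _)
  (small _ bt) y0 ys yK w.
by rewrite mulr0 mul0r.
Qed.

Lemma moments_smooth : exists eps0 : R, 0 < eps0 <= 1 /\
  (forall t, box eps0 t -> U t /\ forall w, tau t (mon w) = (re_moment t w)%:C%C) /\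
  forall N, exists eps A, eps <= eps0 /\ smooth_upto dq re_moment N eps A.
Proof.
have [eps0 [e0 real]] := real_near; exists eps0; split=> //; split=> //.
apply: (smooth_all (@pot_words_size _ _ q) (@pot_words_count _ _ q) (rho := rho)) => //.
- by rewrite lerDl.
- by move=> t w /real[Ut _]; have [] := part_bound w Ut.
- move=> t /real[Ut _]; have [tau1 _] := tau_sd Ut.
  by rewrite /re_moment -malg1E tau1.
move=> t /real[Ut rt] i w; rewrite big_nil subr0 /=.
under eq_bigr do rewrite big_seq1 /=.
rewrite /re_moment (schwinger_dyson_words _ _ (tau_sd Ut)).
rewrite ReB; congr (_ - _).
  by rewrite Re_sum; apply: eq_bigr => p _; rewrite rt Re_realM.
by rewrite Re_sum; apply: eq_bigr => j _; rewrite Re_realM Re_sum.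
Qed.

End Solution.

(** * From sequences of directions to multi-indices *)

Section MultiIndexSums.
Variables (J : eqType) (V : nmodType).
Implicit Types (s : seq J) (k c : J -> nat) (js : seq J).

Definition dirs js k : seq J := flatten [seq nseq (k j) j | j <- js].

Lemma dirs_cons j js k : dirs (j :: js) k = nseq (k j) j ++ dirs js k.
Proof. by []. Qed.

Lemma eq_in_dirs js k k' : {in js, k =1 k'} -> dirs js k = dirs js k'.
Proof. by move=> kk'; congr flatten; apply/eq_in_map => j /kk' ->. Qed.

Lemma size_dirs js k : size (dirs js k) = (\sum_(j <- js) k j)%N.
Proof.
by rewrite size_flatten /shape -map_comp sumnE big_map; apply: eq_bigr => j _; rewrite /= size_nseq.
Qed.

Lemma mem_dirs js k j : j \in dirs js k -> j \in js.
Proof. by case/flatten_mapP => i ijs /nseqP[-> _]. Qed.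

Lemma count_dirs js k j : uniq js -> j \in js -> count_mem j (dirs js k) = k j.
Proof.
elim: js => //= i js IH /andP[ijs un]; rewrite inE dirs_cons count_cat count_nseq /=.
have [->|ji] := eqVneq j i; last by move=> jjs; rewrite mul0n add0n IH.
move=> _; rewrite mul1n; apply/eqP; rewrite -[X in _ == X]addn0 eqn_add2l.
by apply/eqP/count_memPn; apply: contra ijs => /mem_dirs.
Qed.

(** Pascal's rule: the first copy of [j] goes either to the left part or to the right one. *)
Lemma sum_splits_nseq b (j : J) s (F : seq J * seq J -> V) :
  \sum_(p <- splits (nseq b j ++ s)) F p =
  \sum_(a < b.+1) (\sum_(p <- splits s) F (nseq a j ++ p.1, nseq (b - a) j ++ p.2))
     *+ 'C(b, a).
Proof.
elim: b F => [|b IH] F.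
  by rewrite big_ord1 bin0 mulr1n /=; apply: eq_bigr => -[].
rewrite [nseq _ _ ++ _]/= sum_splits_cons (IH (fun p => F (j :: p.1, p.2))).
rewrite (IH (fun p => F (p.1, j :: p.2))) [RHS]big_ord_recl bin0 mulr1n subn0.
under [X in _ = _ + X]eq_bigr => a _ do rewrite lift0 binS mulrnDr subSS.
rewrite big_split /= [X in _ = _ + X]addrC [RHS]addrCA; congr (_ + _).
rewrite big_ord_recl bin0 mulr1n subn0 big_ord_recr /= bin_small // mulr0n addr0.
congr (_ + _); apply: eq_bigr => a _; rewrite /bump /= add1n; congr (_ *+ _).
by apply: eq_bigr => p _; rewrite -[j :: nseq (b - a.+1) j ++ p.2]/(nseq (b - a.+1).+1 j ++ p.2) subnSK.
Qed.

Lemma splits_count s p (j : J) : p \in splits s ->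
  (count_mem j p.1 + count_mem j p.2)%N = count_mem j s.
Proof.
elim: s p => [|x s IH] p /=; first by rewrite inE => /eqP->.
by rewrite mem_cat => /orP[] /mapP[q /IH<- ->] /=; [rewrite addnA | rewrite addnCA].
Qed.

Lemma splits_cat s1 s2 p : p \in splits (s1 ++ s2) ->
  exists p1 p2, [/\ p1 \in splits s1, p2 \in splits s2 & p = (p1.1 ++ p2.1, p1.2 ++ p2.2)].
Proof.
elim: s1 p => [|x s1 IH] p /=.
  by move=> ps; exists ([::], [::]), p; split; rewrite ?inE //; case: p ps.
rewrite mem_cat => /orP[] /mapP[q /IH[p1 [p2 [m1 m2 ->]]] ->].
  exists (x :: p1.1, p1.2), p2; split=> //; rewrite mem_cat; apply/orP; left.
  by apply/mapP; exists p1.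
exists (p1.1, x :: p1.2), p2; split=> //; rewrite mem_cat; apply/orP; right.
by apply/mapP; exists p1.
Qed.

Lemma splits_nseq b (j : J) p : p \in splits (nseq b j) ->
  p = (nseq (count_mem j p.1) j, nseq (count_mem j p.2) j).
Proof.
elim: b p => [|b IH] p /=; first by rewrite inE => /eqP->.
by rewrite mem_cat => /orP[] /mapP[[a1 a2] /IH /= [e1 e2] ->] /=;
  rewrite eqxx add1n /= -e1 -e2.
Qed.

(** In a sequence grouped by letters a subsequence is determined by its letter counts. *)
Lemma splits_dirs js k p : uniq js -> p \in splits (dirs js k) ->
  p = (dirs js (fun i => count_mem i p.1), dirs js (fun i => count_mem i p.2)).
Proof.
elim: js p => [|j js IH] p; first by rewrite inE => _ /eqP->.
rewrite cons_uniq => /andP[jjs un]; rewrite [dirs _ _]dirs_cons.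
case/splits_cat => p1 [p2 [m1 m2 ->]] /=; rewrite !dirs_cons.
have n2 : count_mem j p2.1 = 0%N /\ count_mem j p2.2 = 0%N.
  have /eqP := splits_count j m2.
  have /count_memPn-> : j \notin dirs js k by apply: contra jjs; exact: mem_dirs.
  by rewrite addn_eq0 => /andP[/eqP-> /eqP->].
have n1 i : i \in js -> count_mem i p1.1 = 0%N /\ count_mem i p1.2 = 0%N.
  move=> ijs; have /eqP := splits_count i m1.
  have -> : count_mem i (nseq (k j) j) = 0%N.
    rewrite count_nseq /=; case: eqP => // ji; by rewrite ji ijs in jjs.
  by rewrite addn_eq0 => /andP[/eqP-> /eqP->].
have E1 := splits_nseq m1; have E2 := IH _ un m2.
congr (_, _); rewrite count_cat.
  rewrite n2.1 addn0; congr (_ ++ _); first by rewrite {1}E1.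
  rewrite {1}E2 /=; apply: eq_in_dirs => i ijs; by rewrite count_cat (n1 i ijs).1.
rewrite n2.2 addn0; congr (_ ++ _); first by rewrite {1}E1.
rewrite {1}E2 /=; apply: eq_in_dirs => i ijs; by rewrite count_cat (n1 i ijs).2.
Qed.

Lemma sum_picks_nseq b (j : J) s (F : J * seq J -> V) :
  \sum_(p <- picks (nseq b j ++ s)) F p =
  F (j, nseq b.-1 j ++ s) *+ b + \sum_(p <- picks s) F (p.1, nseq b j ++ p.2).
Proof.
elim: b F => [|b IH] F; first by rewrite mulr0n add0r; apply: eq_bigr => -[].
rewrite [nseq _ _ ++ _]/= sum_picks_cons (IH (fun p => F (p.1, j :: p.2))) /= mulrS addrA.
congr (_ + _ + _); by case: b {IH}.
Qed.

Lemma sum_picks_dirs js k (F : J * seq J -> V) : uniq js ->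
  \sum_(p <- picks (dirs js k)) F p =
  \sum_(j <- js) F (j, dirs js (fun i => k i - (i == j))%N) *+ k j.
Proof.
elim: js F => [|j js IH] F; first by rewrite !big_nil.
rewrite cons_uniq => /andP[jjs un]; rewrite dirs_cons sum_picks_nseq big_cons.
congr (_ + _).
  congr (F (_, _) *+ _); rewrite dirs_cons eqxx subn1; congr (_ ++ _).
  apply: eq_in_dirs => i ijs; case: eqP => [ij|]; last by rewrite subn0.
  by rewrite -ij ijs in jjs.
rewrite (IH (fun p => F (p.1, nseq (k j) j ++ p.2)) un); apply: eq_big_seq => i ijs /=.
congr (F (_, _) *+ _); rewrite dirs_cons; case: eqP => [ji|]; last by rewrite subn0.
by rewrite ji ijs in jjs.
Qed.

End MultiIndexSums.

Lemma count_splits_dirs (J : eqType) (js : seq J) (k c : J -> nat) : uniq js ->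
  count (fun p => all (fun j => count_mem j p.1 == c j) js) (splits (dirs js k)) =
  (\prod_(j <- js) 'C(k j, c j))%N.
Proof.
have countE (T : Type) (a : pred T) (r : seq T) : count a r = (\sum_(z <- r) (a z : nat))%N.
  by rewrite -sum1_count big_mkcond; apply: eq_bigr => z _; case: (a z).
elim: js => [|j js IH]; first by rewrite big_nil.
rewrite cons_uniq => /andP[jjs un]; rewrite countE dirs_cons big_cons -IH // countE.
rewrite (sum_splits_nseq (V := nat)).
have E (a : 'I_(k j).+1) :
   (\sum_(p <- splits (dirs js k))
     all (fun i => count_mem i (nseq a j ++ p.1) == c i) (j :: js) =
    (a == c j :> nat) * \sum_(p <- splits (dirs js k)) all (fun i => count_mem i p.1 == c i) js)%N.
  rewrite big_distrr /=; apply: eq_big_seq => p ps.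
  have n1 : count_mem j p.1 = 0%N.
    have /eqP := splits_count j ps.
    have /count_memPn-> : j \notin dirs js k by apply: contra jjs; exact: mem_dirs.
    by rewrite addn_eq0 => /andP[/eqP->].
  rewrite count_cat count_nseq /= eqxx mul1n n1 addn0 mulnb; congr (nat_of_bool (_ && _)).
  apply: eq_in_all => i ijs; rewrite count_cat count_nseq /=.
  by have /negbTE-> : j != i by apply: contraNneq jjs => ->.
rewrite (eq_bigr (fun a : 'I_(k j).+1 => ((a == c j :> nat) *
  \sum_(p <- splits (dirs js k)) all (fun i => count_mem i p.1 == c i) js)%N *+ 'C(k j, a)));
  last by move=> a _; congr (_ *+ _); exact: E.
have [le|gt] := leqP (c j) (k j); last first.
  rewrite bin_small // mul0n big1 // => a _; case: eqP => [e|]; last by rewrite mul0n mul0rn.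
  by move: gt; rewrite -e ltnNge -ltnS ltn_ord.
have lt : (c j < (k j).+1)%N by [].
rewrite (bigD1 (Ordinal lt)) //= eqxx mul1n [X in _ + X]big1 ?addr0 => [|a ac].
  by rewrite -mulr_natl natn.
case: eqP => [e|]; last by rewrite mul0n mul0rn.
by move: ac; rewrite -val_eqE /= e eqxx.
Qed.

(** Choosing one of two types for each star amounts to splitting the sequence; sorting the chosen
    stars by type is what requires invariance under permutations. *)
Lemma sum_decorations_splits (V : nmodType) (J : Type) (I : eqType) (a b : J -> seq I) s
    (F : seq (seq I) -> V) : (forall D D', perm_eq D D' -> F D = F D') ->
  \sum_(D <- decorations (fun j => [:: a j; b j]) s) F D =
  \sum_(p <- splits s) F (map a p.1 ++ map b p.2).
Proof.
elim: s F => [|j s IH] F pF; first by rewrite !big_seq1.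
rewrite sum_decorations_cons big_cons big_seq1 sum_splits_cons.
rewrite (IH (fun D => F (a j :: D))); last by move=> D D' pe; apply: pF; rewrite perm_cons.
rewrite (IH (fun D => F (b j :: D))); last by move=> D D' pe; apply: pF; rewrite perm_cons.
congr (_ + _); apply: eq_bigr => p _; apply: pF.
by rewrite /= -cat1s perm_catCA.
Qed.

Section MultiIndices.
Variable n : nat.
Implicit Types k c : 'I_n -> nat.

Lemma mi_dirsE k : mi_dirs k = dirs (enum 'I_n) k.
Proof. by []. Qed.

Lemma eq_mi_dirs k c : k =1 c -> mi_dirs k = mi_dirs c.
Proof. by move=> kc; apply: eq_in_dirs => j _. Qed.

Lemma size_mi_dirs k : size (mi_dirs k) = mi_deg k.
Proof. by rewrite mi_dirsE size_dirs /mi_deg big_enum. Qed.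

(** Splittings are grouped by the multi-index of their first part; [count_splits_dirs] gives the
    size of each group, a product of binomials. The value of [inord] is never the default one, as
    letter counts are at most [mi_deg k]. *)
Lemma sum_splits_mi (V : nmodType) k (F : seq 'I_n * seq 'I_n -> V) :
  \sum_(p <- splits (mi_dirs k)) F p =
  \sum_(c in mi_le k) F (mi_dirs (fun j => c j), mi_dirs (mi_sub k (fun j => c j)))
     *+ mi_bin k (fun j => c j).
Proof.
have un := enum_uniq 'I_n.
have le_deg j : (k j <= mi_deg k)%N by rewrite /mi_deg (bigD1 j) //= leq_addr.
pose h (p : seq 'I_n * seq 'I_n) : {ffun 'I_n -> 'I_(mi_deg k).+1} :=
  [ffun j => inord (count_mem j p.1)].
have cnt p j : p \in splits (mi_dirs k) ->
    (count_mem j p.1 + count_mem j p.2)%N = k j.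
  by move=> /(splits_count j) ->; rewrite mi_dirsE count_dirs // mem_enum.
have hE p j : p \in splits (mi_dirs k) -> h p j = count_mem j p.1 :> nat.
  move=> /(cnt _ j) e; rewrite ffunE inordK // ltnS; apply: leq_trans (le_deg j).
  by rewrite -e leq_addr.
rewrite big_seq (partition_big h (mem (mi_le k))) /=; last first.
  by move=> p ps; rewrite inE; apply/forallP => j; rewrite hE // -(cnt p j ps) leq_addr.
apply: eq_bigr => c; rewrite inE => /forallP ck.
transitivity (\sum_(p <- splits (mi_dirs k) |
    all (fun j => count_mem j p.1 == c j) (enum 'I_n))
    F (mi_dirs (fun j => c j), mi_dirs (mi_sub k (fun j => c j)))).
  rewrite big_seq_cond [RHS]big_seq_cond /=.
  have E p : p \in splits (mi_dirs k) ->
     (h p == c) = all (fun j => count_mem j p.1 == c j) (enum 'I_n).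
    move=> ps; apply/eqP/allP => [<- j _|e]; first by rewrite hE.
    apply/ffunP => j; apply: val_inj; rewrite /= hE //; apply/eqP/e.
    by rewrite mem_enum.
  apply: congr_big => // p; first by case: (boolP (p \in _)) => //= ps; exact: E.
  move=> /andP[ps] /andP[_ hpc]; have ps' := ps; rewrite mi_dirsE in ps'.
  rewrite (splits_dirs un ps') -!mi_dirsE; congr (F (_, _)); apply: eq_mi_dirs => j.
    by rewrite -hE // (eqP hpc).
  by rewrite /mi_sub -(eqP hpc) hE // -(cnt _ j ps) addKn.
rewrite big_const_seq iter_addr_0 mi_dirsE (count_splits_dirs _ (fun j => c j : nat) un).
by rewrite big_enum.
Qed.

Lemma sum_picks_mi (V : nmodType) k (F : 'I_n * seq 'I_n -> V) :
  \sum_(p <- picks (mi_dirs k)) F p =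
  \sum_j F (j, mi_dirs (mi_sub k (mi_unit j))) *+ k j.
Proof. by rewrite mi_dirsE sum_picks_dirs ?enum_uniq // big_enum. Qed.

Lemma perm_stars m (a b : 'I_n -> word m) (k c : 'I_n -> nat) :
  perm_eq (stars (flatten [seq [:: (a j, k j); (b j, c j)] | j <- enum 'I_n]))
    (map a (mi_dirs k) ++ map b (mi_dirs c)).
Proof.
rewrite !mi_dirsE; elim: (enum 'I_n) => // j js IH.
rewrite !dirs_cons /stars /= -/(stars _) !map_cat !map_nseq -!catA perm_cat2l.
rewrite perm_sym perm_catCA perm_cat2l perm_sym; exact: IH.
Qed.

Lemma sum_mi_dirs k (f : 'I_n -> nat) : (\sum_(j <- mi_dirs k) f j = \sum_j k j * f j)%N.
Proof.
rewrite mi_dirsE big_flatten big_map big_enum /=; apply: eq_bigr => j _.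
by rewrite big_nseq iter_addn_0 mulnC.
Qed.

(** The binomials in [M] count the choices of stars of type [q j]; undoing this grouping leaves one
    free choice for each star. *)
Lemma M_tutte m (P : word m) (q : 'I_n -> word m) k N :
    (size P + (\sum_(j <- mi_dirs k) size (q j)) + 1 < N)%N ->
  M P q k = (\sum_(D <- decorations (fun j => [:: fmonom_val (q j); rev (q j)]) (mi_dirs k))
     tutte N [:: fmonom_val P] D)%N.
Proof.
move=> le.
rewrite (@sum_decorations_splits nat _ _ (fun j => fmonom_val (q j)) (fun j => rev (q j))
  _ (tutte N [:: fmonom_val P])); last by move=> D D' pe; apply: tutte_perm.
rewrite sum_splits_mi /M; apply: eq_bigr => c ck /=.
rewrite -[RHS]mulr_natl natn; congr (_ * _)%N.
have -> : M0 ((P, 1%N) :: flatten [seq [:: (q j, val (c j)); (wrev (q j), (k j - c j)%N)]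
                                     | j <- enum 'I_n]) =
    planar_maps (P :: stars (flatten [seq [:: (q j, val (c j)); (wrev (q j), (k j - c j)%N)]
                                     | j <- enum 'I_n])) by [].
have pe := perm_stars q (fun j => wrev (q j)) (fun j => c j) (fun j => (k j - c j)%N).
set S := stars _ in pe *.
have pe' : perm_eq [seq fmonom_val w | w <- S]
    (map (fun j => fmonom_val (q j)) (mi_dirs (fun j => c j)) ++
     map (fun j => rev (q j)) (mi_dirs (mi_sub k (fun j => c j)))).
  by rewrite (perm_trans (perm_map (@fmonom_val _) pe)) // map_cat -!map_comp.
rewrite (@planar_maps_tutte _ _ _ N); first exact: tutte_perm.
have -> : size (flatten [seq fmonom_val w | w <- S]) = (\sum_(j <- mi_dirs k) size (q j))%N.
  rewrite (perm_size (perm_flatten pe')) flatten_cat size_cat !size_flatten /shape -!map_comp.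
  rewrite !sumnE !big_map /= [X in (_ + X)%N](eq_bigr (fun j => size (q j))); last first.
    by move=> j _; rewrite size_rev.
  rewrite !sum_mi_dirs -big_split /=; apply: eq_bigr => j _.
  by rewrite -mulnDl /mi_sub subnKC //; move: ck; rewrite inE => /forallP.
exact: le.
Qed.

End MultiIndices.

Lemma sum_pot_words (V : nmodType) m n (q : 'I_n -> word m) i j (F : seq 'I_m -> V) :
  \sum_(u <- pot_words q i j) F u =
  \sum_(y <- [:: fmonom_val (q j); rev (q j)])
     \sum_(p <- cuts y | p.1.2 == i) F (p.2 ++ p.1.1).
Proof. by rewrite big_cat big_cons big_seq1 !big_map !big_filter. Qed.

(** * Taylor coefficients at the origin *)

Section Assembly.
Variables (R : realType) (m n : nat) (q : 'I_n -> word m).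
Variables (tau : 'rV[R]_n -> {scalar ncpoly R m}) (eps0 : R).
Local Notation mon w := (<< FMonom w >> : ncpoly R m).
Local Notation dq := (pot_words q).
Local Notation x := (re_moment tau).
Local Notation e j := (delta_mx ord0 j : 'rV[R]_n).
Hypothesis tau_real : forall t, box eps0 t -> forall w, tau t (mon w) = (x t w)%:C%C.
Hypothesis x_smooth : forall N, exists eps A, eps <= eps0 /\ smooth_upto dq x N eps A.

Lemma scalar_malgE (f : {scalar ncpoly R m}) P :
  f P = \sum_(w <- msupp P) P@_w * f << w >>.
Proof.
by rewrite {1}[P]malg_sumE linear_sum; apply: eq_bigr => w _; rewrite linearZ.
Qed.

Lemma Re_mul_real (z : R[i]) (a : R) : complex.Re (z * a%:C%C) = complex.Re z * a.
Proof. by rewrite mulrC Re_realM mulrC. Qed.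

Lemma Im_mul_real (z : R[i]) (a : R) : complex.Im (z * a%:C%C) = complex.Im z * a.
Proof. by rewrite mulrC Im_realM mulrC. Qed.

(** Value and existence are proved together: differentiating once more at [t] uses both at the
    previous order on a neighborhood of [t]. As the moments are real, taking real or imaginary parts
    only affects the coefficients of [P]. *)
Lemma pderivs_moments N (eps A : R) P s t : eps <= eps0 -> smooth_upto dq x N eps A ->
    (size s <= N)%N -> box eps t ->
  pderivs s (fun t' => tau t' P) t = \sum_(w <- msupp P) P@_w * (iterD x s t w)%:C%C /\
  pderivs_exist s (fun t' => tau t' P) t.
Proof.
move=> le sm; elim: s t => [|j s IH] t sN bt.
  split=> //; rewrite /= scalar_malgE; apply: eq_bigr => w _; congr (_ * _).
  by rewrite -(tau_real (box_le le bt)) fmK.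
have near_s : \forall t' \near t, pderivs s (fun t' => tau t' P) t' =
      \sum_(w <- msupp P) P@_w * (iterD x s t' w)%:C%C /\
    pderivs_exist s (fun t' => tau t' P) t'.
  by apply: filterS (box_near bt) => t' bt'; apply: IH => //; exact: ltnW.
have D (w : word m) : is_derive t (e j) (fun t' => iterD x s t' w) (iterD x (j :: s) t w).
  by apply: derivableP; apply: (sm_der sm).
have DC (c : word m -> R) : is_derive t (e j)
    (fun t' => \sum_(w <- msupp P) c w * iterD x s t' w)
    (\sum_(w <- msupp P) c w * iterD x (j :: s) t w).
  apply: is_derive_seq => w _ _.
have DRe : is_derive t (e j) (fun t' => complex.Re (pderivs s (fun t' => tau t' P) t'))
    (\sum_(w <- msupp P) complex.Re P@_w * iterD x (j :: s) t w).
  apply: near_eq_is_derive (DC (fun w => complex.Re P@_w)).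
  apply: filterS near_s => t' [-> _]; rewrite Re_sum.
  by apply: eq_bigr => w _; rewrite Re_mul_real.
have DIm : is_derive t (e j) (fun t' => complex.Im (pderivs s (fun t' => tau t' P) t'))
    (\sum_(w <- msupp P) complex.Im P@_w * iterD x (j :: s) t w).
  apply: near_eq_is_derive (DC (fun w => complex.Im P@_w)).
  apply: filterS near_s => t' [-> _]; rewrite Im_sum.
  by apply: eq_bigr => w _; rewrite Im_mul_real.
split; last first.
  split; first by apply: filterS near_s => t' [].
  by split; [exact: (@ex_derive _ _ _ _ _ _ _ DRe) | exact: (@ex_derive _ _ _ _ _ _ _ DIm)].
rewrite [LHS]/= /pderiv.
rewrite (derive_val (is_derive := DRe)) (derive_val (is_derive := DIm)).
apply/eqP; rewrite eq_complex /= Re_sum Im_sum; apply/andP; split; apply/eqP; apply: eq_bigr => w _.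
  by rewrite Re_mul_real.
by rewrite Im_mul_real.
Qed.

(* tau^k for the sequence of directions s; see tau_mi_taylor. *)
Definition taylor s (w : seq 'I_m) : R[i] := ((-1) ^+ size s * iterD x s 0 w)%:C%C.

Lemma box0 (eps : R) : 0 < eps -> box eps (0 : 'rV[R]_n).
Proof. by move=> e0 j; rewrite mxE normr0. Qed.

Lemma tau_mi_taylor k P :
  tau_mi tau k P = lin_ext (fun w : word m => taylor (mi_dirs k) w : R[i]^o) P.
Proof.
have [eps [A [le sm]]] := x_smooth (mi_deg k).
have [e0 _] := andP (sm_eps sm).
rewrite /tau_mi (pderivs_moments _ le sm _ (box0 e0)).1 ?size_mi_dirs //.
rewrite mulr_sumr; apply: eq_bigr => w _.
transitivity (P@_w * taylor (mi_dirs k) w); last by [].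
by rewrite /taylor size_mi_dirs mulrCA rmorphM rmorphXn rmorphN rmorph1.
Qed.

Lemma taylor_nil s : taylor s [::] = (nilp s)%:R.
Proof.
have [eps [A [le sm]]] := x_smooth (size s).
have [e0 _] := andP (sm_eps sm).
rewrite /taylor (sm_nil sm (leqnn _) (box0 e0)).
by case: nilP => [->|_]; rewrite ?expr0 ?mul1r ?mulr0.
Qed.

(** At the origin the terms with a factor t_j vanish. The sign is multiplicative over splittings,
    and removing a picked direction leaves one factor -1, which cancels the minus sign of that
    sum. *)
Lemma taylor_cons s i w : taylor s (i :: w) =
  \sum_(p <- cuts w | p.1.2 == i) \sum_(ab <- splits s) taylor ab.1 p.1.1 * taylor ab.2 p.2 +
  \sum_(p <- picks s) \sum_(u <- dq i p.1) taylor p.2 (u ++ w).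
Proof.
have [eps [A [le sm]]] := x_smooth (size s).
have [e0 _] := andP (sm_eps sm).
rewrite {1}/taylor (sm_eq sm (leqnn _) (box0 e0)).
rewrite [X in _ - X - _]big1 ?subr0 => [|j _]; last by rewrite mxE mul0r.
rewrite mulrBr rmorphB /= !mulr_sumr !rmorph_sum /= -sumrN; congr (_ + _).
  apply: eq_bigr => p _; rewrite mulr_sumr rmorph_sum; apply: eq_big_seq => ab abs.
  have [sz _ _] := splitsP abs; rewrite -sz exprD /taylor -rmorphM /=; congr (_%:C%C); ring.
apply: eq_big_seq => p ps; rewrite mulr_sumr rmorph_sum -sumrN; apply: eq_bigr => u _.
rewrite -(picks_size ps) /taylor -rmorphN exprS; congr (_%:C%C); ring.
Qed.

(** The coefficients satisfy the recursion assumed by [sum_tutte]; with the single root [P] the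
    product of moments is just one of them. *)
Lemma taylor_M k (P : word m) : taylor (mi_dirs k) P = (M P q k)%:R.
Proof.
pose N := (size P + (\sum_(j <- mi_dirs k) size (q j)) + 1).+1.
rewrite (M_tutte (N := N)) // natr_sum -(multiT1 taylor).
rewrite (sum_tutte (wt := fun j => size (q j)) (T := taylor)) //.
- by move=> j y; rewrite !inE => /orP[] /eqP->; rewrite ?size_rev.
- exact: taylor_nil.
- move=> s i w; rewrite taylor_cons; congr (_ + _); apply: eq_bigr => p _.
  rewrite sum_pot_words; apply: eq_bigr => y _; apply: eq_bigr => c _.
  by rewrite catA.
by rewrite /= cats0 /N.
Qed.

End Assembly.

Lemma malg_scalerAr (K : monomType) (A : comNzRingType) (c : A) (P Q : {malg A[K]}) :
  P * (c *: Q) = c *: (P * Q).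
Proof.
apply/malgP => k; rewrite mcoeffZ [in RHS]mcoeffMl (mcoeffMlw _ (fsubset_refl _) (msuppZ_le c Q)).
rewrite mulr_sumr; apply: eq_bigr => u _; rewrite mulr_sumr; apply: eq_bigr => v _.
by rewrite mcoeffZ mulrCA mulrnAr.
Qed.

Theorem theorem2p2 (R : realType) (m n : nat) (hm : (1 <= m)%N) (hn : (1 <= n)%N)
    (q : 'I_n -> word m)
    (U : set 'rV[R]_n) (Uconvex : convex_set U) (U0 : nbhs (0 : 'rV[R]_n) U)
    (r : R) (tau : 'rV[R]_n -> {scalar ncpoly R m})
    (tau_sa : forall t, U t -> selfadjoint_form (tau t))
    (tau_sd : forall t, U t -> schwinger_dyson (potential q t) (tau t))
    (tau_bound : forall t, U t ->
       forall w : word m, `|tau t << w >>| <= (r ^+ size w)%:C%C) :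
  [/\ forall P : ncpoly R m,
        exists eps : nat -> R, (forall N, 0 < eps N) /\
          forall (k : 'I_n -> nat) (t : 'rV[R]_n),
            U t -> (forall i, `|t ord0 i| <= eps (mi_deg k)) ->
            pderivs_exist (mi_dirs k) (fun s => tau s P) t,
      forall (k : 'I_n -> nat) (P : ncpoly R m) (i : 'I_m),
        tau_mi tau k (ncX R i * P) =
          \sum_(p in mi_le k) (mi_bin k (fun j => p j))%:R *
             tensor_form (tau_mi tau (fun j => p j))
                         (tau_mi tau (mi_sub k (fun j => p j)))
                         (ncdiff i P)
          + \sum_(j < n) (k j)%:R *
             tau_mi tau (mi_sub k (mi_unit j))
               ((cycdiff i << q j >> + cycdiff i (ncstar << q j >>)) * P),
      forall k : 'I_n -> nat,
        tau_mi tau k 1 = (if [forall j, k j == 0%N] then 1 else 0)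
    & forall (P : word m) (k : 'I_n -> nat),
        tau_mi tau k << P >> = (M P q k)%:R].

Proof.
have [eps0 [_ [real smooth]]] := moments_smooth U0 tau_sd tau_bound.
have tau_real t : box eps0 t -> forall w, tau t << FMonom w >> = (re_moment tau t w)%:C%C.
  by move=> /real[].
have taylorE := tau_mi_taylor tau_real smooth.
have basisE k (w : seq 'I_m) : tau_mi tau k << FMonom w >> = taylor tau (mi_dirs k) w.
  by rewrite taylorE lin_extU.
split.
- move=> P; have [eps Heps] := choice smooth.
  have pos N : 0 < eps N.
    by have [A [_ sm]] := Heps N; have [] := andP (sm_eps sm).
  (* Halving passes from the open boxes of [smooth_upto] to the closed ones of the statement; the
     radius depends on the total order alone. *)
  exists (fun N => eps N / 2); split=> [N|k t _ tk]; first by rewrite divr_gt0.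
  have [A [le sm]] := Heps (mi_deg k).
  apply: (pderivs_moments tau_real P le sm _ _).2; first by rewrite size_mi_dirs.
  move=> j; apply: le_lt_trans (tk j) _.
  by rewrite ltr_pdivrMr // ltr_pMr // ltr1n.
- move=> k P i.
  (* By linearity all terms become sums over the words of [P], to be compared word by word with
     [taylor_cons]. *)
  have -> : ncX R i * P = \sum_(w <- msupp P) P@_w *: << FMonom (i :: w) >>.
    rewrite {1}[P]malg_sumE mulr_sumr; apply: eq_bigr => w _.
    by rewrite malg_scalerAr; congr (_ *: _); rewrite ncXE -[w in LHS]fmK mulXX.
  rewrite taylorE lin_ext_sum.
  under [X in _ = X + _]eq_bigr do rewrite tensor_ncdiff mulr_sumr.
  rewrite exchange_big /=.
  have -> : \sum_(j < n) (k j)%:R * tau_mi tau (mi_sub k (mi_unit j))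
               ((cycdiff i << q j >> + cycdiff i (ncstar << q j >>)) * P) =
    \sum_(w <- msupp P) P@_w * (\sum_(p <- picks (mi_dirs k))
       \sum_(u <- pot_words q i p.1) taylor tau p.2 (u ++ w)).
    under [RHS]eq_bigr do rewrite (sum_picks_mi _ (fun p => \sum_(u <- pot_words q i p.1)
      taylor tau p.2 (u ++ _))) mulr_sumr.
    rewrite exchange_big /=; apply: eq_bigr => j _.
    rewrite {1}[P]malg_sumE mulr_sumr taylorE lin_ext_sum mulr_sumr; apply: eq_bigr => w _.
    rewrite malg_scalerAr lin_extZ ncstarU !cycdiffU mulrDl -[w in X in lin_ext _ X]fmK.
    rewrite !cycdiff_wordM -big_cat lin_ext_sum -[in RHS]mulr_natl [RHS]mulrCA.
    congr (_ * (_ * _)).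
    by apply: eq_bigr => u _; rewrite lin_extU.
  rewrite -big_split; apply: eq_bigr => w _; rewrite /= lin_extZ lin_extU.
  transitivity (P@_w * taylor tau (mi_dirs k) (i :: w)); first by [].
  rewrite (taylor_cons smooth) mulrDr; congr (_ + _).
  under [X in _ * X = _]eq_bigr => p _ do rewrite (sum_splits_mi k (fun ab => taylor tau ab.1 p.1.1 *
    taylor tau ab.2 p.2)).
  rewrite [X in _ * X = _]exchange_big mulr_sumr; apply: eq_bigr => c _.
  rewrite [RHS]mulrCA; congr (_ * _); rewrite mulr_sumr; apply: eq_bigr => p _.
  by rewrite !basisE mulr_natl.
- move=> k; rewrite malg1E basisE (taylor_nil smooth).
  have -> : nilp (mi_dirs k) = [forall j, k j == 0%N].
    rewrite /nilp size_mi_dirs /mi_deg sum_nat_eq0; apply: eq_forallb => j.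
    by rewrite implyTb.
  by case: [forall j, _].
- by move=> P k; rewrite -[P in LHS]fmK basisE (taylor_M smooth).
Qed.
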